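(* Let $0<l_1,l_2,l_3<\infty$ and let $\Omega\subset\mathbb{R}^3$ be a bounded convex domain contained in $(0,l_1)\times(0,l_2)\times(0,l_3)$. Let $\varepsilon=\mathrm{diag}(\varepsilon_1,\varepsilon_2,\varepsilon_3)$ with $\varepsilon_i\in L^\infty(\Omega)$ real valued, and suppose there are constants $\underline{\varepsilon}_i>0$ with $\underline{\varepsilon}_i\|\varphi\|^2_{L^2(\Omega)}\le(\varepsilon_i\varphi,\varphi)_{L^2(\Omega)}$ for all $\varphi\in L^2(\Omega)$, $i=1,2,3$, and a constant $\overline{\varepsilon}>0$ with $(\varepsilon\phi,\phi)_{L^2(\Omega)}\le\overline{\varepsilon}\|\phi\|^2_{L^2(\Omega)}$ for all $\phi\in L^2(\Omega)^3$. Then \[ c_{\mathrm m,\varepsilon}\le\frac1\pi\max\Big\{\Big(\tfrac{\underline{\varepsilon}_1}{l_1^2}+\tfrac{\underline{\varepsilon}_2}{l_2^2}+\tfrac{\underline{\varepsilon}_3}{l_3^2}\Big)^{-1/2},\ \sqrt{\overline{\varepsilon}}\,\mathrm{diam}(\Omega)\Big\}. \]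
   Context: $\|\phi\|_\varepsilon^2=(\varepsilon\phi,\phi)_{L^2(\Omega)}$. $D(\Omega)=\{\phi\in L^2(\Omega)^3:\operatorname{div}\phi\in L^2\}$, $R(\Omega)=\{\phi\in L^2(\Omega)^3:\operatorname{rot}\phi\in L^2\}$ (weak operators), $\mathring{R}(\Omega)$ the closure of $C_c^\infty(\Omega)^3$ in the graph norm of $R(\Omega)$, $\varepsilon^{-1}D(\Omega)=\{\phi:\varepsilon\phi\in D(\Omega)\}$. The tangential Maxwell constant $c_{\mathrm m,\varepsilon}$ is the smallest constant with $\|\phi\|_\varepsilon\le c_{\mathrm m,\varepsilon}\sqrt{\|\operatorname{div}\varepsilon\phi\|^2_{L^2}+\|\operatorname{rot}\phi\|^2_{L^2}}$ for all $\phi\in\mathring{R}(\Omega)\cap\varepsilon^{-1}D(\Omega)$. *)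

(* Defs.v *)
From HB Require Import structures.
From mathcomp Require Import all_boot all_order all_algebra.
From mathcomp Require Import all_classical all_reals all_analysis.
Set Implicit Arguments. Unset Strict Implicit. Unset Printing Implicit Defensive.
Import Order.TTheory GRing.Theory Num.Theory.
Import numFieldNormedType.Exports.
Local Open Scope classical_set_scope.
Local Open Scope ring_scope.

Definition pt (R : realType) := ((R * R) * R)%type.

Definition lam3 (R : realType) :=
  (((@lebesgue_measure R) \x (@lebesgue_measure R)) \x (@lebesgue_measure R))%E.

Definition coord (R : realType) (i : nat) (x : pt R) : R :=
  if i == 0%N then x.1.1 else if i == 1%N then x.1.2 else x.2.

Definition upd (R : realType) (i : nat) (x : pt R) (t : R) : pt R :=
  if i == 0%N then ((t, x.1.2), x.2)
  else if i == 1%N then ((x.1.1, t), x.2) else ((x.1.1, x.1.2), t).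

Definition partial (R : realType) (i : nat) (f : pt R -> R) (x : pt R) : R :=
  derive1 (fun t => f (upd i x t)) (coord i x).

Fixpoint iterD (R : realType) (ds : seq nat) (f : pt R -> R) : pt R -> R :=
  match ds with [::] => f | i :: ds' => partial i (iterD ds' f) end.

Definition smooth (R : realType) (f : pt R -> R) : Prop :=
  forall ds : seq nat, continuous (iterD ds f) /\
    forall (i : nat) (x : pt R),
      derivable (fun t => iterD ds f (upd i x t)) (coord i x) 1.

Definition test_fun (R : realType) (O : set (pt R)) (f : pt R -> R) : Prop :=
  smooth f /\ exists K : set (pt R), [/\ compact K, K `<=` O &
                                          forall x, ~ K x -> f x = 0].

(* Vector fields: component functions indexed by 0,1,2 *)
Definition vfield (R : realType) := nat -> pt R -> R.

Definition test_field (R : realType) (O : set (pt R)) (u : vfield R) : Prop :=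
  forall i, (i < 3)%N -> test_fun O (u i).

Definition rot (R : realType) (u : vfield R) : vfield R := fun i x =>
  if i == 0%N then partial 1 (u 2%N) x - partial 2 (u 1%N) x
  else if i == 1%N then partial 2 (u 0%N) x - partial 0 (u 2%N) x
  else partial 0 (u 1%N) x - partial 1 (u 0%N) x.

Definition L2 (R : realType) (O : set (pt R)) (f : pt R -> R) : Prop :=
  measurable_fun O f /\
  (\int[@lam3 R]_(x in O) ((f x) ^+ 2)%:E < +oo)%E.

Definition L2v (R : realType) (O : set (pt R)) (u : vfield R) : Prop :=
  forall i, (i < 3)%N -> L2 O (u i).

Definition ip (R : realType) (O : set (pt R)) (f g : pt R -> R) : R :=
  Rintegral (@lam3 R) O (fun x => f x * g x).

Definition ipv (R : realType) (O : set (pt R)) (u v : vfield R) : R :=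
  \sum_(i < 3) ip O (u i) (v i).

Definition weak_rot (R : realType) (O : set (pt R)) (u w : vfield R) : Prop :=
  forall chi, test_field O chi -> ipv O u (rot chi) = ipv O w chi.

Definition weak_div (R : realType) (O : set (pt R)) (u : vfield R)
  (g : pt R -> R) : Prop :=
  forall chi, test_fun O chi ->
    \sum_(i < 3) ip O (u i) (partial i chi) = - ip O g chi.

(* u (with weak curl w) lies in the closure of C_c^oo(O)^3 in the graph norm
   of R(O) *)
Definition in_Rcirc (R : realType) (O : set (pt R)) (u w : vfield R) : Prop :=
  exists chi : nat -> vfield R,
    (forall n, test_field O (chi n)) /\
    (fun n => ipv O (fun i x => chi n i x - u i x) (fun i x => chi n i x - u i x))
      @ \oo --> (0 : R) /\
    (fun n => ipv O (fun i x => rot (chi n) i x - w i x)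
                    (fun i x => rot (chi n) i x - w i x))
      @ \oo --> (0 : R).

Definition epsmul (R : realType) (e : vfield R) (u : vfield R) : vfield R :=
  fun i x => e i x * u i x.

Definition tangential_maxwell_estimate (R : realType) (O : set (pt R))
  (e : vfield R) (C : R) : Prop :=
  forall (u w : vfield R) (g : pt R -> R),
    L2v O u -> L2v O w -> weak_rot O u w -> in_Rcirc O u w ->
    L2 O g -> weak_div O (epsmul e u) g ->
    Num.sqrt (ipv O (epsmul e u) u) <= C * Num.sqrt (ip O g g + ipv O w w).

Definition edist (R : realType) (x y : pt R) : R :=
  Num.sqrt (\sum_(i < 3) (coord i x - coord i y) ^+ 2).

Definition diam (R : realType) (O : set (pt R)) : R :=
  sup [set d | exists x y, [/\ O x, O y & d = edist x y]].

Definition convex_set3 (R : realType) (O : set (pt R)) : Prop :=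
  forall x y t, O x -> O y -> 0 <= t <= 1 ->
    O ((t * x.1.1 + (1 - t) * y.1.1, t * x.1.2 + (1 - t) * y.1.2),
       t * x.2 + (1 - t) * y.2).

(* Main.v *)
Require Import Defs.
From HB Require Import structures.
From mathcomp Require Import all_boot all_order all_algebra.
From mathcomp Require Import all_classical all_reals all_analysis.
From mathcomp Require Import measurable_realfun ring lra.
Import Order.TTheory GRing.Theory Num.Theory.
Import numFieldNormedType.Exports.
Local Open Scope classical_set_scope.
Local Open Scope ring_scope.
Set Implicit Arguments.
Unset Strict Implicit.
Unset Printing Implicit Defensive.

(** Write N, P and D for the eps-norms of u, grad p and u - grad p, with p a test function.
    Since N^2 + P^2 = D^2 - 2 (g, p), the theorem follows from the Friedrichs inequality for p
    and from the claim that a test field chi is approximated by gradients of test functions in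
    L^2 up to (diam / pi) |rot chi|.

    For the claim, let h = w W with W smooth and convex on R^3, zero on the support of chi and
    of linear growth. The equation - Lap P + (|grad h|^2 + Lap h) P = - div chi has approximate
    solutions P of compact support in R^3; then v = chi - e^h grad (e^(-h) P) has the twisted
    rotation rot chi and a small twisted divergence. In the twisted Gaffney identity the
    convexity of W yields a term of good sign, and the multiplier X = - grad G / G, with G an
    explicit function of the distance to a point m, gives the lower bound (pi / diam)^2 |v|^2
    on the ball of radius 2 diam / pi around m. By Jung's theorem such a ball contains the
    domain, because pi^2 < 32 / 3. For large w the mass of v near and outside the boundary is
    small, so that e^(-h) P can be cut off. *)

(** On a convex domain the rotational part is usually treated by a Gaffney inequality whose boundary
    term is signed by the curvature, which asks for boundary regularity. Here no boundary appears:
    e^(-h) with large w acts as the wall, the Hessian of h replaces the curvature, and every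
    integration by parts concerns smooth fields of bounded support on R^3. The price is that P and v
    leave the domain, so their mass in the collar W > 1 must be controlled.

    The twist is a conjugation: the twisted rotation is e^h rot e^(-h), and since h = 0 on the
    support of chi, e^(-h) v = chi - grad (e^(-h) P). Thus e^(-h) P is the gradient correction that
    is sought, and rot chi is unchanged.

    The maximum of two constants, not their sum, arises as follows: with k = pi^2 times the sum of
    the eps_i / l_i^2 (lower bounds), - 2 (g, p) <= |g|^2 / k + k |p|^2, and k |p|^2 <= P^2 cancels
    the P^2 on the left. What remains is D^2, governed by rot u alone, and |g|^2 / k, governed by
    the divergence alone. An exact Helmholtz decomposition is thereby replaced by a test function
    p. *)

Local Notation coord := Defs.coord.

(** * Partial derivatives and functions of class C^k on R^3 *)

Section Calculus.
Variable R : realType.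
Implicit Types (f g h : pt R -> R) (x y z : pt R) (t : R).

Lemma coord_upd i x t : coord i (upd i x t) = t.
Proof. by rewrite /coord /upd; case: i => [|[|i]]. Qed.

Lemma upd_coord i x : upd i x (coord i x) = x.
Proof. by case: x => [[a b] c]; rewrite /coord /upd; case: i => [|[|i]]. Qed.

Lemma upd_upd i x t t' : upd i (upd i x t) t' = upd i x t'.
Proof. by rewrite /upd; case: i => [|[|i]]. Qed.

Lemma coord_upd_neq i j x t :
  (i < 3)%N -> (j < 3)%N -> i != j -> coord j (upd i x t) = coord j x.
Proof. by move: i j => [|[|[|i]]] [|[|[|j]]]. Qed.

Lemma upd_comm i j x t t' : (i < 3)%N -> (j < 3)%N -> i != j ->
  upd i (upd j x t') t = upd j (upd i x t) t'.
Proof. by move: i j => [|[|[|i]]] [|[|[|j]]]. Qed.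

(** A relation rather than a value: the derivative of a composite expression is found by applying
    the rules below and unifying, and [partial_val] reads off the result. *)
Definition pD i f x d := is_derive (coord i x) (1 : R) (fun t => f (upd i x t)) d.

Lemma partial_val i f x d : pD i f x d -> partial i f x = d.
Proof. by move=> H; rewrite /partial derive1E; exact: derive_val. Qed.

Lemma pDP i f x : derivable (fun t => f (upd i x t)) (coord i x) 1 ->
  pD i f x (partial i f x).
Proof. by move=> H; rewrite /pD /partial derive1E; exact: derivableP. Qed.

Lemma pD_der i f x d : pD i f x d -> derivable (fun t => f (upd i x t)) (coord i x) 1.
Proof. by case. Qed.

Lemma pD_cst i (c : R) x : pD i (fun=> c) x 0.
Proof. exact: is_derive_cst. Qed.

Lemma pD_add i f g x df dg : pD i f x df -> pD i g x dg ->
  pD i (fun x => f x + g x) x (df + dg).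
Proof. by move=> H K; exact: (is_deriveD H K). Qed.

Lemma pD_opp i f x df : pD i f x df -> pD i (fun x => - f x) x (- df).
Proof. by move=> H; exact: (is_deriveN H). Qed.

Lemma pD_mul i f g x df dg : pD i f x df -> pD i g x dg ->
  pD i (fun x => f x * g x) x (df * g x + f x * dg).
Proof.
move=> H K; have := is_deriveM H K; rewrite upd_coord /GRing.scale /=.
by rewrite (mulrC (g x)) addrC; apply.
Qed.

Lemma pD_comp i (F : R -> R) f x df dF : is_derive (f x) (1 : R) F dF -> pD i f x df ->
  pD i (fun x => F (f x)) x (dF * df).
Proof.
move=> H K; apply: (@is_derive1_comp R F (fun t => f (upd i x t))) => //.
by rewrite upd_coord.
Qed.

Lemma pD_coord_same i x : pD i (coord i) x 1.
Proof.
rewrite /pD (_ : (fun t => coord i (upd i x t)) = id); first exact: is_derive_id.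
by apply/funext => t; rewrite coord_upd.
Qed.

Lemma pD_coord_neq i j x : (i < 3)%N -> (j < 3)%N -> i != j -> pD i (coord j) x 0.
Proof.
move=> hi hj ij; rewrite /pD (_ : (fun t => coord j (upd i x t)) = (fun=> coord j x)).
  exact: is_derive_cst.
by apply/funext => t; rewrite coord_upd_neq.
Qed.

(** Smoothness becomes an induction on k in which products and compositions need one derivative at a
    time; [smooth_Ck] relates it to the iterated partials. *)
Fixpoint Ck (k : nat) f : Prop := continuous f /\
  match k with
  | 0%N => True
  | k'.+1 => (forall i x, derivable (fun t => f (upd i x t)) (coord i x) 1) /\
             forall i, Ck k' (partial i f)
  end.

Lemma Ck_cont k f : Ck k f -> continuous f.
Proof. by case: k => [|k] []. Qed.

Lemma Ck_pD k i f x : Ck k.+1 f -> pD i f x (partial i f x).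
Proof. by move=> [_ [H _]]; exact: pDP. Qed.

Lemma Ck_partial k i f : Ck k.+1 f -> Ck k (partial i f).
Proof. by move=> [_ [_ H]]; exact: H. Qed.

Lemma CkSW k f : Ck k.+1 f -> Ck k f.
Proof.
elim: k f => [f [H _] //|k IH f [cf [df H]]]; split => //; split => // i.
by apply: IH; exact: H.
Qed.

Lemma Ck_intro k f (df : nat -> pt R -> R) : continuous f ->
  (forall i x, pD i f x (df i x)) -> (forall i, Ck k (df i)) -> Ck k.+1 f.
Proof.
move=> cf H K; split => //; split => [i x|i]; first exact: pD_der (H i x).
by rewrite (_ : partial i f = df i) //; apply/funext => x; apply: partial_val.
Qed.

Lemma Ck_cst k (c : R) : Ck k (fun=> c).
Proof.
elim: k c => [|k IH] c; first by split => // x; exact: cvg_cst.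
apply: (@Ck_intro _ _ (fun _ _ => 0)) => //; first by move=> x; exact: cvg_cst.
by move=> i x; exact: pD_cst.
Qed.

Lemma Ck_add k f g : Ck k f -> Ck k g -> Ck k (fun x => f x + g x).
Proof.
elim: k f g => [|k IH] f g Hf Hg.
  by split => // x; apply: cvgD; [exact: (Ck_cont Hf)|exact: (Ck_cont Hg)].
apply: (@Ck_intro _ _ (fun i x => partial i f x + partial i g x)).
- by move=> x; apply: cvgD; [exact: (Ck_cont Hf)|exact: (Ck_cont Hg)].
- by move=> i x; apply: pD_add; (apply: Ck_pD; eassumption).
- by move=> i; apply: IH; exact: Ck_partial.
Qed.

Lemma Ck_opp k f : Ck k f -> Ck k (fun x => - f x).
Proof.
elim: k f => [|k IH] f Hf.
  by split => // x; apply: cvgN; exact: (Ck_cont Hf).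
apply: (@Ck_intro _ _ (fun i x => - partial i f x)).
- by move=> x; apply: cvgN; exact: (Ck_cont Hf).
- by move=> i x; apply: pD_opp; (apply: Ck_pD; eassumption).
- by move=> i; apply: IH; exact: Ck_partial.
Qed.

Lemma Ck_sub k f g : Ck k f -> Ck k g -> Ck k (fun x => f x - g x).
Proof. by move=> Hf Hg; apply: Ck_add => //; exact: Ck_opp. Qed.

Lemma Ck_mul k f g : Ck k f -> Ck k g -> Ck k (fun x => f x * g x).
Proof.
elim: k f g => [|k IH] f g Hf Hg.
  by split => // x; apply: cvgM; [exact: (Ck_cont Hf)|exact: (Ck_cont Hg)].
apply: (@Ck_intro _ _ (fun i x => partial i f x * g x + f x * partial i g x)).
- by move=> x; apply: cvgM; [exact: (Ck_cont Hf)|exact: (Ck_cont Hg)].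
- by move=> i x; apply: pD_mul; (apply: Ck_pD; eassumption).
- by move=> i; apply: Ck_add; apply: IH => //; try exact: Ck_partial; exact: CkSW.
Qed.

Lemma Ck_exp k f n : Ck k f -> Ck k (fun x => f x ^+ n).
Proof.
move=> Hf; elim: n => [|n IH]; first by under eq_fun do rewrite expr0; exact: Ck_cst.
by under eq_fun do rewrite exprS; exact: Ck_mul.
Qed.

Lemma continuous_coord i : continuous (@coord R i).
Proof.
move=> x; rewrite /coord; case: i => [|[|i]] /=.
- by apply: (@continuous_comp _ _ _ fst fst); [exact: cvg_fst|exact: cvg_fst].
- by apply: (@continuous_comp _ _ _ fst snd); [exact: cvg_fst|exact: cvg_snd].
- exact: cvg_snd.
Qed.

Lemma coord_ge2 i : @coord R i.+2 = coord 2. Proof. by []. Qed.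

Lemma Ck_coord k i : Ck k (@coord R i).
Proof.
suff H j : (j < 3)%N -> Ck k (@coord R j).
  case: i => [|[|i]]; [exact: H|exact: H|rewrite coord_ge2; exact: H].
move=> hj; case: k => [|k]; first by split => //; exact: continuous_coord.
(* Every index above 2 denotes the third coordinate, so indices are truncated before they are
   compared. *)
pose m i := if (i < 2)%N then i else 2%N.
have hm i' : (m i' < 3)%N by rewrite /m; case: (ltnP i' 2) => // h; exact: leq_trans h _.
apply: (@Ck_intro _ _ (fun i _ => (m i == j)%:R)).
- exact: continuous_coord.
- move=> i' x; have -> : pD i' (coord j) x = pD (m i') (coord j) x.
    by rewrite /pD /m; case: i' => [|[|i']].
  case: eqP => [<-|/eqP ne]; first exact: pD_coord_same.
  exact: pD_coord_neq.
- by move=> i'; exact: Ck_cst.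
Qed.

Lemma smooth_Ck f : Defs.smooth f <-> forall k, Ck k f.
Proof.
have sp g i : Defs.smooth g -> Defs.smooth (partial i g).
  move=> H ds; have := H (rcons ds i).
  have -> : Defs.iterD (rcons ds i) g = Defs.iterD ds (partial i g) by elim: ds => //= j ds ->.
  by [].
split.
  move=> H k; elim: k f H => [|k IH] f H; first by split => //; exact: (H [::]).1.
  split; first exact: (H [::]).1.
  split => [i x|i]; first exact: (H [::]).2.
  by apply: IH; exact: sp.
move=> H ds.
suff K : forall k, Ck k (Defs.iterD ds f).
  by split; [exact: (Ck_cont (K 0%N))|move=> i x; case: (K 1%N) => _ [H1 _]; exact: H1].
elim: ds => //= i ds IH k; apply: Ck_partial; exact: IH.
Qed.

Lemma partialM k i f g : Ck k.+1 f -> Ck k.+1 g ->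
  partial i (fun x => f x * g x) = fun x => partial i f x * g x + f x * partial i g x.
Proof.
by move=> Hf Hg; apply/funext => x; apply/partial_val/pD_mul; (apply: Ck_pD; eassumption).
Qed.

Lemma partial_cst i (c : R) : partial i (fun=> c) = fun=> 0.
Proof. by apply/funext => x; apply: partial_val; exact: pD_cst. Qed.

Lemma partialZ k i f (c : R) : Ck k.+1 f ->
  partial i (fun x => c * f x) = fun x => c * partial i f x.
Proof.
move=> Hf; rewrite (partialM i (Ck_cst k.+1 c) Hf) partial_cst.
by apply/funext => x; rewrite mul0r add0r.
Qed.

Lemma partial_coord i j : (i < 3)%N -> (j < 3)%N ->
  partial i (@coord R j) = fun=> (i == j)%:R.
Proof.
move=> hi hj; apply/funext => x; apply: partial_val.
case: eqP => [<-|/eqP ne]; first exact: pD_coord_same.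
exact: pD_coord_neq.
Qed.

Lemma Ck_expR k f : Ck k f -> Ck k (fun x => expR (f x)).
Proof.
elim: k f => [|k IH] f Hf.
  split => // x; apply: continuous_comp; [exact: (Ck_cont Hf)|exact: continuous_expR].
apply: (@Ck_intro _ _ (fun i x => expR (f x) * partial i f x)).
- move=> x; apply: continuous_comp; [exact: (Ck_cont Hf)|exact: continuous_expR].
- move=> i x; apply: (@pD_comp i expR); apply: Ck_pD; eassumption.
- by move=> i; apply: Ck_mul; [apply: IH; exact: CkSW|exact: Ck_partial].
Qed.

Lemma partial_expR k i f : Ck k.+1 f ->
  partial i (fun x => expR (f x)) = fun x => expR (f x) * partial i f x.
Proof.
move=> Hf; apply/funext => x; apply: partial_val.
by apply: (@pD_comp i expR); apply: Ck_pD; eassumption.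
Qed.

Lemma pD_inv i f x df : f x != 0 -> pD i f x df ->
  pD i (fun x => (f x)^-1) x (- (f x) ^- 2 * df).
Proof.
move=> f0 H; rewrite /pD.
have f0' : (fun t => f (upd i x t)) (coord i x) != 0 by rewrite upd_coord.
by have := is_deriveV f0' H; rewrite upd_coord.
Qed.

Lemma Ck_inv k f : (forall x, f x != 0) -> Ck k f -> Ck k (fun x => (f x)^-1).
Proof.
move=> f0; have ci : continuous f -> continuous (fun x => (f x)^-1).
  by move=> cf x; apply: cvgV => //; exact: cf.
elim: k => [|k IH] Hf; first by split => //; apply: ci; exact: Ck_cont Hf.
apply: (@Ck_intro _ _ (fun i x => - (f x)^-1 ^+ 2 * partial i f x)).
- exact/ci/(Ck_cont Hf).
- by move=> i x; rewrite exprVn; apply: pD_inv => //; (apply: Ck_pD; eassumption).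
- move=> i; apply: Ck_mul; last exact: Ck_partial.
  by apply/Ck_opp/Ck_exp/IH; exact: CkSW.
Qed.

End Calculus.

(** * Mean values, symmetry of second derivatives, flat functions *)

Section MeanValue.
Variable R : realType.
Implicit Types (f g : pt R -> R) (x y z : pt R) (t : R).

(** The product norm is the sup norm: balls are boxes, and their volume can be read off the product
    measure. *)
Lemma normpt_le x (r : R) :
  (`|x| <= r) = [&& `|coord 0 x| <= r, `|coord 1 x| <= r & `|coord 2 x| <= r].
Proof. by rewrite prod_normE ge_max prod_normE ge_max -andbA. Qed.

Lemma normpt_coord i x : `|coord i x| <= `|x|.
Proof.
have := lexx `|x|; rewrite {1}normpt_le => /and3P[h0 h1 h2].
by case: i => [|[|i]].
Qed.

Lemma coordD i x y : coord i (x + y) = coord i x + coord i y.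
Proof. by case: i => [|[|i]]. Qed.
Lemma coordB i x y : coord i (x - y) = coord i x - coord i y.
Proof. by case: i => [|[|i]]. Qed.
Lemma coordN i x : coord i (- x) = - coord i x.
Proof. by case: i => [|[|i]]. Qed.
Lemma coordZ i t x : coord i (t *: x) = t * coord i x.
Proof. by case: i => [|[|i]]. Qed.

Lemma is_derive_continuous (F : R -> R) t d : is_derive t (1 : R) F d -> {for t, continuous F}.
Proof.
move=> H; apply: differentiable_continuous; apply/derivable1_diffP; exact: (@ex_derive _ _ _ _ _ _ _ H).
Qed.

Lemma der_upd k i f x t : Ck k.+1 f ->
  is_derive t (1 : R) (fun s => f (upd i x s)) (partial i f (upd i x t)).
Proof.
move=> Hf; have := Ck_pD i (upd i x t) Hf; rewrite /pD coord_upd.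
by under eq_fun do rewrite upd_upd.
Qed.

Lemma MVT_abs (F dF : R -> R) (a b : R) : (forall t, is_derive t (1 : R) F (dF t)) ->
  exists2 c, `|c - a| <= `|b - a| & F b - F a = dF c * (b - a).
Proof.
move=> H; have cF A : {within A, continuous F}.
  by apply: continuous_subspaceT => t; exact: (is_derive_continuous (H t)).
have [ab|ba] := leP a b.
  have [c] := @MVT_segment R F dF a b ab (fun t _ => H t) (cF _).
  rewrite in_itv /= => /andP[ac cb] e; exists c => //.
  by rewrite !ger0_norm ?subr_ge0 // lerD2r.
have [c] := @MVT_segment R F dF b a (ltW ba) (fun t _ => H t) (cF _).
rewrite in_itv /= => /andP[bc ca] e; exists c.
  by rewrite !ler0_norm ?subr_le0 ?(ltW ba) // lerN2 lerD2r.
by rewrite -opprB e -mulrN opprB.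
Qed.

(** The segment from x to y is replaced by a path along the axes, so that only partial derivatives
    occur; the intermediate points stay in the ball of radius |y - x| about x. *)
Lemma MVT_pt k f x y : Ck k.+1 f -> exists p : nat -> pt R,
  (forall i, `|p i - x| <= `|y - x|) /\
  f y - f x = \sum_(i < 3) partial i f (p i) * (coord i y - coord i x).
Proof.
move=> Hf.
have [c0 h0 e0] := MVT_abs x.1.1 y.1.1 (fun t => der_upd 0 x t Hf).
have [c1 h1 e1] := MVT_abs x.1.2 y.1.2 (fun t => der_upd 1 ((y.1.1, x.1.2), x.2) t Hf).
have [c2 h2 e2] := MVT_abs x.2 y.2 (fun t => der_upd 2 ((y.1.1, y.1.2), x.2) t Hf).
exists (fun i => if i == 0%N then ((c0, x.1.2), x.2) else
   if i == 1%N then ((y.1.1, c1), x.2) else ((y.1.1, y.1.2), c2)); split.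
  have k0 : `|y.1.1 - x.1.1| <= `|y - x| by exact: (normpt_coord 0 (y - x)).
  have k1 : `|y.1.2 - x.1.2| <= `|y - x| by exact: (normpt_coord 1 (y - x)).
  have k2 : `|y.2 - x.2| <= `|y - x| by exact: (normpt_coord 2 (y - x)).
  by case => [|[|i]] /=; rewrite normpt_le /coord /= ?subrr ?normr0 ?normr_ge0 /= ?k0 ?k1 ?k2
    ?(le_trans h0 k0) ?(le_trans h1 k1) ?(le_trans h2 k2).
rewrite !big_ord_recl big_ord0 addr0 /= /coord /=.
move: e0 e1 e2; rewrite /upd /= => <- <- <-.
case: x {h0 h1 h2} => [[x0 x1] x2]; case: y => [[y0 y1] y2] /=; ring.
Qed.

Lemma near_pt (P : pt R -> Prop) x :
  (\forall y \near x, P y) <-> exists2 d, 0 < d & forall y, `|y - x| < d -> P y.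
Proof.
split.
  move=> /nbhs_ballP[d /= d0 H]; exists d => // y h; apply: H.
  by rewrite -ball_normE /ball_ /= distrC.
move=> [d d0 H]; apply/nbhs_ballP; exists d => //= y.
by rewrite -ball_normE /ball_ /= distrC; exact: H.
Qed.

Lemma continuous_near f x (e : R) : continuous f -> 0 < e ->
  exists2 d, 0 < d & forall y, `|y - x| < d -> `|f y - f x| < e.
Proof.
move=> cf e0; apply/near_pt.
by have /cvgrPdist_lt/(_ e e0) := cf x; apply: filterS => y; rewrite distrC.
Qed.

(** Continuity of the partials suffices for this chain rule: [MVT_pt] evaluates the difference
    quotient at points that tend to [z]. *)
Lemma der_line k f x (u : pt R) t : Ck k.+1 f ->
  is_derive t (1 : R) (fun s => f (x + s *: u))
    (\sum_(i < 3) partial i f (x + t *: u) * coord i u).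
Proof.
move=> Hf; set l := (X in is_derive _ _ _ X).
suff C : (fun h : R => h^-1 *: ((fun s => f (x + s *: u)) (h *: 1 + t) -
                  (fun s => f (x + s *: u)) t)) @ 0^' --> l.
  by apply: DeriveDef; [apply/cvg_ex; exists l|exact: cvg_lim C].
apply/cvgrPdist_le => e e0; set z := x + t *: u.
pose M := 1 + `|u|.
have M0 : 0 < M by rewrite /M ltr_pwDl.
have eM : 0 < e / (3 * M) by rewrite divr_gt0 // mulr_gt0.
have cp i := Ck_cont (Ck_partial i Hf).
have [d0 d00 D0] := continuous_near z (cp 0%N) eM.
have [d1 d10 D1] := continuous_near z (cp 1%N) eM.
have [d2 d20 D2] := continuous_near z (cp 2%N) eM.
near=> h.
have h0 : h != 0 by near: h; exact: nbhs_dnbhs_neq.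
have hd : `|h| < Num.min d0 (Num.min d1 d2) / M.
  near: h; apply: dnbhs0_lt; by rewrite divr_gt0 // !lt_min d00 d10 d20.
rewrite /= /GRing.scale /= mulr1.
have [p [hp ->]] := MVT_pt z (x + (h + t) *: u) Hf.
have hz : x + (h + t) *: u - z = h *: u by rewrite /z scalerDl opprD addrACA subrr add0r addrK.
have hp' i : `|p i - z| < Num.min d0 (Num.min d1 d2).
  apply: (le_lt_trans (hp i)); rewrite hz normrZ.
  apply: (@le_lt_trans _ _ (`|h| * M)); last by rewrite -ltr_pdivlMr.
  by rewrite ler_wpM2l // /M lerDr.
rewrite mulr_sumr /l -sumrB.
under eq_bigr => i _.
  rewrite -coordB hz coordZ (_ : _ - _ = (partial i f z - partial i f (p i)) * coord i u).
    over.
  by rewrite mulrBl; congr (_ - _); rewrite [RHS]mulrC; field.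
have hi (i : 'I_3) : `|(partial i f z - partial i f (p i)) * coord i u| <= e / 3.
  rewrite normrM (@le_trans _ _ (e / (3 * M) * M)) //.
    apply: ler_pM => //; last by rewrite /M (le_trans (normpt_coord _ _)) // lerDr.
    have := hp' i; rewrite !lt_min => /and3P[a0 a1 a2]; rewrite distrC ltW //.
    by move: a0 a1 a2; case: i => [[|[|[|i]]] hi] //= a0 a1 a2; [exact: D0|exact: D1|exact: D2].
  by rewrite le_eqVlt; apply/orP; left; apply/eqP; field; rewrite gt_eqF.
apply: (le_trans (ler_norm_sum _ _ _)).
apply: (@le_trans _ _ (\sum_(i < 3) e / 3)); first by apply: ler_sum => i _; exact: hi.
by rewrite sumr_const card_ord -mulr_natr le_eqVlt; apply/orP; left; apply/eqP; field.
Unshelve. all: by end_near.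
Qed.

Lemma Lipschitz_pt k f x y (L : R) : Ck k.+1 f ->
  (forall z i, `|z - x| <= `|y - x| -> `|partial i f z| <= L) ->
  `|f y - f x| <= 3 * L * `|y - x|.
Proof.
move=> Hf H; have [p [hp ->]] := MVT_pt x y Hf.
apply: (le_trans (ler_norm_sum _ _ _)).
apply: (@le_trans _ _ (\sum_(i < 3) L * `|y - x|)).
  apply: ler_sum => i _; rewrite normrM ler_pM //; first exact: H.
  by rewrite -coordB normpt_coord.
by rewrite sumr_const card_ord -mulrA mulr_natl.
Qed.

Lemma normpt_upd i x t : `|upd i x t - x| = `|t - coord i x|.
Proof.
apply/le_anti; rewrite normpt_le; apply/andP; split; last first.
  by rewrite -{1}(coord_upd i x t) -coordB normpt_coord.
case: x => [[a b] c]; case: i => [|[|i]];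
  by rewrite /coord /upd /= ?subrr ?normr0 ?normr_ge0 ?lexx.
Qed.

Lemma partial_near i f g x : (\forall y \near x, f y = g y) -> partial i f x = partial i g x.
Proof.
move=> /near_pt[d d0 H]; rewrite /partial !derive1E; apply: near_eq_derive.
near=> t; apply: H.
have : `|t - coord i x| < d.
  by near: t; apply/nbhs_ballP; exists d => //= s; rewrite -ball_normE /= distrC.
by rewrite normpt_upd.
Unshelve. all: by end_near.
Qed.

(** Two mean values, along i and then along j. The left side is symmetric in i and j, whence the
    symmetry of second derivatives. *)
Lemma second_difference k i j f x (h : R) : (i < 3)%N -> (j < 3)%N -> i != j -> Ck k.+2 f ->
  exists2 p, `|p - x| <= `|h| &
  f (upd j (upd i x (coord i x + h)) (coord j x + h)) - f (upd i x (coord i x + h)) -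
  f (upd j x (coord j x + h)) + f x = partial j (partial i f) p * h ^+ 2.
Proof.
move=> hi hj ij Hf; set a := coord i x; set b := coord j x.
have [c hc ec] := MVT_abs a (a + h)
  (fun t => is_deriveB (der_upd i (upd j x (b + h)) t Hf) (der_upd i x t Hf)).
have [c' hc' ec'] := MVT_abs b (b + h) (fun t => der_upd j (upd i x c) t (Ck_partial i Hf)).
exists (upd j (upd i x c) c').
  rewrite normpt_le; move: hc hc'; rewrite ![_ + h]addrC !addrK /a /b.
  by move: i j hi hj ij {ec ec' a b} => [|[|[|i]]] [|[|[|j]]] // _ _ _;
     rewrite /coord /upd /= => -> ->; rewrite subrr normr0 normr_ge0.
have E1 : upd i (upd j x (b + h)) c = upd j (upd i x c) (b + h) by rewrite upd_comm.
have E2 : upd j (upd i x c) b = upd i x c.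
  by rewrite -[in RHS](upd_coord j (upd i x c)) coord_upd_neq.
have E3 : upd i (upd j x (b + h)) (coord i x) = upd j x (b + h).
  by rewrite -[RHS](upd_coord i) coord_upd_neq // eq_sym.
have E4 : upd i (upd j x (b + h)) (a + h) = upd j (upd i x (coord i x + h)) (b + h).
  by rewrite upd_comm.
rewrite E2 in ec'; rewrite E1 ec' /a in ec.
move: ec; rewrite !fctE E3 E4 upd_coord => e.
rewrite [LHS](_ : _ = (f (upd j (upd i x (coord i x + h)) (b + h)) - f (upd i x (coord i x + h)))
  - (f (upd j x (b + h)) - f x)); last by ring.
rewrite e; ring.
Qed.

Lemma partial_comm k i j f x : (i < 3)%N -> (j < 3)%N -> Ck k.+2 f ->
  partial i (partial j f) x = partial j (partial i f) x.
Proof.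
move=> hi hj Hf; have [->//|ij] := eqVneq i j.
apply/eqP; rewrite -subr_eq0 -normr_le0; apply/ler_addgt0Pl => e e0; rewrite addr0.
have e2 : 0 < e / 2 by rewrite divr_gt0.
have cc i' j' := Ck_cont (Ck_partial i' (Ck_partial j' Hf)).
have [d d0 D] := continuous_near x (cc i j) e2.
have [d' d'0 D'] := continuous_near x (cc j i) e2.
pose h := Num.min d d' / 2.
have h0 : 0 < h by rewrite /h divr_gt0 // lt_min d0 d'0.
have hd : `|h| < d /\ `|h| < d'.
  rewrite (gtr0_norm h0) /h; split.
    by rewrite (@le_lt_trans _ _ (d / 2)) ?ler_pM2r ?invr_gt0 ?ge_min ?lexx //; lra.
  by rewrite (@le_lt_trans _ _ (d' / 2)) ?ler_pM2r ?invr_gt0 ?ge_min ?lexx ?orbT //; lra.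
have [p hp ep] := second_difference x h hi hj ij Hf.
have ji : j != i by rewrite eq_sym.
have [q hq eq] := second_difference x h hj hi ji Hf.
have {ep eq} pq : partial j (partial i f) p = partial i (partial j f) q.
  have h2 : h ^+ 2 != 0 by rewrite expf_neq0 // gt_eqF.
  apply: (mulIf h2); apply: etrans (esym ep) _; apply: etrans _ eq.
  rewrite (upd_comm _ _ _ hj hi) //.
  move: (f _) (f _) (f _) (f _) => u1 u2 u3 u4; ring.
have a1 := D q (le_lt_trans hq hd.1).
have := D' p (le_lt_trans hp hd.2); rewrite pq => a2 {pq D D' cc}.
move: (partial i _ x) (partial j _ x) (partial i _ q) a1 a2 => u v w a1 a2.
apply: (le_trans (ler_distD w _ _)); rewrite [e in leRHS]splitr.
by apply: lerD; apply: ltW => //; rewrite distrC.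
Qed.

(** The family over m is closed under differentiation up to linear combinations, so the smoothness
    of bumps and smooth steps follows by induction. *)
Definition expinv (m : nat) t := if 0 < t then t^-1 ^+ m * expR (- t^-1) else 0.

Lemma expinv_ge0 m t : 0 <= expinv m t.
Proof.
rewrite /expinv; case: ifP => // t0.
by rewrite mulr_ge0 ?expR_ge0 // exprn_ge0 // invr_ge0 ltW.
Qed.

(** The term of order m + 2 of the exponential series in 1 / t beats t^(-m); a quadratic bound
    yields derivative 0 at the origin. *)
Lemma expinv_le m t : expinv m t <= (m.+2)`!%:R * t ^+ 2.
Proof.
rewrite /expinv; case: ifP => [t0|_]; last by rewrite mulr_ge0 // sqr_ge0.
have u0 : 0 < t^-1 by rewrite invr_gt0.
have F0 : 0 < (m.+2)`!%:R :> R by rewrite ltr0n fact_gt0.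
have := expR_ge1Dxn m.+1 (ltW u0) => H.
have H1 : t^-1 ^+ m.+2 <= (m.+2)`!%:R * expR t^-1.
  by rewrite mulrC -ler_pdivrMr // (le_trans _ H) // lerDr.
rewrite expRN ler_pdivrMr ?expR_gt0 // mulrAC.
have -> : t^-1 ^+ m = t^-1 ^+ m.+2 * t ^+ 2.
  by rewrite -[m.+2]addn2 exprD -mulrA -exprMn mulVf ?gt_eqF // expr1n mulr1.
by rewrite ler_wpM2r // sqr_ge0.
Qed.

Lemma is_derive_expinv m t :
  is_derive t (1 : R) (expinv m) (expinv m.+2 t - m%:R * expinv m.+1 t).
Proof.
have [t0|t0|->] := ltgtP t 0.
- rewrite /expinv ltNge (ltW t0) /= mulr0 subr0.
  have H : is_derive t (1 : R) (fun _ : R => 0 : R) 0 by exact: is_derive_cst.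
  apply: (near_eq_is_derive _ H).
  near=> u; rewrite ifF //; apply/negbTE; rewrite -leNgt.
  by apply: ltW; near: u; exact: lt_nbhsl.
- rewrite /expinv t0.
  have H1 : is_derive t (1 : R) (fun s : R => s^-1) (- t ^- 2).
    have := @is_deriveV R id t 1 1 (lt0r_neq0 t0) (is_derive_id _ _).
    by rewrite /GRing.scale /= mulr1.
  have H2 := is_deriveX m H1; rewrite exprfctE in H2.
  have H3 : is_derive t (1 : R) (fun s : R => expR (- s^-1)) (expR (- t^-1) * (t ^- 2)).
    have H1' : is_derive t (1 : R) (fun s : R => - s^-1) (t ^- 2).
      by have := is_deriveN H1; rewrite opprK.
    exact: (@is_derive1_comp R expR (fun s : R => - s^-1)).
  have H := is_deriveM H2 H3.
  have H' : is_derive t (1 : R) (fun s : R => s^-1 ^+ m * expR (- s^-1))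
      (t^-1 ^+ m.+2 * expR (- t^-1) - m%:R * (t^-1 ^+ m.+1 * expR (- t^-1))).
    suff <- : t^-1 ^+ m *: (expR (- t^-1) * t ^- 2) +
       expR (- t^-1) *: ((m%:R * t^-1 ^+ m.-1) *: - t ^- 2) =
       t^-1 ^+ m.+2 * expR (- t^-1) - m%:R * (t^-1 ^+ m.+1 * expR (- t^-1)) by exact: H.
    rewrite /GRing.scale /= -exprVn; case: m {H2 H} => [|m]; first by ring.
    by rewrite /= !exprS; ring.
  apply: (near_eq_is_derive _ H').
  near=> u; rewrite ifT //; near: u; exact: lt_nbhsr.
- have e0 k : expinv k 0 = 0 by rewrite /expinv ltxx.
  rewrite !e0 mulr0 subr0.
  suff C : (fun u : R => u^-1 *: (expinv m (u *: 1 + 0) - expinv m 0)) @ 0^' --> (0 : R).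
    by apply: DeriveDef; [apply/cvg_ex; exists 0|exact: cvg_lim C].
  have F0 : 0 < (m.+2)`!%:R :> R by rewrite ltr0n fact_gt0.
  apply/cvgrPdist_le => e ep; near=> u.
  have u0 : u != 0 by near: u; exact: nbhs_dnbhs_neq.
  have ue : `|u| < e / (m.+2)`!%:R by near: u; apply: dnbhs0_lt; rewrite divr_gt0.
  rewrite e0 subr0 addr0 sub0r normrN /GRing.scale /= mulr1 normrM normfV.
  rewrite (ger0_norm (expinv_ge0 _ _)) ler_pdivrMl ?normr_gt0 //.
  apply: (le_trans (expinv_le _ _)); rewrite -real_normK ?num_real // expr2 mulrCA.
  rewrite ler_wpM2l // mulrC -ler_pdivlMr //; exact: ltW.
Unshelve. all: by end_near.
Qed.

Lemma Ck_expinv k m f : Ck k f -> Ck k (fun x => expinv m (f x)).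
Proof.
have cp n g : continuous g -> continuous (fun x => expinv n (g x)).
  move=> cg x; apply: (@continuous_comp _ _ _ g (expinv n)); first exact: cg.
  exact: (is_derive_continuous (is_derive_expinv n _)).
elim: k m => [|k IH] m Hf; first by split => //; exact/cp/(Ck_cont Hf).
apply: (@Ck_intro _ _ _ (fun i x => (expinv m.+2 (f x) - m%:R * expinv m.+1 (f x)) * partial i f x)).
- exact/cp/(Ck_cont Hf).
- move=> i x; apply: (@pD_comp _ i (expinv m)); last (apply: Ck_pD; eassumption).
  exact: is_derive_expinv.
- move=> i; have Hf' := CkSW Hf; apply: Ck_mul; last exact: Ck_partial.
  by apply: Ck_sub; [exact: IH|apply: Ck_mul; [exact: Ck_cst|exact: IH]].
Qed.

End MeanValue.

(** * Integration of continuous functions of bounded support *)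

Section Integral.
Variable R : realType.
Implicit Types (f g h : pt R -> R) (x y z : pt R) (t r : R).

Lemma normpt_lt x r :
  (`|x| < r) = [&& `|coord 0 x| < r, `|coord 1 x| < r & `|coord 2 x| < r].
Proof. by rewrite prod_normE gt_max prod_normE gt_max -andbA. Qed.

Lemma measurable_coord i : measurable_fun [set: pt R] (@coord R i).
Proof.
case: i => [|[|i]]; rewrite /coord /=.
- exact: measurableT_comp measurable_fst measurable_fst.
- exact: measurableT_comp measurable_snd measurable_fst.
- exact: measurable_snd.
Qed.

Lemma measurable_coord_itv i (I : interval R) : measurable [set x : pt R | coord i x \in I].
Proof.
rewrite (_ : mkset _ = setT `&` @coord R i @^-1` [set` I]); last by rewrite setTI.
exact: (measurable_coord i measurableT (measurable_itv I)).
Qed.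

(** The measurable structure is the product one, so an open set is exhibited as a countable union of
    boxes with rational end points. *)
Lemma measurable_open_pt (U : set (pt R)) : open U -> measurable U.
Proof.
move=> oU.
pose box (q : (rat * rat) * (rat * rat) * (rat * rat)) : set (pt R) :=
  [set x | coord 0 x \in `]ratr q.1.1.1, ratr q.1.1.2[ ] `&`
  [set x | coord 1 x \in `]ratr q.1.2.1, ratr q.1.2.2[ ] `&`
  [set x | coord 2 x \in `]ratr q.2.1, ratr q.2.2[ ].
have -> : U = \bigcup_q (if `[< box q `<=` U >] then box q else set0).
  apply/seteqP; split => [x Ux|x [q _]]; last by case: ifP => // /asboolP h /h.
  have [d d0 D] : exists2 d, 0 < d & forall y, `|y - x| < d -> U y.
    by apply/near_pt; move: oU; rewrite openE => /(_ x Ux).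
  have H i : exists q : rat * rat, coord i x - d < ratr q.1 < coord i x /\
                                    coord i x < ratr q.2 < coord i x + d.
    have h1 : coord i x - d < coord i x by rewrite gtrBl.
    have h2 : coord i x < coord i x + d by rewrite ltrDl.
    have [q1] := rat_in_itvoo h1; have [q2] := rat_in_itvoo h2.
    by rewrite !in_itv /= => a b; exists (q1, q2).
  have [q0 [/andP[a0 b0] /andP[c0 d0']]] := H 0%N.
  have [q1 [/andP[a1 b1] /andP[c1 d1']]] := H 1%N.
  have [q2 [/andP[a2 b2] /andP[c2 d2']]] := H 2%N.
  exists ((q0, q1), q2) => //; rewrite asboolT /=.
    by split; [split|]; rewrite /= in_itv /= ?b0 ?b1 ?b2.
  move=> y [[]] /=; rewrite !in_itv /= => /andP[e0 f0] /andP[e1 f1] /andP[e2 f2].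
  apply: D; rewrite normpt_lt !ltr_norml !coordB; apply/and3P; split; lra.
apply: countable_bigcupT_measurable => // q; case: ifP => // _.
by apply: measurableI; [apply: measurableI|]; exact: measurable_coord_itv.
Qed.

Lemma measurable_cont f : continuous f -> measurable_fun setT f.
Proof.
move=> /continuousP cf; apply: (measurability _ (measurable_realfun.RGenOpens.measurableE R)).
move=> _ [_ [a [b ->] <-]]; rewrite setTI; apply: measurable_open_pt.
exact/cf/interval_open.
Qed.

Lemma box_measurable r : measurable [set x : pt R | `|x| <= r].
Proof.
rewrite (_ : mkset _ = [set x | coord 0 x \in `[- r, r]] `&` [set x | coord 1 x \in `[- r, r]]
   `&` [set x | coord 2 x \in `[- r, r]]).
  by apply: measurableI; [apply: measurableI|]; exact: measurable_coord_itv.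
apply/seteqP; split => x /=.
  by rewrite normpt_le => /and3P[]; rewrite !in_itv /= !ler_norml.
by rewrite normpt_le !in_itv /= !ler_norml => -[[-> ->] ->].
Qed.

Lemma box_finite r : (@lam3 R [set x : pt R | (`|x| <= r)%R] < +oo)%E.
Proof.
have mI : measurable (`[- r, r]%classic : set R) by exact: measurable_itv.
have -> : [set x : pt R | `|x| <= r] = (`[- r, r]%classic `*` `[- r, r]%classic) `*` `[- r, r]%classic.
  apply/seteqP; split => x /=.
    by rewrite normpt_le => /and3P[]; rewrite !in_itv /= !ler_norml.
  by rewrite normpt_le !in_itv /= !ler_norml => -[[-> ->] ->].
rewrite /lam3.
pose I : set R := `[- r, r]%classic.
have h : (@lebesgue_measure R I < +oo)%E.
  by rewrite /I lebesgue_measure_itv /=; case: ifP => // _; rewrite -EFinB ltry.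
rewrite product_measure1E //; last exact: measurableX.
have e2 : (((@lebesgue_measure R) \x (@lebesgue_measure R)) (I `*` I) =
  lebesgue_measure I * lebesgue_measure I)%E by exact: product_measure1E.
have h2 : (lebesgue_measure I * lebesgue_measure I < +oo)%E.
  by rewrite lte_mul_pinfty // ge0_fin_numE.
rewrite -/I; apply: (@le_lt_trans _ _ ((lebesgue_measure I * lebesgue_measure I) * lebesgue_measure I)%E).
  by rewrite -e2.
by rewrite lte_mul_pinfty ?mule_ge0 // ge0_fin_numE ?mule_ge0.
Qed.

(** Continuous functions of bounded support are integrable and stable under the operations used, so
    that [J] is linear and monotone on them with no further integrability condition. *)
Definition bsupp f := exists r, forall x, r < `|x| -> f x = 0.
Definition Cc f := continuous f /\ bsupp f.

Lemma bsuppP f : bsupp f -> exists2 r, 0 < r & forall x, r <= `|x| -> f x = 0.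
Proof.
move=> [r h]; exists (`|r| + 1); first by rewrite ltr_pwDr.
by move=> x hx; apply: h; rewrite (lt_le_trans _ hx) // ltr_pwDr // ler_norm.
Qed.

Lemma box_compact r : compact [set x : pt R | `|x| <= r].
Proof.
have -> : [set x : pt R | `|x| <= r] = (`[- r, r]%classic `*` `[- r, r]%classic) `*` `[- r, r]%classic.
  apply/seteqP; split => x /=.
    by rewrite normpt_le => /and3P[]; rewrite !in_itv /= !ler_norml.
  by rewrite normpt_le !in_itv /= !ler_norml => -[[-> ->] ->].
by apply: compact_setX; [apply: compact_setX|]; exact: segment_compact.
Qed.

Lemma continuous_bounded f (K : set (pt R)) : compact K -> continuous f ->
  exists2 M, 0 < M & forall x, K x -> `|f x| <= M.
Proof.
move=> cK cf.
have cfK : compact (f @` K) by apply: continuous_compact => //; exact: continuous_subspaceT.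
have [M [_ hM]] := compact_bounded cfK.
exists (`|M| + 1); first by rewrite ltr_pwDr.
move=> x Kx; apply: (hM (`|M| + 1)); last by exists x.
by rewrite ltr_pwDr // ler_norm.
Qed.

Lemma continuous_box f r : continuous f -> exists2 M, 0 < M & forall x, `|x| <= r -> `|f x| <= M.
Proof. by move=> cf; have [M M0 h] := continuous_bounded (@box_compact r) cf; exists M. Qed.

Lemma Cc_bounded f : Cc f -> exists2 M, 0 < M & forall x, `|f x| <= M.
Proof.
move=> [cf [r hr]]; have [M M0 hM] := @continuous_box f r cf; exists M => // x.
have [/hM //|/hr ->] := leP `|x| r; by rewrite normr0 ltW.
Qed.

Lemma integrable_bdd_supp (f : pt R -> R) (r M : R) : measurable_fun setT f ->
  (forall x, `|f x| <= M) -> (forall x, r < `|x| -> f x = 0) ->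
  (@lam3 R).-integrable setT (EFin \o f).
Proof.
move=> mf hM hr.
have -> : EFin \o f = (EFin \o f) \_ [set x : pt R | `|x| <= r].
  apply/funext => x; rewrite patchE /=; case: ifPn => //.
  by rewrite notin_setE /= => /negP; rewrite -ltNge => /hr ->.
apply: (@integrable_mkcond _ _ R (@lam3 R) _ (EFin \o f) (box_measurable r)).1.
apply: measurable_bounded_integrable => //; first exact: box_measurable.
- exact: box_finite.
- exact: measurable_funTS.
- by exists M; split; [exact: num_real|move=> N MN x _; exact: le_trans (hM x) (ltW MN)].
Qed.

Lemma Cc_integrable f : Cc f -> (@lam3 R).-integrable setT (EFin \o f).
Proof.
move=> Hf; have [M _ hM] := Cc_bounded Hf; case: Hf => cf [r hr].
by apply: (@integrable_bdd_supp f r M) => //; exact: measurable_cont.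
Qed.

Definition J f := \int[@lam3 R]_x f x.

Lemma bsupp_add f g : bsupp f -> bsupp g -> bsupp (fun x => f x + g x).
Proof.
move=> [r hr] [s hs]; exists (Num.max r s) => x; rewrite gt_max => /andP[h1 h2].
by rewrite hr // hs // addr0.
Qed.
Lemma bsupp_opp f : bsupp f -> bsupp (fun x => - f x).
Proof. by move=> [r hr]; exists r => x h; rewrite hr ?oppr0. Qed.
Lemma bsupp_mull f g : bsupp f -> bsupp (fun x => f x * g x).
Proof. by move=> [r hr]; exists r => x h; rewrite hr ?mul0r. Qed.
Lemma bsupp_mulr f g : bsupp g -> bsupp (fun x => f x * g x).
Proof. by move=> [r hr]; exists r => x h; rewrite hr ?mulr0. Qed.
Lemma bsupp_partial i f : bsupp f -> bsupp (partial i f).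
Proof.
move=> [r hr]; exists r => x h; rewrite -[RHS](_ : partial i (fun=> 0) x = 0); last by rewrite partial_cst.
apply: partial_near; apply/near_pt; exists (`|x| - r); first by rewrite subr_gt0.
move=> y hy; apply: hr.
have : `|x| <= `|y| + `|y - x| by rewrite -[in leLHS](subKr y x) (le_trans (ler_normB _ _)).
by move: hy; lra.
Qed.

Lemma Cc_add f g : Cc f -> Cc g -> Cc (fun x => f x + g x).
Proof.
move=> [cf bf] [cg bg]; split; last exact: bsupp_add.
by move=> x; apply: cvgD; [exact: cf|exact: cg].
Qed.
Lemma Cc_opp f : Cc f -> Cc (fun x => - f x).
Proof. by move=> [cf bf]; split; [move=> x; apply: cvgN; exact: cf|exact: bsupp_opp]. Qed.
Lemma Cc_sub f g : Cc f -> Cc g -> Cc (fun x => f x - g x).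
Proof. by move=> Hf Hg; apply: Cc_add => //; exact: Cc_opp. Qed.
Lemma Cc_mull f g : Cc f -> continuous g -> Cc (fun x => f x * g x).
Proof.
move=> [cf bf] cg; split; last exact: bsupp_mull.
by move=> x; apply: cvgM; [exact: cf|exact: cg].
Qed.
Lemma Cc_mulr f g : continuous f -> Cc g -> Cc (fun x => f x * g x).
Proof. by move=> cf Hg; under eq_fun do rewrite mulrC; exact: Cc_mull. Qed.
Lemma Cc_scale (c : R) f : Cc f -> Cc (fun x => c * f x).
Proof. by apply: Cc_mulr => x; exact: cvg_cst. Qed.
Lemma Cc_sqr f : Cc f -> Cc (fun x => f x ^+ 2).
Proof. by move=> Hf; under eq_fun do rewrite expr2; apply: Cc_mull => //; case: Hf. Qed.
Lemma Cc_norm f : Cc f -> Cc (fun x => `|f x|).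
Proof.
move=> [cf [r hr]]; split; first by move=> x; apply: cvg_norm; exact: cf.
by exists r => x h; rewrite hr ?normr0.
Qed.
Lemma Cc0 : Cc (fun _ => 0).
Proof. by split; [move=> x; exact: cvg_cst|exists 0]. Qed.
Lemma J_add f g : Cc f -> Cc g -> J (fun x => f x + g x) = J f + J g.
Proof. by move=> Hf Hg; rewrite /J RintegralD //; exact: Cc_integrable. Qed.
Lemma J_sub f g : Cc f -> Cc g -> J (fun x => f x - g x) = J f - J g.
Proof. by move=> Hf Hg; rewrite /J RintegralB //; exact: Cc_integrable. Qed.
Lemma J_scale (c : R) f : Cc f -> J (fun x => c * f x) = c * J f.
Proof. by move=> Hf; rewrite /J RintegralZl //; exact: Cc_integrable. Qed.
Lemma J_opp f : Cc f -> J (fun x => - f x) = - J f.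
Proof. by move=> Hf; rewrite -mulN1r -J_scale //; congr J; apply/funext => x; rewrite mulN1r. Qed.
Lemma J_le f g : Cc f -> Cc g -> (forall x, f x <= g x) -> J f <= J g.
Proof.
by move=> Hf Hg H; rewrite /J; apply: le_Rintegral => //; exact: Cc_integrable.
Qed.
Lemma J_ge0 f : (forall x, 0 <= f x) -> 0 <= J f.
Proof. by move=> H; apply: Rintegral_ge0 => x _. Qed.
Lemma J0 : J (fun _ => 0) = 0.
Proof.
by rewrite -[RHS](mul0r (J (fun=> 0))) -(J_scale 0 Cc0); congr J; apply/funext => x; rewrite mul0r.
Qed.
Lemma J_abs f : Cc f -> `|J f| <= J (fun x => `|f x|).
Proof.
move=> Hf; have Hn := Cc_norm Hf; rewrite ler_norml; apply/andP; split.
  rewrite -J_opp //; apply: J_le => //; first exact: Cc_opp.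
  by move=> x; rewrite lerNl -normrN ler_norm.
by apply: J_le => // x; exact: ler_norm.
Qed.

Definition vol r := fine (@lam3 R [set x : pt R | (`|x| <= r)%R]).

Lemma vol_ge0 r : 0 <= vol r. Proof. by rewrite /vol fine_ge0. Qed.

Lemma J_bound f r M : Cc f -> (forall x, r < `|x| -> f x = 0) -> (forall x, `|f x| <= M) ->
  `|J f| <= M * vol r.
Proof.
move=> Hf hr hM; apply: (le_trans (J_abs Hf)).
have M0 : 0 <= M by rewrite (le_trans _ (hM 0)).
rewrite /vol -Rintegral_cst; last exact: box_measurable.
rewrite [leRHS]Rintegral_mkcond; apply: le_Rintegral => //.
- exact/Cc_integrable/Cc_norm.
- rewrite (_ : EFin \o _ = (EFin \o (fun=> M)) \_ [set x : pt R | `|x| <= r]); last first.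
    by apply/funext => x; rewrite /= !patchE; case: ifP.
  apply: (@integrable_mkcond _ _ R (@lam3 R) _ (EFin \o (fun=> M)) (box_measurable r)).1.
  apply: measurable_bounded_integrable; [exact: box_measurable|exact: box_finite|
    exact: measurable_cst|exists M; split; first exact: num_real].
  by move=> N MN y _; rewrite /= ger0_norm // ltW.
- move=> x _; rewrite patchE; case: ifPn => [_|]; first exact: hM.
  by rewrite notin_setE /= => /negP; rewrite -ltNge => /hr ->; rewrite normr0.
Qed.

End Integral.

(** * Invariance under reflections and translations, integration by parts *)

Section Reflection.

(** The pushforward of the product measure agrees with that measure on rectangles, which determine
    it. *)
Lemma product_measure_preserving d1 d2 (T1 : measurableType d1) (T2 : measurableType d2)
    (R : realType) (m1 : {sigma_finite_measure set T1 -> \bar R})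
    (m2 : {sigma_finite_measure set T2 -> \bar R}) (f1 : T1 -> T1) (f2 : T2 -> T2) :
  measurable_fun setT f1 -> measurable_fun setT f2 ->
  (forall A, measurable A -> m1 (f1 @^-1` A) = m1 A) ->
  (forall A, measurable A -> m2 (f2 @^-1` A) = m2 A) ->
  forall A, measurable A ->
    (m1 \x m2)%E ((fun x => (f1 x.1, f2 x.2)) @^-1` A) = (m1 \x m2)%E A.
Proof.
move=> mf1 mf2 p1 p2 A mA.
set f := fun x : T1 * T2 => (f1 x.1, f2 x.2).
have mf : measurable_fun setT f.
  apply: measurable_fun_pair; [exact: measurableT_comp mf1 measurable_fst|
                             exact: measurableT_comp mf2 measurable_snd].
pose mu : {measure set (T1 * T2)%type -> \bar R} := pushforward (m1 \x m2)%E f.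
rewrite -[LHS]/(mu mf A); apply/esym; apply: product_measure_unique => // B C mB mC.
rewrite /mu /= /pushforward.
rewrite (_ : _ @^-1` _ = (f1 @^-1` B) `*` (f2 @^-1` C)); last by apply/seteqP; split.
have mB' : measurable (f1 @^-1` B) by rewrite -[X in measurable X]setTI; exact: mf1.
have mC' : measurable (f2 @^-1` C) by rewrite -[X in measurable X]setTI; exact: mf2.
apply: etrans (product_measure1E m1 m2 mB' mC') _.
by congr (_ * _)%E; [exact: p1|exact: p2].
Qed.

Lemma product_sigma_finite d1 d2 (T1 : measurableType d1) (T2 : measurableType d2)
    (R : realType) (m1 : {sigma_finite_measure set T1 -> \bar R})
    (m2 : {sigma_finite_measure set T2 -> \bar R}) : sigma_finite setT (m1 \x m2)%E.
Proof.
have /sigma_finiteP[F [eF incF finF]] := sigma_finiteT m1.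
have /sigma_finiteP[G [eG incG finG]] := sigma_finiteT m2.
exists (fun n => F n `*` G n).
  apply/seteqP; split => [[x y] _|//].
  have [i _ Fx] : (\bigcup_i F i) x by rewrite -eF.
  have [j _ Gy] : (\bigcup_i G i) y by rewrite -eG.
  exists (maxn i j) => //; split => /=.
    by have /subsetPset := incF _ _ (leq_maxl i j); exact.
  by have /subsetPset := incG _ _ (leq_maxr i j); exact.
move=> n; have [mF lF] := finF n; have [mG lG] := finG n.
split; first exact: measurableX.
by rewrite product_measure1E // lte_mul_pinfty // ge0_fin_numE.
Qed.

(** The product packaged with its sigma-finiteness, so that further products can be formed and
    Fubini's theorem applies to pairs of points of R^3. *)
Definition sfprod d1 d2 (T1 : measurableType d1) (T2 : measurableType d2)
    (R : realType) (m1 : {sigma_finite_measure set T1 -> \bar R})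
    (m2 : {sigma_finite_measure set T2 -> \bar R}) :
    {sigma_finite_measure set (T1 * T2)%type -> \bar R} :=
  HB.pack (m1 \x m2)%E
    (Measure_isSigmaFinite.Build _ _ _ (m1 \x m2)%E (product_sigma_finite m1 m2)).

Variable R : realType.
Implicit Types (f g h : pt R -> R) (x y z c : pt R) (t r : R).

Definition sflam3 := sfprod (sfprod (@lebesgue_measure R) (@lebesgue_measure R)) (@lebesgue_measure R).

Lemma measurable_reflect t : measurable_fun [set: R] (fun s : R => t - s).
Proof.
by apply: continuous_measurable_fun => x; apply: cvgB; [exact: cvg_cst|exact: cvg_id].
Qed.

(** Reflections rather than translations: y -> x - y is the substitution of convolutions, and two
    reflections compose to a translation ([J_shift]). *)
Lemma lebesgue_reflect t (A : set R) : measurable A ->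
  lebesgue_measure ((fun s => t - s) @^-1` A) = lebesgue_measure A.
Proof.
move=> mA.
pose mu : {measure set (measurableTypeR R) -> \bar R} :=
  pushforward (@lebesgue_measure R) ((fun s : R => t - s) : _ -> measurableTypeR R).
rewrite -[LHS]/(mu (measurable_reflect t) A); apply/esym/lebesgue_measure_unique => // X [[a b] /= _ <-].
rewrite /mu /= /pushforward /=.
have -> : (fun s : R => t - s) @^-1` `]a, b] = `[t - b, t - a[%classic.
  by apply/seteqP; split => x /=; rewrite !in_itv /=; lra.
rewrite !lebesgue_measure_itv /= !lte_fin ltrD2l ltrN2.
by case: ifP => // _; rewrite -!EFinB; congr EFin; ring.
Qed.

Lemma lam3_reflect c (A : set (pt R)) : measurable A ->
  @lam3 R ((fun x => c - x) @^-1` A) = @lam3 R A.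
Proof.
have H2 := @product_measure_preserving _ _ _ _ R (@lebesgue_measure R) (@lebesgue_measure R)
  _ _ (measurable_reflect c.1.1) (measurable_reflect c.1.2)
  (@lebesgue_reflect c.1.1) (@lebesgue_reflect c.1.2).
have m2 : measurable_fun [set: R * R] (fun x : R * R => (c.1.1 - x.1, c.1.2 - x.2)).
  apply: measurable_fun_pair.
    exact: measurableT_comp (measurable_reflect c.1.1) measurable_fst.
  exact: measurableT_comp (measurable_reflect c.1.2) measurable_snd.
move=> mA; have := @product_measure_preserving _ _ _ _ R
  (sfprod (@lebesgue_measure R) (@lebesgue_measure R)) (@lebesgue_measure R)
  _ _ m2 (measurable_reflect c.2) H2 (@lebesgue_reflect c.2) A mA.
by [].
Qed.

Lemma continuous_reflect f c : continuous f -> continuous (fun x => f (c - x)).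
Proof.
move=> cf x; apply: (continuous_comp (f := fun x => c - x) (g := f)); last exact: cf.
by apply: cvgB; [exact: cvg_cst|exact: cvg_id].
Qed.

Lemma continuous_shift f c : continuous f -> continuous (fun x => f (x + c)).
Proof.
move=> cf x; apply: (continuous_comp (f := fun x => x + c) (g := f)); last exact: cf.
by apply: cvgD; [exact: cvg_id|exact: cvg_cst].
Qed.

Lemma Cc_reflect f c : Cc f -> Cc (fun x => f (c - x)).
Proof.
move=> [cf [r hr]]; split; first exact: continuous_reflect.
exists (`|c| + r) => x hx; apply: hr.
have : `|x| <= `|c| + `|c - x| by rewrite -[in leLHS](subKr c x) (le_trans (ler_normB _ _)).
by move: hx; lra.
Qed.

Lemma Cc_shift f c : Cc f -> Cc (fun x => f (x + c)).
Proof.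
move=> [cf [r hr]]; split; first exact: continuous_shift.
exists (`|c| + r) => x hx; apply: hr.
have : `|x| <= `|x + c| + `|c| by rewrite -[in leLHS](addrK c x) (le_trans (ler_normB _ _)).
by move: hx; lra.
Qed.

Lemma J_reflect f c : Cc f -> J (fun x => f (c - x)) = J f.
Proof.
move=> Hf; rewrite /J /Rintegral.
have mphi : measurable_fun [set: pt R] (fun x => c - x).
  have h i : measurable_fun [set: pt R] (fun x => coord i c - coord i x).
    by apply: (measurableT_comp (measurable_reflect (coord i c))); exact: measurable_coord.
  exact: (measurable_fun_pair (measurable_fun_pair (h 0%N) (h 1%N)) (h 2%N)).
have mf : measurable_fun [set: pt R] (EFin \o f).
  by apply/measurable_EFinP; apply: measurable_cont; case: Hf.
pose T := (measurableTypeR R * measurableTypeR R * measurableTypeR R)%type.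
have H := @integral_pushforward _ _ T T R _ mphi (@lam3 R) setT (EFin \o f) mf.
congr fine; apply: etrans (esym (H _ measurableT)) _.
  by rewrite preimage_setT; exact/Cc_integrable/(Cc_reflect c).
by apply: eq_measure_integral => A mA _; exact: lam3_reflect.
Qed.

Lemma J_shift f c : Cc f -> J (fun x => f (x + c)) = J f.
Proof.
move=> Hf; rewrite -(J_reflect 0 Hf).
rewrite -(J_reflect (- c) (Cc_reflect 0 Hf)).
by congr J; apply/funext => x; congr f; rewrite opprB addrC opprK addrA addrC; rewrite add0r addrC.
Qed.

Definition evec (i : nat) : pt R :=
  if i == 0%N then ((1, 0), 0) else if i == 1%N then ((0, 1), 0) else ((0, 0), 1).

Lemma norm_evec i : `|evec i| <= 1.
Proof.
by rewrite normpt_le /evec /coord /=; case: i => [|[|i]] /=; rewrite ?normr0 ?normr1 ?lexx ?ler01.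
Qed.

Lemma Cc_partial k i f : bsupp f -> Ck k.+1 f -> Cc (partial i f).
Proof. by move=> bf Hf; split; [exact: Ck_cont (Ck_partial i Hf)|exact: bsupp_partial]. Qed.

Lemma Cc_partial2_bounded k i f : bsupp f -> Ck k.+2 f ->
  exists2 L, 0 < L & forall j z, `|partial j (partial i f) z| <= L.
Proof.
move=> bf Hf.
have [L0 p0 h0] := Cc_bounded (Cc_partial 0 (bsupp_partial i bf) (Ck_partial i Hf)).
have [L1 p1 h1] := Cc_bounded (Cc_partial 1 (bsupp_partial i bf) (Ck_partial i Hf)).
have [L2 p2 h2] := Cc_bounded (Cc_partial 2 (bsupp_partial i bf) (Ck_partial i Hf)).
exists (L0 + L1 + L2); first lra.
by case => [|[|j]] z; [have := h0 z|have := h1 z|have := h2 z]; rewrite /partial /upd /coord /=; lra.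
Qed.

Lemma pt_ext x y : coord 0 x = coord 0 y -> coord 1 x = coord 1 y ->
  coord 2 x = coord 2 y -> x = y.
Proof. by case: x => [[a b] c]; case: y => [[a' b'] c']; rewrite /coord /= => -> -> ->. Qed.

Lemma upd_evec i x t : upd i x (coord i x + t) = x + t *: evec i.
Proof.
by apply: pt_ext; rewrite coordD coordZ /upd /coord /evec; case: i => [|[|i]] /=; ring.
Qed.

Lemma partial_coord_ge2 i f : partial i.+2 f = partial 2 f.
Proof. by []. Qed.

Lemma der_evec k i f x t : Ck k.+1 f ->
  is_derive t (1 : R) (fun s => f (x + s *: evec i)) (partial i f (x + t *: evec i)).
Proof.
move=> Hf; have := der_line x (evec i) t Hf.
have H (F : nat -> R) : (forall j, F j.+2 = F 2%N) -> \sum_(j < 3) F j * coord j (evec i) = F i.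
  move=> F2; rewrite !big_ord_recl big_ord0 /coord /evec /=.
  by case: i => [|[|i]] /=; rewrite ?F2 ?mulr0 ?mulr1 ?addr0 ?add0r.
have e j : partial j.+2 f (x + t *: evec i) = partial 2 f (x + t *: evec i).
  by rewrite partial_coord_ge2.
by have -> := H (fun j => partial j f (x + t *: evec i)) e.
Qed.

Lemma diff_quotient k i f x (h L : R) : h != 0 -> Ck k.+2 f ->
  (forall j z, `|partial j (partial i f) z| <= L) ->
  `|h^-1 * (f (x + h *: evec i) - f x) - partial i f x| <= 3 * L * `|h|.
Proof.
move=> h0 Hf hL.
have L0 : 0 <= L by rewrite (le_trans _ (hL 0%N x)).
have [c hc ec] := MVT_abs 0 h (fun t => der_evec i x t Hf).
move: ec; rewrite /= scale0r !subr0 addr0 => ->.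
rewrite mulrC mulfK // distrC.
rewrite distrC (le_trans (Lipschitz_pt (L := L) (Ck_partial i Hf) (fun z j _ => hL j z))) //.
rewrite ler_wpM2l //; first by rewrite mulr_ge0.
move: hc; rewrite !subr0 => hc.
rewrite addrAC subrr add0r normrZ (le_trans _ hc) //.
by rewrite -[leRHS]mulr1 ler_wpM2l ?norm_evec.
Qed.

(* By translation invariance the difference quotients of f have integral 0; they
   converge uniformly to the partial derivative. *)
Lemma J_partial k i f : (i < 3)%N -> bsupp f -> Ck k.+2 f -> J (partial i f) = 0.
Proof.
move=> hi bf Hf; have Cf : Cc f by split => //; exact: Ck_cont Hf.
have Cp := Cc_partial i bf (CkSW Hf).
have [r r0 hr] := bsuppP bf.
have [L L0 hL] := Cc_partial2_bounded i bf Hf.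
apply/eqP; rewrite -normr_le0; apply/ler_addgt0Pl => e e0; rewrite addr0.
pose M := 3 * L * vol (r + 1).
have M0 : 0 <= M by rewrite /M mulr_ge0 ?vol_ge0 // mulr_ge0 ?ltW.
pose h := Num.min 1 (e / (M + 1)).
have h0 : 0 < h by rewrite /h lt_min ltr01 divr_gt0 // ltr_wpDl.
have h1 : h <= 1 by rewrite /h ge_min lexx.
have hM : h * M <= e.
  rewrite (@le_trans _ _ (e / (M + 1) * M)) //; first by rewrite ler_wpM2r // /h ge_min lexx orbT.
  have M1 : 0 < M + 1 by rewrite ltr_wpDl.
  by rewrite mulrAC ler_pdivrMr // ler_pM2l // lerDl.
pose q x := h^-1 * (f (x + h *: evec i) - f x).
have Cq : Cc q by apply: Cc_scale; apply: Cc_sub => //; exact: Cc_shift.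
have Jq : J q = 0.
  rewrite /q J_scale; last by apply: Cc_sub => //; exact: Cc_shift.
  by rewrite J_sub ?J_shift ?subrr ?mulr0 //; exact: Cc_shift.
rewrite -[J _]subr0 -Jq -J_sub //.
apply: (@le_trans _ _ (3 * L * h * vol (r + 1))); last by move: hM; rewrite /M; lra.
have bh x : `|x + h *: evec i - x| <= h.
  rewrite addrAC subrr add0r normrZ gtr0_norm //.
  by rewrite -[leRHS]mulr1 ler_wpM2l ?norm_evec // ltW.
apply: J_bound; first exact: Cc_sub.
  move=> x hx; have [r' hr'] := bsupp_partial i bf.
  have hx0 : r < `|x| by lra.
  rewrite /q !hr ?(ltW hx0) //; last first.
    have : `|x| <= `|x + h *: evec i| + `|x + h *: evec i - x|.
      by rewrite -[in leLHS](subKr (x + h *: evec i) x) (le_trans (ler_normB _ _)).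
    by have := bh x; lra.
  rewrite subrr mulr0 subr0.
  rewrite -[RHS](_ : partial i (fun=> 0) x = 0); last by rewrite partial_cst.
  apply: partial_near; apply/near_pt; exists (`|x| - r); first by rewrite subr_gt0.
  move=> y hy; apply: hr.
  have : `|x| <= `|y| + `|y - x| by rewrite -[in leLHS](subKr y x) (le_trans (ler_normB _ _)).
  by move: hy; lra.
move=> x.
rewrite distrC -[h in leRHS](gtr0_norm h0); apply: (diff_quotient _ _ Hf hL).
by rewrite gt_eqF.
Qed.

Lemma J_ibp k i f g : (i < 3)%N -> bsupp (fun x => f x * g x) -> Ck k.+2 f -> Ck k.+2 g ->
  J (fun x => partial i f x * g x + f x * partial i g x) = 0.
Proof.
move=> hi b Hf Hg; rewrite -(partialM i Hf Hg); apply: J_partial hi b _.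
exact: Ck_mul Hf Hg.
Qed.

End Reflection.

(** * Convolution and mollifiers *)

Section Convolution.
Variable R : realType.
Implicit Types (f g h k : pt R -> R) (x y z : pt R) (t r s : R).

Definition smth f := forall m, Ck m f.

Definition conv f k x := J (fun y => f y * k (x - y)).

Lemma Cc_conv_int f k x : continuous f -> Cc k -> Cc (fun y => f y * k (x - y)).
Proof. by move=> cf ck; apply: Cc_mulr => //; exact: Cc_reflect. Qed.

Lemma conv_comm f k x : continuous f -> Cc k -> conv f k x = J (fun z => f (x - z) * k z).
Proof.
move=> cf ck; rewrite /conv -(J_reflect x (Cc_conv_int x cf ck)).
by congr J; apply/funext => z; rewrite subKr.
Qed.

Lemma conv_approx f k x r e : continuous f -> Cc k -> (forall z, 0 <= k z) -> J k = 1 ->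
  (forall z, r < `|z| -> k z = 0) -> (forall z, `|z| <= r -> `|f (x - z) - f x| <= e) ->
  `|conv f k x - f x| <= e.
Proof.
move=> cf ck k0 k1 hr H; rewrite conv_comm //.
have C1 : Cc (fun z => f (x - z) * k z) by apply: Cc_mulr => //; exact: continuous_reflect.
have C2 : Cc (fun z => f x * k z) by exact: Cc_scale.
rewrite -[X in _ - X]mulr1 -[in X in _ - X]k1 -J_scale // -J_sub //.
have C3 := Cc_sub C1 C2.
apply: (le_trans (J_abs C3)); rewrite -[e]mulr1 -k1 -J_scale //.
apply: J_le; [exact: Cc_norm|exact: Cc_scale|move=> z].
rewrite -mulrBl normrM (ger0_norm (k0 z)).
have [/H h|/hr ->] := leP `|z| r; last by rewrite !mulr0.
exact: ler_wpM2r.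
Qed.

Lemma conv_bsupp f k : bsupp f -> bsupp k -> bsupp (conv f k).
Proof.
move=> [r hr] [r' hr']; exists (r + r') => x hx; rewrite /conv -[RHS](J0 R); congr J.
apply/funext => y; have [h|/hr ->] := leP `|y| r; last by rewrite mul0r.
rewrite hr' ?mulr0 //.
have : `|x| <= `|y| + `|x - y| by rewrite -[in leLHS](subrK y x) addrC ler_normD.
by move: hx h; lra.
Qed.

Lemma J_mul_bound f g r M e : continuous f -> Cc g -> 0 <= e ->
  (forall y, `|y| <= r -> `|f y| <= M) -> (forall y, r < `|y| -> g y = 0) ->
  (forall y, `|g y| <= e) -> `|J (fun y => f y * g y)| <= M * e * vol r.
Proof.
move=> cf cg e0 hM hg he.
have [r0|r0] := leP 0 r; last first.
  rewrite (_ : (fun y => f y * g y) = fun=> 0); last first.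
    by apply/funext => y; rewrite hg ?mulr0 // (lt_le_trans r0).
  have s0 : [set x : pt R | `|x| <= r] = set0.
    by apply/seteqP; split => // x /=; rewrite leNgt (lt_le_trans r0).
  have v0 : vol r = 0 by rewrite /vol s0; exact: (congr1 fine (@measure0 _ _ R (@lam3 R))).
  by rewrite J0 normr0 v0 mulr0.
apply: J_bound; first exact: Cc_mulr.
  by move=> y hy; rewrite hg ?mulr0.
move=> y; have M0 : 0 <= M by rewrite (le_trans _ (hM 0 _)) // normr0.
have [hy|hy] := leP `|y| r; first by rewrite normrM ler_pM // hM.
by rewrite hg // mulr0 normr0 mulr_ge0.
Qed.

Lemma Cc_Lipschitz k : bsupp k -> smth k -> exists2 L, 0 < L &
  forall x y, `|k y - k x| <= L * `|y - x|.
Proof.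
move=> bk sk.
have [L0 p0 h0] := Cc_bounded (Cc_partial 0 bk (sk 1%N)).
have [L1 p1 h1] := Cc_bounded (Cc_partial 1 bk (sk 1%N)).
have [L2 p2 h2] := Cc_bounded (Cc_partial 2 bk (sk 1%N)).
exists (3 * (L0 + L1 + L2)); first lra.
move=> x y; apply: (Lipschitz_pt (sk 1%N)) => z i _.
by case: i => [|[|i]]; [have := h0 z|have := h1 z|rewrite partial_coord_ge2; have := h2 z]; lra.
Qed.

Lemma norm_shift_bound x y z r : `|z - x| <= 1 -> `|x| + 1 + r < `|y| -> r < `|z - y|.
Proof.
move=> h1 h2; have : `|y| <= `|z - y| + (`|z - x| + `|x|).
  rewrite -[in leLHS](subKr z y) (le_trans (ler_normB _ _)) // addrC lerD2l.
  by rewrite -[in leLHS](subrK x z) ler_normD.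
by move: h1 h2; lra.
Qed.

Lemma conv_continuous f k : continuous f -> bsupp k -> smth k -> continuous (conv f k).
Proof.
move=> cf bk sk x0; have [L L0 hL] := Cc_Lipschitz bk sk.
have ck := Ck_cont (sk 0%N); have [r r0 hr] := bsuppP bk.
have [M M0 hM] := continuous_box (`|x0| + 1 + r) cf.
pose C := M * L * vol (`|x0| + 1 + r).
have C0 : 0 <= C by rewrite /C mulr_ge0 ?vol_ge0 // mulr_ge0 // ltW.
have HC x : `|x - x0| <= 1 -> `|conv f k x - conv f k x0| <= C * `|x - x0|.
  move=> hx; have C1 := Cc_conv_int x cf (conj ck bk); have C2 := Cc_conv_int x0 cf (conj ck bk).
  rewrite /conv -J_sub //; under eq_fun do rewrite -mulrBr.
  rewrite /C mulrAC -[M * L * _]mulrA; apply: J_mul_bound => //.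
  - by apply: Cc_sub; apply: Cc_reflect; split.
  - by rewrite mulr_ge0 // ltW.
  - by move=> y hy; rewrite !hr ?subrr //; apply/ltW/(norm_shift_bound _ hy); rewrite ?subrr ?normr0.
  - by move=> y; have := hL (x0 - y) (x - y); rewrite opprB addrA subrK.
apply/cvgrPdist_le => e e0; apply/near_pt.
have C1 : 0 < C + 1 by rewrite ltr_wpDl.
exists (Num.min 1 (e / (C + 1))); first by rewrite lt_min ltr01 divr_gt0.
move=> x; rewrite lt_min => /andP[h1 h2]; rewrite distrC (le_trans (HC _ (ltW h1))) //.
rewrite (@le_trans _ _ ((C + 1) * `|x - x0|)) //; first by rewrite ler_wpM2r // lerDl.
by rewrite mulrC -ler_pdivlMr // ltW.
Qed.

Lemma smth_partial i k : smth k -> smth (partial i k).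
Proof. by move=> sk m; exact: Ck_partial. Qed.

(** The derivative falls on the kernel, so continuity of f is enough: the difference quotients of k
    converge uniformly, with an error controlled by second derivatives. *)
Lemma pD_conv f k i x : continuous f -> bsupp k -> smth k ->
  pD i (conv f k) x (conv f (partial i k) x).
Proof.
move=> cf bk sk; have ck := Ck_cont (sk 0%N).
have Cck : Cc k by []. have Ccp := Cc_partial i bk (sk 1%N).
have [r1 r10 hr1] := bsuppP bk; have [r2 r20 hr2] := bsuppP Ccp.2.
pose r := r1 + r2.
have hr z : r < `|z| -> k z = 0 by move=> h; apply: hr1; rewrite /r in h; lra.
have hrp z : r < `|z| -> partial i k z = 0 by move=> h; apply: hr2; rewrite /r in h; lra.
have [L L0 hL] := Cc_partial2_bounded i bk (sk 2%N).
have [M M0 hM] := continuous_box (`|x| + 1 + r) cf.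
pose C := M * (3 * L) * vol (`|x| + 1 + r).
have C0 : 0 <= C by rewrite /C mulr_ge0 ?vol_ge0 // mulr_ge0 ?mulr_ge0 // ltW.
suff D : (fun t => t^-1 *: ((fun t => conv f k (upd i x t)) (t *: 1 + coord i x) -
           (fun t => conv f k (upd i x t)) (coord i x))) @ 0^' --> conv f (partial i k) x.
  by apply: DeriveDef; [apply/cvg_ex; exists (conv f (partial i k) x)|exact: cvg_lim D].
apply/cvgrPdist_le => e e0; near=> t.
have t0 : t != 0 by near: t; exact: nbhs_dnbhs_neq.
have t1 : `|t| < 1 by near: t; exact: dnbhs0_lt.
have te : `|t| < e / (C + 1) by near: t; apply: dnbhs0_lt; rewrite divr_gt0 // ltr_wpDl.
have bh : `|x + t *: evec R i - x| <= 1.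
  rewrite addrAC subrr add0r normrZ -[leRHS]mulr1.
  by rewrite ler_pM ?norm_evec // ltW.
have st : t *: (1 : R) = t by exact: mulr1.
rewrite /= upd_coord st [t + _]addrC upd_evec distrC.
have C1 := Cc_conv_int x cf Cck; have C2 := Cc_conv_int (x + t *: evec R i) cf Cck.
have C3 := Cc_conv_int x cf Ccp.
have C4 := Cc_sub C2 C1; have C5 := Cc_scale t^-1 C4.
rewrite /conv -J_sub // /GRing.scale /= -J_scale // -J_sub //.
rewrite (_ : (fun _ => _) = fun y => f y *
   (t^-1 * (k (x - y + t *: evec R i) - k (x - y)) - partial i k (x - y))); last first.
  by apply/funext => y; rewrite (addrAC x (t *: _)); ring.
have E : M * (3 * L * `|t|) * vol (`|x| + 1 + r) <= e.
  rewrite (@le_trans _ _ ((C + 1) * `|t|)) //.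
    by rewrite /C; have := normr_ge0 t; lra.
  by rewrite mulrC -ler_pdivlMr ?ltr_wpDl // ltW.
apply: le_trans E; apply: J_mul_bound => //.
- apply: Cc_sub; last exact: Cc_reflect.
  under eq_fun do rewrite (addrAC x (- _)).
  by apply/Cc_scale/Cc_sub; exact: Cc_reflect.
- by rewrite mulr_ge0 // mulr_ge0 // ltW.
- move=> y hy; rewrite (addrAC x (- _)) !hr ?hrp ?subrr ?mulr0 ?subr0 //;
    by apply: (norm_shift_bound _ hy); rewrite ?subrr ?normr0.
- by move=> y; apply: (diff_quotient _ t0 (sk 2%N) hL).
Unshelve. all: by end_near.
Qed.

Lemma partial_conv f k i : continuous f -> bsupp k -> smth k ->
  partial i (conv f k) = conv f (partial i k).
Proof. by move=> cf bk sk; apply/funext => x; apply: partial_val; exact: pD_conv. Qed.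

Lemma smth_conv f k : continuous f -> bsupp k -> smth k -> smth (conv f k).
Proof.
move=> cf bk sk m; elim: m k bk sk => [|m IH] k bk sk.
  by split => //; exact: conv_continuous.
apply: (@Ck_intro _ _ _ (fun i => conv f (partial i k))).
- exact: conv_continuous.
- by move=> i x; exact: pD_conv.
- by move=> i; apply: IH; [exact: bsupp_partial|exact: smth_partial].
Qed.

Lemma pD_reflect m f c i x : Ck m.+1 f ->
  pD i (fun y => f (c - y)) x (- partial i f (c - x)).
Proof.
move=> Hf; have := der_upd i (c - x) (coord i c - coord i x) Hf.
rewrite -coordB upd_coord => H.
have H1 : is_derive (coord i x) (1 : R) (fun t => coord i c - t) (- 1).
  have := is_deriveB (is_derive_cst (coord i c) (coord i x) (1 : R)) (is_derive_id (coord i x) (1 : R)).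
  by rewrite sub0r.
rewrite coordB in H.
have := @is_derive1_comp R (fun s => f (upd i (c - x) s)) (fun t => coord i c - t) _ _ _ H H1.
rewrite mulrN1 /pD; congr is_derive; apply/funext => t /=; congr f.
by apply: pt_ext; rewrite ?coordB; move: x c {H H1} => [[x0 x1] x2] [[c0 c1] c2];
  case: i => [|[|i]].
Qed.

Lemma Ck_reflect m f c : Ck m f -> Ck m (fun y => f (c - y)).
Proof.
elim: m f => [|m IH] f Hf.
  by split => //; apply: continuous_reflect; exact: Ck_cont Hf.
apply: (@Ck_intro _ _ _ (fun i y => - partial i f (c - y))).
- by apply: continuous_reflect; exact: Ck_cont Hf.
- by move=> i x; exact: pD_reflect Hf.
- by move=> i; apply/Ck_opp/IH; exact: Ck_partial.
Qed.

Lemma conv_partial m f k i : (i < 3)%N -> Ck m.+2 f -> bsupp k -> smth k ->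
  conv f (partial i k) = conv (partial i f) k.
Proof.
move=> hi Hf bk sk; apply/funext => x.
have cf := Ck_cont Hf; have Cck : Cc k by split => //; exact: Ck_cont (sk 0%N).
have Hk := Ck_reflect x (sk m.+2).
have bk' := (Cc_reflect x Cck).2.
have := J_ibp hi (bsupp_mulr f bk') Hf Hk.
have -> : partial i (fun y => k (x - y)) = fun y => - partial i k (x - y).
  by apply/funext => y; apply/partial_val/(pD_reflect _ _ _ (sk 1%N)).
have C1 := Cc_conv_int x (Ck_cont (Ck_partial i Hf)) Cck.
have C2 := Cc_conv_int x cf (Cc_partial i bk (sk 1%N)).
rewrite (_ : (fun _ => _) = fun y => partial i f y * k (x - y) - f y * partial i k (x - y)); last first.
  by apply/funext => y; rewrite mulrN.
by rewrite J_sub // => /eqP; rewrite subr_eq0 => /eqP.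
Qed.

Lemma measurable_sub_pt : measurable_fun [set: pt R * pt R] (fun p : pt R * pt R => p.1 - p.2).
Proof.
have h i : measurable_fun [set: pt R * pt R] (fun p : pt R * pt R => coord i p.1 - coord i p.2).
  have h1 : measurable_fun [set: pt R * pt R] (fun p : pt R * pt R => p.1) by exact: measurable_fst.
  have h2 : measurable_fun [set: pt R * pt R] (fun p : pt R * pt R => p.2) by exact: measurable_snd.
  exact: (measurable_funB (measurableT_comp (@measurable_coord R i) h1)
                          (measurableT_comp (@measurable_coord R i) h2)).
exact: (measurable_fun_pair (measurable_fun_pair (h 0%N) (h 1%N)) (h 2%N)).
Qed.

Lemma J_fubini (F : pt R -> pt R -> R) r M :
  measurable_fun [set: pt R * pt R] (fun p : pt R * pt R => F p.1 p.2) ->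
  (forall x y, `|F x y| <= M) ->
  (forall x y, r < `|x| \/ r < `|y| -> F x y = 0) ->
  (forall x, Cc (F x)) -> (forall y, Cc (F^~ y)) ->
  J (fun x => J (F x)) = J (fun y => J (F^~ y)).
Proof.
move=> mF hM hr c1 c2.
pose B := [set x : pt R | `|x| <= r]; pose T := (measurableTypeR R * measurableTypeR R * measurableTypeR R)%type.
have mB : measurable (B : set T) := @box_measurable R r.
have lB : (@lam3 R B < +oo)%E := @box_finite R r.
pose G : T * T -> R := fun p => F p.1 p.2.
have mG : measurable_fun [set: T * T] G by exact: mF.
have iG : (sflam3 R \x sflam3 R)%E.-integrable setT (EFin \o G).
  have -> : EFin \o G = (EFin \o G) \_ (B `*` B).
    apply/funext => p; rewrite patchE; case: ifPn => //.
    rewrite notin_setE => /not_andP h; rewrite /= /G hr //.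
    by case: h => /negP; rewrite -ltNge; [left|right].
  have mBB : measurable ((B : set T) `*` (B : set T)) by exact: measurableX.
  apply: (@integrable_mkcond _ _ R (sflam3 R \x sflam3 R)%E _ (EFin \o G) mBB).1.
  apply: measurable_bounded_integrable => //.
  - apply: (@le_lt_trans _ _ (sflam3 R B * sflam3 R B)%E).
      by have := product_measure1E (sflam3 R) (sflam3 R) mB mB => <-.
    by rewrite lte_mul_pinfty // ge0_fin_numE.
  - exact: measurable_funTS.
  - by exists M; split; [exact: num_real|move=> N MN p _; exact: le_trans (hM _ _) (ltW MN)].
have := @Fubini _ _ T T R (sflam3 R) (sflam3 R) _ iG.
rewrite /G /= => E.
have e1 : (\int[@lam3 R]_x (J (F x))%:E = \int[@lam3 R]_x \int[@lam3 R]_y (F x y)%:E)%E.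
  apply: eq_integral => x _; rewrite /J /Rintegral fineK //.
  by apply: integrable_fin_num => //; exact: Cc_integrable.
have e2 : (\int[@lam3 R]_y (J (F^~ y))%:E = \int[@lam3 R]_y \int[@lam3 R]_x (F x y)%:E)%E.
  apply: eq_integral => x _; rewrite /J /Rintegral fineK //.
  by apply: integrable_fin_num => //; exact: Cc_integrable.
by rewrite {1 3}/J /Rintegral e1 e2; congr fine.
Qed.

Lemma conv_adj f g k : Cc f -> Cc g -> Cc k -> (forall z, k (- z) = k z) ->
  J (fun x => conv f k x * g x) = J (fun y => f y * conv g k y).
Proof.
move=> Hf Hg Hk ke.
have [Mf Mf0 hMf] := Cc_bounded Hf; have [Mg Mg0 hMg] := Cc_bounded Hg.
have [Mk Mk0 hMk] := Cc_bounded Hk.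
have [rf rf0 hrf] := bsuppP Hf.2; have [rg rg0 hrg] := bsuppP Hg.2.
pose F x y := f y * k (x - y) * g x.
have c1 x : Cc (F x).
  by apply: Cc_mull; [exact: Cc_conv_int Hf.1 Hk|move=> y; exact: cvg_cst].
have c2 y : Cc (F^~ y).
  apply: Cc_mulr => //; exact: (Cc_scale (f y) (Cc_shift (- y) Hk)).1.
have := @J_fubini F (rf + rg) (Mf * Mk * Mg).
move=> H; rewrite (_ : (fun x => conv f k x * g x) = fun x => J (F x)); last first.
  apply/funext => x; rewrite /conv mulrC -J_scale; last exact: Cc_conv_int Hf.1 Hk.
  by congr J; apply/funext => y; rewrite mulrC.
rewrite (_ : (fun y => f y * conv g k y) = fun y => J (F^~ y)); last first.
  apply/funext => y; rewrite /conv -J_scale; last exact: Cc_conv_int Hg.1 Hk.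
  by congr J; apply/funext => x; rewrite /F -ke opprB; ring.
apply: H => //.
- apply: measurable_funM; first apply: measurable_funM.
  + by apply: (measurableT_comp (measurable_cont Hf.1)); exact: measurable_snd.
  + by apply: (measurableT_comp (measurable_cont Hk.1)); exact: measurable_sub_pt.
  + by apply: (measurableT_comp (measurable_cont Hg.1)); exact: measurable_fst.
- by move=> x y; rewrite /F !normrM ler_pM // ler_pM.
- move=> x y [h|h]; rewrite /F; first by rewrite hrg ?mulr0 //; lra.
  by rewrite hrf ?mul0r //; lra.
Qed.

Lemma J_conv f k : Cc f -> Cc k -> J (conv f k) = J f * J k.
Proof.
move=> Hf Hk.
have [Mf Mf0 hMf] := Cc_bounded Hf; have [Mk Mk0 hMk] := Cc_bounded Hk.
have [rf rf0 hrf] := bsuppP Hf.2; have [rk rk0 hrk] := bsuppP Hk.2.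
pose F x y := f y * k (x - y).
have := @J_fubini F (rf + rk) (Mf * Mk).
rewrite -/(conv f k) => -> //.
- rewrite mulrC -J_scale //; congr J; apply/funext => y; rewrite /F.
  rewrite J_scale; last exact: Cc_shift.
  by rewrite (J_shift (- y) Hk) mulrC.
- apply: measurable_funM.
  + by apply: (measurableT_comp (measurable_cont Hf.1)); exact: measurable_snd.
  + by apply: (measurableT_comp (measurable_cont Hk.1)); exact: measurable_sub_pt.
- by move=> x y; rewrite /F normrM ler_pM.
- move=> x y h; rewrite /F.
  have [hy|hy] := leP rf `|y|; first by rewrite hrf ?mul0r.
  rewrite hrk ?mulr0 //; case: h => h; last by lra.
  have : `|x| <= `|y| + `|x - y| by rewrite -[in leLHS](subrK y x) addrC ler_normD.
  by lra.
- by move=> x; exact: Cc_conv_int Hf.1 Hk.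
- by move=> y; apply/Cc_scale/Cc_shift.
Qed.

Lemma Cc_conv f k : Cc f -> bsupp k -> smth k -> Cc (conv f k).
Proof.
move=> [cf bf] bk sk; split; first exact: conv_continuous.
exact: conv_bsupp.
Qed.

(* Young's inequality with a non-optimal constant: completing the square avoids Cauchy-Schwarz. *)
Lemma conv_L2 f k h : Cc f -> bsupp k -> smth k -> bsupp h -> smth h ->
  (forall z, `|k z| <= h z) ->
  J (fun x => conv f k x ^+ 2) <= (J h + 1) ^+ 2 * J (fun x => f x ^+ 2).
Proof.
move=> Hf bk sk bh sh kh; have Hk : Cc k by split => //; exact: Ck_cont (sk 0%N).
have Hh : Cc h by split => //; exact: Ck_cont (sh 0%N).
have Hf2 := Cc_sqr Hf.
set K := J h; have K0 : 0 <= K by apply: J_ge0 => z; exact: le_trans (kh z).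
have K1 : 0 < K + 1 by rewrite ltr_wpDl.
have N0 : 0 <= J (fun x => f x ^+ 2) by apply: J_ge0 => x; exact: sqr_ge0.
have C1 x := Cc_conv_int x Hf.1 Hk.
have C2 x := Cc_conv_int x Hf2.1 Hh.
have P x : conv f k x ^+ 2 <= (K + 1) * conv (fun y => f y ^+ 2) h x.
  set A := conv f k x.
  have Q t : 2 * t * A <= conv (fun y => f y ^+ 2) h x + t ^+ 2 * K.
    have C3 := Cc_reflect x Hh.
    rewrite /K -(J_reflect x Hh) /A /conv -!J_scale // -J_add //; last exact: Cc_scale.
    apply: J_le; [exact: Cc_scale|apply: Cc_add => //; exact: Cc_scale|].
    move=> y; apply: (le_trans (ler_norm _)); rewrite !normrM (ger0_norm (ler0n R 2)).
    have h2 := sqr_ge0 (`|f y| - `|t|).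
    have h3 : 2 * `|t| * `|f y| <= f y ^+ 2 + t ^+ 2.
      by move: h2; rewrite sqrrB !real_normK ?num_real //; lra.
    rewrite -mulrDl mulrA ler_pM // mulr_ge0 // mulr_ge0 //.
  (* The optimal choice would be t = A / K; the denominator K + 1 stays positive even if K = 0. *)
  have := Q (A / (K + 1)); set Y := conv _ _ x => q.
  have h' : (A / (K + 1)) ^+ 2 * K <= (A / (K + 1)) ^+ 2 * (K + 1).
    by rewrite ler_wpM2l ?sqr_ge0 // lerDl.
  have e1 : (A / (K + 1)) ^+ 2 * (K + 1) = A ^+ 2 / (K + 1) by field; rewrite gt_eqF.
  have e2 : 2 * (A / (K + 1)) * A = 2 * (A ^+ 2 / (K + 1)) by field; rewrite gt_eqF.
  by rewrite mulrC -ler_pdivrMr //; lra.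
have Cc2 := Cc_conv Hf2 bh sh.
apply: (@le_trans _ _ (J (fun x => (K + 1) * conv (fun y => f y ^+ 2) h x))).
  by apply: J_le => //; [exact/Cc_sqr/Cc_conv|exact: Cc_scale].
rewrite J_scale // J_conv // expr2 -mulrA ler_wpM2l ?(ltW K1) // mulrC.
by rewrite ler_wpM2r // lerDl.
Qed.

Lemma box_measure r : 0 <= r -> vol r = (2 * r) ^+ 3 :> R.
Proof.
move=> r0; pose I : set R := `[- r, r]%classic.
have e : [set x : pt R | `|x| <= r] = (I `*` I) `*` I.
  apply/seteqP; split => x /=.
    by rewrite normpt_le => /and3P[]; rewrite /I /= !in_itv /= !ler_norml.
  by rewrite normpt_le /I /= !in_itv /= !ler_norml => -[[-> ->] ->].
have mI : measurable I by exact: measurable_itv.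
have lI : @lebesgue_measure R I = (2 * r)%:E.
  rewrite /I lebesgue_measure_itv /= lte_fin; case: ltP => h.
    by rewrite -EFinB opprK mulr2n mulrDl !mul1r.
  by congr EFin; apply/eqP; lra.
rewrite /vol e /lam3.
have e2 : (((@lebesgue_measure R) \x (@lebesgue_measure R)) (I `*` I) =
  lebesgue_measure I * lebesgue_measure I)%E by exact: product_measure1E.
have e3 : @lam3 R ((I `*` I) `*` I) = ((lebesgue_measure I * lebesgue_measure I) * lebesgue_measure I)%E.
  by rewrite -e2; apply: product_measure1E => //; exact: measurableX.
by rewrite -/(@lam3 R) e3 lI -!EFinM /=; ring.
Qed.

Lemma J_lower f r e : Cc f -> (forall x, 0 <= f x) -> (forall x, `|x| <= r -> e <= f x) ->
  e * vol r <= J f.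
Proof.
move=> Hf f0 He; have mb := @box_measurable R r.
rewrite /vol -Rintegral_cst // [leLHS]Rintegral_mkcond; apply: le_Rintegral => //.
- rewrite (_ : EFin \o _ = (EFin \o (fun=> e)) \_ [set x : pt R | `|x| <= r]); last first.
    by apply/funext => x; rewrite /= !patchE; case: ifP.
  apply: (@integrable_mkcond _ _ R (@lam3 R) _ (EFin \o (fun=> e)) mb).1.
  apply: measurable_bounded_integrable; [exact: mb|exact: box_finite|
    exact: measurable_cst|exists `|e|; split; first exact: num_real].
  by move=> N MN y _; rewrite /= ltW.
- exact: Cc_integrable.
- by move=> x _; rewrite patchE; case: ifPn => // h; apply: He; rewrite inE in h.
Qed.

Definition bump s x : R :=
  expinv 0 (s ^+ 2 - coord 0 x ^+ 2) * expinv 0 (s ^+ 2 - coord 1 x ^+ 2)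
    * expinv 0 (s ^+ 2 - coord 2 x ^+ 2).

Lemma bump_smth s : smth (bump s).
Proof.
move=> m; apply: Ck_mul; first apply: Ck_mul;
  by apply/Ck_expinv/Ck_sub; [exact: Ck_cst|apply/Ck_exp; exact: Ck_coord].
Qed.

Lemma bump_supp s x : 0 < s -> s <= `|x| -> bump s x = 0.
Proof.
move=> s0; rewrite leNgt normpt_lt !negb_and -!leNgt => h.
have E i : s <= `|coord i x| -> expinv 0 (s ^+ 2 - coord i x ^+ 2) = 0.
  move=> hi; rewrite /expinv ifF //; apply/negbTE; rewrite -leNgt subr_le0.
  by rewrite -(real_normK (num_real (coord i x))) ler_pXn2r // nnegrE ltW // (lt_le_trans s0 hi).
by rewrite /bump; case/or3P: h => /E ->; rewrite ?mulr0 ?mul0r.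
Qed.

Lemma bump_ge0 s x : 0 <= bump s x.
Proof. by rewrite /bump !mulr_ge0 ?expinv_ge0. Qed.

Lemma bump_even s x : bump s (- x) = bump s x.
Proof. by rewrite /bump !coordN !sqrrN. Qed.

Lemma bump_lower s : 0 < s -> exists2 e, 0 < e & forall x, `|x| <= s / 2 -> e <= bump s x.
Proof.
move=> s0; pose c := (s ^+ 2 - (s / 2) ^+ 2).
have c0 : 0 < c by rewrite /c; nra.
exists (expR (- c^-1) ^+ 3); first by rewrite exprn_gt0 // expR_gt0.
move=> x; rewrite normpt_le => /and3P[h0 h1 h2].
have E i : `|coord i x| <= s / 2 -> expR (- c^-1) <= expinv 0 (s ^+ 2 - coord i x ^+ 2).
  move=> h; have h' : c <= s ^+ 2 - coord i x ^+ 2.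
    rewrite /c lerD2l lerN2 -(real_normK (num_real (coord i x))).
    by rewrite ler_pXn2r // nnegrE divr_ge0 // ltW.
  have p := lt_le_trans c0 h'.
  by rewrite /expinv p expr0 mul1r ler_expR lerN2 lef_pV2 ?posrE.
have e0 := expR_ge0 (- c^-1).
by rewrite /bump exprSr expr2 !ler_pM ?mulr_ge0 // E.
Qed.

Lemma mollifier s : 0 < s -> exists eta : pt R -> R,
  [/\ smth eta, bsupp eta, forall x, s < `|x| -> eta x = 0,
      (forall x, 0 <= eta x) /\ (forall x, eta (- x) = eta x) & J eta = 1].
Proof.
move=> s0; have bb : bsupp (bump s) by exists s => x h; apply: bump_supp => //; exact: ltW.
have cb : Cc (bump s) by split => //; exact: Ck_cont (bump_smth s 0%N).
have Jb : 0 < J (bump s).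
  have [e e0 he] := bump_lower s0.
  apply: lt_le_trans (J_lower cb (bump_ge0 s) he).
  by rewrite box_measure ?divr_ge0 ?(ltW s0) // mulr_gt0 // exprn_gt0 // mulr_gt0 // divr_gt0.
exists (fun x => (J (bump s))^-1 * bump s x); split.
- by move=> m; apply: Ck_mul; [exact: Ck_cst|exact: bump_smth].
- exact: bsupp_mulr.
- by move=> x h; rewrite bump_supp ?mulr0 // ltW.
- split=> x; first by rewrite mulr_ge0 ?bump_ge0 // invr_ge0 ltW.
  by rewrite bump_even.
- by rewrite J_scale // mulVf // gt_eqF.
Qed.

(** [conv_L2] asks for a smooth majorant of the modulus of its kernel, and the modulus of a
    derivative of a mollifier need not be smooth. *)
Lemma smooth_majorant f : Cc f -> exists2 h, smth h /\ bsupp h & forall x, `|f x| <= h x.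
Proof.
move=> Hf; have [M M0 hM] := Cc_bounded Hf; have [r r0 hr] := bsuppP Hf.2.
have s0 : 0 < 2 * r by rewrite mulr_gt0.
have [e e0 he] := bump_lower s0.
exists (fun x => M / e * bump (2 * r) x).
  split; first by move=> m; apply: Ck_mul; [exact: Ck_cst|exact: bump_smth].
  by apply: bsupp_mulr; exists (2 * r) => x h; apply: bump_supp => //; exact: ltW.
move=> x; have [h|h] := leP r `|x|.
  by rewrite hr // normr0 mulr_ge0 ?bump_ge0 // divr_ge0 ?ltW.
rewrite (le_trans (hM x)) // mulrAC ler_pdivlMr // ler_pM2l // he //.
by move: h; lra.
Qed.

End Convolution.

Definition sum3 (R : realType) (F : nat -> R) : R := F 0%N + F 1%N + F 2%N.

Lemma sum3E (R : realType) (F : nat -> R) : \sum_(i < 3) F i = sum3 F.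
Proof. by rewrite !big_ord_recl big_ord0 /sum3 /= addr0 addrA. Qed.

Definition cross (R : realType) (a b : nat -> R) (i : nat) : R :=
  if i == 0%N then a 1%N * b 2%N - a 2%N * b 1%N
  else if i == 1%N then a 2%N * b 0%N - a 0%N * b 2%N
  else a 0%N * b 1%N - a 1%N * b 0%N.

(** * Smooth functions, the divergence theorem, and tactics for both *)

Section Smooth.
Variable R : realType.
Implicit Types (f g : pt R -> R).

Lemma smth_cst (c : R) : smth (fun _ : pt R => c). Proof. by move=> m; exact: Ck_cst. Qed.
Lemma smth_add f g : smth f -> smth g -> smth (fun x => f x + g x).
Proof. by move=> hf hg m; exact: Ck_add. Qed.
Lemma smth_opp f : smth f -> smth (fun x => - f x).
Proof. by move=> hf m; exact: Ck_opp. Qed.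
Lemma smth_mul f g : smth f -> smth g -> smth (fun x => f x * g x).
Proof. by move=> hf hg m; exact: Ck_mul. Qed.
Lemma smth_exp f n : smth f -> smth (fun x => f x ^+ n).
Proof. by move=> hf m; exact: Ck_exp. Qed.
Lemma smth_coord i : smth (@coord R i). Proof. by move=> m; exact: Ck_coord. Qed.
Lemma smth_cont f : smth f -> continuous f. Proof. by move=> /(_ 0%N) /Ck_cont. Qed.
Lemma smth_pD i f x : smth f -> pD i f x (partial i f x).
Proof. by move=> /(_ 1%N); exact: Ck_pD. Qed.
Lemma smth_Cc f : smth f -> bsupp f -> Cc f.
Proof. by move=> hf bf; split => //; exact: smth_cont. Qed.
Lemma smth_comm i j f x : (i < 3)%N -> (j < 3)%N -> smth f ->
  partial i (partial j f) x = partial j (partial i f) x.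
Proof. by move=> hi hj hf; exact: partial_comm (hf 2%N). Qed.
Lemma bsupp_exp f n : bsupp f -> bsupp (fun x => f x ^+ n.+1).
Proof. by move=> hf; under eq_fun do rewrite exprS; exact: bsupp_mull. Qed.

Lemma J_div (T : nat -> pt R -> R) : (forall i, smth (T i)) -> (forall i, bsupp (T i)) ->
  J (fun x => sum3 (fun i => partial i (T i) x)) = 0.
Proof.
move=> hs hb; have c i := Cc_partial i (hb i) (hs i 1%N).
rewrite /sum3 J_add ?J_add //; last exact: Cc_add.
by rewrite !(J_partial _ (hb _) (hs _ 2%N)) // !addr0.
Qed.

End Smooth.

(** [sm] and [bs] prove smoothness and bounded support along the syntax of the function; [pd]
    computes a partial derivative, whose value is left to unification. *)
Ltac sm := lazymatch goal with
  | |- forall i, smth _ => move=> ?; sm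
  | |- smth (fun _ => ?c) => exact: (smth_cst c)
  | |- smth (fun _ => _ + _) => apply: smth_add; sm
  | |- smth (fun _ => - _) => apply: smth_opp; sm
  | |- smth (fun _ => _ * _) => apply: smth_mul; sm
  | |- smth (fun _ => _ ^+ _) => apply: smth_exp; sm
  | |- smth (fun x => coord _ x) => apply: smth_coord
  | |- smth (Defs.coord _) => apply: smth_coord
  | |- smth (fun x => partial _ _ x) => apply: smth_partial; sm
  | |- smth (partial _ _) => apply: smth_partial; sm
  | H : smth ?f |- smth ?f => exact: H
  | |- smth (fun x => ?f x) => first [exact: smth_cst | match goal with H : _ |- _ => solve [apply: H] end | assumption]
  | |- smth _ => first [match goal with H : _ |- _ => solve [apply: H] end]
  end.

Ltac bs := lazymatch goal with
  | |- forall i, bsupp _ => move=> ?; bs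
  | |- bsupp (fun _ => _ + _) => apply: bsupp_add; bs
  | |- bsupp (fun _ => - _) => apply: bsupp_opp; bs
  | |- bsupp (fun _ => _ * _) => first [solve [apply: bsupp_mull; bs] | solve [apply: bsupp_mulr; bs]]
  | |- bsupp (fun _ => _ ^+ _.+1) => apply: bsupp_exp; bs
  | |- bsupp (fun x => partial _ _ x) => apply: bsupp_partial; bs
  | |- bsupp (partial _ _) => apply: bsupp_partial; bs
  | |- bsupp _ => match goal with H : _ |- _ => solve [apply: H] end
  end.

Ltac cc := apply: smth_Cc; [sm|bs].

Ltac pd := lazymatch goal with
  | |- pD _ (fun _ => ?c) _ _ => exact: (pD_cst _ c)
  | |- pD _ (fun _ => _ + _) _ _ => apply: pD_add; pd
  | |- pD _ (fun _ => - _) _ _ => apply: pD_opp; pd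
  | |- pD _ (fun _ => _ * _) _ _ => apply: pD_mul; pd
  | |- pD _ _ _ _ => apply: smth_pD; sm
  end.

(* Replacing the derivatives by variables keeps [ring] from unfolding them. *)
Ltac gen_atoms x v :=
  repeat match goal with |- context [partial ?i ?f x] => generalize (partial i f x); intro end;
  repeat match goal with |- context [v ?k x] => generalize (v k x); intro end.

(** * Twisted Gaffney and multiplier identities *)

Section Gaffney.
Variables (R : realType) (h : pt R -> R).
Hypothesis hs : smth h.
Implicit Types (u v : vfield R).

(** This is e^h rot (e^(-h) v). The operators [gradp] and [divp] are conjugated the other way:
    e^(-h) grad (e^h v) and its trace. *)
Definition rotm v : vfield R := fun i x =>
  Defs.rot v i x - cross (fun k => partial k h x) (fun k => v k x) i.
Definition gradp v j i x := partial j (v i) x + partial j h x * v i x.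
Definition divp v x := sum3 (fun i => gradp v i i x).
Definition nrm2 v x := sum3 (fun i => v i x ^+ 2).
Definition gradp2 v x := sum3 (fun j => sum3 (fun i => gradp v j i x ^+ 2)).
Definition hessq v x := 2 * (sum3 (fun i => partial i (partial i h) x) * nrm2 v x
  - sum3 (fun j => sum3 (fun i => partial j (partial i h) x * v i x * v j x))).

(** The integrands differ by the divergence of the field T, which is quadratic in v; besides the
    product rule only the symmetry of second derivatives enters. The Hessian term arises where a
    derivative falls on grad h. *)
Lemma gaffney v : (forall i, smth (v i)) -> (forall i, bsupp (v i)) ->
  J (fun x => nrm2 (rotm v) x + divp v x ^+ 2) = J (fun x => gradp2 v x + hessq v x).
Proof.
move=> sv bv.
pose T j x := v j x * (partial 0 (v 0%N) x + partial 1 (v 1%N) x + partial 2 (v 2%N) x)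
  + - (v 0%N x * partial 0 (v j) x + v 1%N x * partial 1 (v j) x + v 2%N x * partial 2 (v j) x)
  + 2 * (v j x * (partial 0 h x * v 0%N x + partial 1 h x * v 1%N x + partial 2 h x * v 2%N x))
  + - (2 * (partial j h x * (v 0%N x * v 0%N x + v 1%N x * v 1%N x + v 2%N x * v 2%N x))).
have sT j : smth (T j) by rewrite /T; sm.
have bT j : bsupp (T j) by rewrite /T; bs.
have C1 : Cc (fun x => nrm2 (rotm v) x + divp v x ^+ 2).
  rewrite /nrm2 /divp /rotm /gradp /Defs.rot /cross /sum3 /=; cc.
have C2 : Cc (fun x => gradp2 v x + hessq v x).
  rewrite /gradp2 /hessq /nrm2 /gradp /sum3 /=; cc.
apply/eqP; rewrite -subr_eq0 -J_sub //; apply/eqP.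
rewrite -(J_div sT bT); congr J; apply/funext => x.
eassert (e0 : partial 0 (T 0%N) x = _). { apply: partial_val; rewrite /T; pd. }
eassert (e1 : partial 1 (T 1%N) x = _). { apply: partial_val; rewrite /T; pd. }
eassert (e2 : partial 2 (T 2%N) x = _). { apply: partial_val; rewrite /T; pd. }
rewrite /sum3 e0 e1 e2 /gradp2 /hessq /nrm2 /divp /gradp /rotm /Defs.rot /cross /sum3 /=.
have c10 k := @smth_comm R 1 0 (v k) x isT isT (sv k).
have c20 k := @smth_comm R 2 0 (v k) x isT isT (sv k).
have c21 k := @smth_comm R 2 1 (v k) x isT isT (sv k).
move: (c10 0%N) (c10 1%N) (c10 2%N) (c20 0%N) (c20 1%N) (c20 2%N) (c21 0%N) (c21 1%N) (c21 2%N)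
  (@smth_comm R 1 0 h x isT isT hs) (@smth_comm R 2 0 h x isT isT hs)
  (@smth_comm R 2 1 h x isT isT hs).
clear; gen_atoms x v.
by do 12 (move=> E; rewrite ?E {E}); ring.
Qed.

(* The multiplier identity: all zero-order terms in grad h cancel, so it holds with the
   twisted operators as well. *)
Definition mulq (X : vfield R) v x :=
  sum3 (fun i => partial i (X i) x) * nrm2 v x
  - sum3 (fun j => sum3 (fun i => partial j (X i) x * v i x * v j x)).

Lemma mulq_vanish X v x : (forall i, v i x = 0) -> mulq X v x = 0.
Proof.
by move=> v0; rewrite /mulq /nrm2 /sum3 !v0; clear; gen_atoms x X; ring.
Qed.

Lemma sum3_mul0 (a b : nat -> R) : (forall i, b i = 0) -> sum3 (fun i => a i * b i) = 0.
Proof. by move=> b0; rewrite /sum3 !b0 !mulr0 !addr0. Qed.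

Lemma multiplier X v : (forall i, smth (X i)) -> (forall i, smth (v i)) ->
  (forall i, bsupp (v i)) ->
  J (fun x => mulq X v x
     + sum3 (fun i => cross (fun k => X k x) (fun k => v k x) i * rotm v i x)
     + sum3 (fun j => sum3 (fun i => X j x * v i x * gradp v j i x))
     - divp v x * sum3 (fun i => X i x * v i x)) = 0.
Proof.
move=> sX sv bv.
pose T j x := X j x * (v 0%N x * v 0%N x + v 1%N x * v 1%N x + v 2%N x * v 2%N x)
  + - (v j x * (X 0%N x * v 0%N x + X 1%N x * v 1%N x + X 2%N x * v 2%N x)).
have sT j : smth (T j) by rewrite /T; sm.
have bT j : bsupp (T j) by rewrite /T; bs.
rewrite -(J_div sT bT); congr J; apply/funext => x.
eassert (e0 : partial 0 (T 0%N) x = _). { apply: partial_val; rewrite /T; pd. }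
eassert (e1 : partial 1 (T 1%N) x = _). { apply: partial_val; rewrite /T; pd. }
eassert (e2 : partial 2 (T 2%N) x = _). { apply: partial_val; rewrite /T; pd. }
rewrite /mulq /sum3 e0 e1 e2 /nrm2 /divp /gradp /rotm /Defs.rot /cross /sum3 /=.
clear; gen_atoms x v; gen_atoms x X; ring.
Qed.

Variable G : pt R -> R.
Hypotheses (Gs : smth G) (G0 : forall x, 0 < G x).

Let sV : smth (fun x => (G x)^-1).
Proof. by move=> m; apply: Ck_inv => // x; rewrite gt_eqF. Qed.

Definition logX : vfield R := fun i x => - partial i G x * (G x)^-1.
Definition quot v : vfield R := fun i x => v i x * (G x)^-1.

Lemma smth_logX i : smth (logX i).
Proof. by rewrite /logX; sm. Qed.

Lemma partial_quot v i j x : (forall i, smth (v i)) ->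
  G x * partial j (quot v i) x = partial j (v i) x + logX j x * v i x.
Proof.
move=> sv; have g0 : G x != 0 by rewrite gt_eqF.
have -> : partial j (quot v i) x = partial j (v i) x * (G x)^-1 + v i x * (- (G x) ^- 2 * partial j G x).
  apply/partial_val/pD_mul; first exact: smth_pD.
  by apply: pD_inv => //; exact: smth_pD.
by rewrite /logX; move: (partial _ _ _) (partial _ _ _) => a b; field.
Qed.

(** Division by G adds X v to the twisted gradient, and likewise X x v to the twisted rotation.
    Hence the Gaffney identity for v / G involves exactly the combinations produced by completing
    squares in [twisted_pointwise]. *)
Lemma gradp_quot v i j x : (forall i, smth (v i)) ->
  G x * gradp (quot v) j i x = gradp v j i x + logX j x * v i x.
Proof.
move=> sv; rewrite /gradp mulrDr partial_quot // {1}/quot.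
have g0 : G x != 0 by rewrite gt_eqF.
by move: (partial _ _ _) (partial _ _ _) (logX _ _) => a b d; field.
Qed.

Lemma rotm_quot v i x : (forall i, smth (v i)) ->
  G x * rotm (quot v) i x = rotm v i x + cross (fun k => logX k x) (fun k => v k x) i.
Proof.
move=> sv; have g0 : G x != 0 by rewrite gt_eqF.
have E k : G x * quot v k x = v k x by rewrite /quot mulrC divfK.
rewrite /rotm /Defs.rot /cross.
have P k l := partial_quot k l x sv.
have L (p q a b y z : R) : G x * (p - q - (a * y - b * z)) =
    G x * p - G x * q - (a * (G x * y) - b * (G x * z)) by ring.
case: i => [|[|i]] /=; rewrite L !P !E; clear; gen_atoms x v;
  by move: (logX _ x) (logX _ x) => u1 u2; ring.
Qed.

(** With A = N + X v, of trace D + Xv, completing squares leaves half of |om + X x v|^2 and half of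
    |A|^2. Splitting a third of the squared trace off |A|^2 gives the 1 / 6 in k; the identity with
    weight b raises it to 1 / 6 + b / 3. The bound b <= 1 keeps the coefficient 1 - b of the
    discarded squares nonnegative. *)
Lemma twisted_pointwise (X v om : nat -> R) (N : nat -> nat -> R) (Q b g D Xv k : R) :
  0 <= Q -> 0 <= b <= 1 -> D = sum3 (fun i => N i i) ->
  Xv = sum3 (fun i => X i * v i) -> k = 1 / 6 + b / 3 ->
  g - sum3 (fun i => X i ^+ 2) * sum3 (fun i => v i ^+ 2) + (1 / 2 + k) * Xv ^+ 2
     + (2 * k - 1) * (D * Xv) + (k - 1 / 2) * D ^+ 2 <=
  1 / 2 * sum3 (fun i => om i ^+ 2)
   + 1 / 2 * (sum3 (fun j => sum3 (fun i => N j i ^+ 2)) + Q) - 1 / 2 * D ^+ 2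
   + (g + sum3 (fun i => cross X v i * om i) + sum3 (fun j => sum3 (fun i => X j * v i * N j i))
      - D * Xv)
   + b / 2 * (sum3 (fun i => (om i + cross X v i) ^+ 2) + (D + Xv) ^+ 2
      - sum3 (fun j => sum3 (fun i => (N j i + X j * v i) ^+ 2)) - Q).
Proof.
move=> Q0 /andP[b0 b1] -> -> ->; rewrite -subr_ge0.
pose A j i := N j i + X j * v i.
pose W := sum3 (fun i => (om i + cross X v i) ^+ 2).
pose off := A 0%N 1%N ^+ 2 + A 0%N 2%N ^+ 2 + A 1%N 0%N ^+ 2 + A 1%N 2%N ^+ 2 + A 2%N 0%N ^+ 2 + A 2%N 1%N ^+ 2.
pose tr := (A 0%N 0%N - A 1%N 1%N) ^+ 2 + (A 0%N 0%N - A 2%N 2%N) ^+ 2 + (A 1%N 1%N - A 2%N 2%N) ^+ 2.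
have W0 : 0 <= W by rewrite /W /sum3 !addr_ge0 ?sqr_ge0.
have off0 : 0 <= off by rewrite /off !addr_ge0 ?sqr_ge0.
have tr0 : 0 <= tr by rewrite /tr !addr_ge0 ?sqr_ge0.
have H : 0 <= 1 / 2 * (1 + b) * W + 1 / 2 * (1 - b) * (off + tr / 3 + Q).
  by apply: addr_ge0; apply: mulr_ge0 => //; lra.
apply: (le_trans H); rewrite le_eqVlt; apply/orP; left; apply/eqP.
by rewrite /W /off /tr /A /cross /sum3 /=; field.
Qed.

Lemma cauchy3 (a b : nat -> R) :
  sum3 (fun i => a i * b i) ^+ 2 <= sum3 (fun i => a i ^+ 2) * sum3 (fun i => b i ^+ 2).
Proof.
rewrite -subr_ge0 /sum3.
have -> : (a 0%N ^+ 2 + a 1%N ^+ 2 + a 2%N ^+ 2) * (b 0%N ^+ 2 + b 1%N ^+ 2 + b 2%N ^+ 2)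
   - (a 0%N * b 0%N + a 1%N * b 1%N + a 2%N * b 2%N) ^+ 2 =
   (a 0%N * b 1%N - a 1%N * b 0%N) ^+ 2 + (a 0%N * b 2%N - a 2%N * b 0%N) ^+ 2
   + (a 1%N * b 2%N - a 2%N * b 1%N) ^+ 2 by ring.
by rewrite !addr_ge0 ?sqr_ge0.
Qed.

(** Half the Gaffney identity for v, the multiplier identity, and c / 2 times the Gaffney identity
    for v / G combine into a function F whose integral is that of |rot_h v|^2. The condition c <=
    G^2 makes the pointwise weight b = c / G^2 at most 1. *)
Theorem twisted_inequality v (c lam B tau : R) :
  (forall i, smth (v i)) -> (forall i, bsupp (v i)) ->
  (forall u x, 0 <= hessq u x) -> 0 <= c -> (forall x, c <= G x ^+ 2) ->
  0 < B -> 0 < tau ->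
  (forall x, (forall i, v i x = 0) \/
     (sum3 (fun i => logX i x ^+ 2) <= B /\
      lam * nrm2 v x <= mulq logX v x - sum3 (fun i => logX i x ^+ 2) * nrm2 v x
        + (2 / 3 + c / (3 * G x ^+ 2)) * sum3 (fun i => logX i x * v i x) ^+ 2)) ->
  (lam - tau) * J (nrm2 v) <=
    J (nrm2 (rotm v)) + (1 / 2 + B / (4 * tau)) * J (fun x => divp v x ^+ 2).
Proof.
move=> sv bv Hq c0 cG B0 tau0 Hpt.
have sX := smth_logX.
have sy i : smth (quot v i) by rewrite /quot; sm.
have by_ i : bsupp (quot v i) by rewrite /quot; bs.
have C1 : Cc (nrm2 (rotm v)) by rewrite /nrm2 /rotm /Defs.rot /cross /sum3 /=; cc.
have C2 : Cc (fun x => divp v x ^+ 2) by rewrite /divp /gradp /sum3 /=; cc.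
have C3 : Cc (fun x => gradp2 v x + hessq v x).
  by rewrite /gradp2 /hessq /nrm2 /gradp /sum3 /=; cc.
have Cv : Cc (nrm2 v) by rewrite /nrm2 /sum3; cc.
have C4 : Cc (fun x => nrm2 (rotm (quot v)) x + divp (quot v) x ^+ 2).
  by rewrite /nrm2 /divp /rotm /gradp /Defs.rot /cross /sum3 /=; cc.
have C5 : Cc (fun x => gradp2 (quot v) x + hessq (quot v) x).
  by rewrite /gradp2 /hessq /nrm2 /gradp /sum3 /=; cc.
set M := fun x => mulq logX v x
     + sum3 (fun i => cross (fun k => logX k x) (fun k => v k x) i * rotm v i x)
     + sum3 (fun j => sum3 (fun i => logX j x * v i x * gradp v j i x))
     - divp v x * sum3 (fun i => logX i x * v i x).
have CM : Cc M.
  by rewrite /M /mulq /nrm2 /divp /gradp /rotm /Defs.rot /cross /sum3 /=; cc.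
have JM : J M = 0 by exact: multiplier.
have E1 := gaffney sv bv; have E2 := gaffney sy by_.
rewrite J_add // in E1.
pose F x := 1 / 2 * nrm2 (rotm v) x + 1 / 2 * (gradp2 v x + hessq v x)
   - 1 / 2 * divp v x ^+ 2 + M x
   + (c / 2 * (nrm2 (rotm (quot v)) x + divp (quot v) x ^+ 2)
      - c / 2 * (gradp2 (quot v) x + hessq (quot v) x)).
have Ca := Cc_scale (1 / 2) C1; have Cb := Cc_scale (1 / 2) C3; have Cd := Cc_scale (1 / 2) C2.
have Ce := Cc_scale (c / 2) C4; have Cf := Cc_scale (c / 2) C5.
have Cab := Cc_add Ca Cb; have Cabd := Cc_sub Cab Cd; have CabdM := Cc_add Cabd CM.
have Cef := Cc_sub Ce Cf.
have JF : J F = J (nrm2 (rotm v)).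
  rewrite /F (J_add CabdM Cef) (J_add Cabd CM) (J_sub Cab Cd) (J_add Ca Cb) (J_sub Ce Cf).
  rewrite (J_scale _ C1) (J_scale _ C3) (J_scale _ C2) (J_scale _ C4) (J_scale _ C5) JM E2 subrr.
  by move: E1; set A := J _; set A2 := J _; set A3 := J _ => E1; lra.
set K := 1 / 2 + B / (4 * tau).
suff H : J (fun x => (lam - tau) * nrm2 v x - K * divp v x ^+ 2) <= J F.
  by move: H; rewrite JF J_sub ?J_scale //; [lra|exact: Cc_scale|exact: Cc_scale].
apply: J_le.
- by apply: Cc_sub; exact: Cc_scale.
- exact: Cc_add.
move=> x; set g := G x; have g0 : 0 < g by exact: G0.
have g20 : 0 < g ^+ 2 by rewrite exprn_gt0.
set b := c / g ^+ 2.
have b01 : 0 <= b <= 1.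
  by rewrite /b divr_ge0 ?(ltW g20) //= ler_pdivrMr // mul1r; exact: cG.
have := @twisted_pointwise (fun k => logX k x) (fun k => v k x) (fun k => rotm v k x)
  (fun j i => gradp v j i x) (hessq v x) b (mulq logX v x) _ _ _ (Hq _ _) b01 erefl erefl erefl.
rewrite /=; set R1 := (X in X <= _); set R2 := (X in _ <= X) => H12.
have EF : F x = R2.
  rewrite /F /R2 /M -!/(divp v x).
  have r1 : c / 2 * (nrm2 (rotm (quot v)) x + divp (quot v) x ^+ 2)
      - c / 2 * (gradp2 (quot v) x + hessq (quot v) x) =
    b / 2 * (sum3 (fun i => (rotm v i x + cross (fun k => logX k x) (fun k => v k x) i) ^+ 2)
      + (divp v x + sum3 (fun i => logX i x * v i x)) ^+ 2
      - sum3 (fun j => sum3 (fun i => (gradp v j i x + logX j x * v i x) ^+ 2)) - hessq v x).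
    have q1 : hessq (quot v) x = hessq v x / g ^+ 2.
      rewrite /hessq /nrm2 /quot /sum3 -/g.
      gen_atoms x v; have gn : g != 0 by rewrite gt_eqF.
      by field.
    have q2 : divp v x + sum3 (fun i => logX i x * v i x) = g * divp (quot v) x.
      have L (p q r : R) : G x * (p + q + r) = G x * p + G x * q + G x * r by ring.
      rewrite /divp /sum3 /g L !gradp_quot //.
      by move: (gradp v _ _ x) (gradp v _ _ x) (gradp v _ _ x) => u1 u2 u3; ring.
    have q3 j i : gradp v j i x + logX j x * v i x = g * gradp (quot v) j i x.
      by rewrite /g gradp_quot.
    have q4 i : rotm v i x + cross (fun k => logX k x) (fun k => v k x) i = g * rotm (quot v) i x.
      by rewrite /g rotm_quot.
    rewrite q1 q2 /nrm2 /gradp2 /sum3 !q3 !q4 /b.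
    move: (hessq v x) (divp (quot v) x) (rotm (quot v) _ x) (rotm (quot v) _ x) (rotm (quot v) _ x).
    move=> a1 a2 a3 a4 a5.
    move: (gradp (quot v) _ _ x) (gradp (quot v) _ _ x) (gradp (quot v) _ _ x)
      (gradp (quot v) _ _ x) (gradp (quot v) _ _ x) (gradp (quot v) _ _ x)
      (gradp (quot v) _ _ x) (gradp (quot v) _ _ x) (gradp (quot v) _ _ x).
    move=> u1 u2 u3 u4 u5 u6 u7 u8 u9; have gn : g != 0 by rewrite gt_eqF.
    by field.
  by rewrite r1 -/(gradp2 v x) -/(nrm2 (rotm v) x).
rewrite EF; apply: le_trans H12.
have kk : 2 / 3 + c / (3 * G x ^+ 2) = 1 / 2 + (1 / 6 + b / 3).
  by rewrite /b -/g; field; rewrite gt_eqF.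
rewrite /R1 -/(nrm2 v x) -/(divp v x).
set D := divp v x; set Xv := sum3 (fun i => logX i x * v i x).
have D0 : 0 <= D ^+ 2 by exact: sqr_ge0.
have K1 : 0 <= B / (4 * tau) by rewrite divr_ge0 ?mulr_ge0 // ltW.
have [b0 b1] := andP b01.
have [v0|[HB Hl]] := Hpt x.
  have Xv0 : Xv = 0 by exact: sum3_mul0.
  have n0 : nrm2 v x = 0 by rewrite /nrm2 /sum3 !v0 expr0n /= !addr0.
  have m0 : mulq logX v x = 0 by exact: mulq_vanish.
  rewrite Xv0 n0 m0 /K; have := mulr_ge0 K1 D0; have := mulr_ge0 b0 D0; lra.
rewrite kk -/Xv in Hl.
have n0 : 0 <= nrm2 v x by rewrite /nrm2 /sum3 !addr_ge0 ?sqr_ge0.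
have CS : Xv ^+ 2 <= B * nrm2 v x.
  by rewrite (le_trans (cauchy3 _ _)) // ler_wpM2r.
(* Young's inequality with weight tau, after Xv^2 <= B |v|^2: this is the origin of tau and of B /
   (4 tau) in the conclusion. *)
have Y : `|D * Xv| <= B / (4 * tau) * D ^+ 2 + tau * nrm2 v x.
  have t4 : 0 < 4 * tau * B by rewrite !mulr_gt0.
  have bn : B != 0 by rewrite gt_eqF.
  have tn : tau != 0 by rewrite gt_eqF.
  have e2 : tau * (Xv ^+ 2 / B) <= tau * nrm2 v x.
    by rewrite ler_pM2l // ler_pdivrMr // mulrC.
  have p1 : 0 <= B / (4 * tau) * D ^+ 2 + tau * (Xv ^+ 2 / B) - D * Xv.
    have -> : B / (4 * tau) * D ^+ 2 + tau * (Xv ^+ 2 / B) - D * Xv =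
      (B * D - 2 * tau * Xv) ^+ 2 / (4 * tau * B) by clear -bn tn; field; rewrite bn tn.
    by rewrite divr_ge0 ?sqr_ge0 // ltW.
  have p2 : 0 <= B / (4 * tau) * D ^+ 2 + tau * (Xv ^+ 2 / B) + D * Xv.
    have -> : B / (4 * tau) * D ^+ 2 + tau * (Xv ^+ 2 / B) + D * Xv =
      (B * D + 2 * tau * Xv) ^+ 2 / (4 * tau * B) by clear -bn tn; field; rewrite bn tn.
    by rewrite divr_ge0 ?sqr_ge0 // ltW.
  move: p1 p2 e2; rewrite ler_norml; move: (tau * (Xv ^+ 2 / B)) (B / (4 * tau) * D ^+ 2)
    (tau * nrm2 v x) (D * Xv) => w1 w2 w3 w4 p1 p2 p3.
  apply/andP; split; lra.
have : - (`|D * Xv|) <= (2 * (1 / 6 + b / 3) - 1) * (D * Xv).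
  rewrite lerNl -mulNr (le_trans (ler_norm _)) // normrM ler_piMl //.
  by rewrite ler_norml; lra.
move: Y Hl; rewrite /K; have := mulr_ge0 b0 D0.
set n := nrm2 v x in n0 *; set X2 := sum3 (fun i => logX i x ^+ 2).
set DX := D * Xv; set XX := Xv ^+ 2; set DD := D ^+ 2; set BB := B / (4 * tau) * DD.
have -> : (1 / 2 + B / (4 * tau)) * DD = DD / 2 + BB by rewrite /BB; field; rewrite gt_eqF.
move: (D0 : 0 <= DD); clearbody DD DX XX X2 n BB; move: (mulq logX v x) => m.
lra.
Qed.

End Gaffney.

(** * The barrier G and the lower bound on a ball *)

Section Barrier.
Variable R : realType.

Lemma smth_expinv n (f : pt R -> R) : smth f -> smth (fun x => expinv n (f x)).
Proof. by move=> hf m; exact: Ck_expinv. Qed.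

Lemma smth_inv (f : pt R -> R) : (forall x, f x != 0) -> smth f -> smth (fun x => (f x)^-1).
Proof. by move=> f0 hf m; exact: Ck_inv. Qed.

Definition sstep (a b t : R) : R := expinv 0 (t - a) * (expinv 0 (t - a) + expinv 0 (b - t))^-1.

Lemma expinv_gt0 n (t : R) : 0 < t -> 0 < expinv n t.
Proof. by move=> t0; rewrite /expinv t0 mulr_gt0 ?expR_gt0 // exprn_gt0 // invr_gt0. Qed.

Lemma expinv_le0 n (t : R) : t <= 0 -> expinv n t = 0.
Proof. by move=> t0; rewrite /expinv ltNge t0. Qed.

Lemma sstep_den (a b t : R) : a < b -> 0 < expinv 0 (t - a) + expinv 0 (b - t).
Proof.
move=> ab; have [h|h] := ltP a t.
  by rewrite ltr_pwDl ?expinv_ge0 // expinv_gt0 // subr_gt0.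
by rewrite ltr_wpDl ?expinv_ge0 // expinv_gt0 // subr_gt0 (le_lt_trans h).
Qed.

Lemma sstep01 (a b t : R) : a < b -> 0 <= sstep a b t <= 1.
Proof.
move=> ab; have d := sstep_den t ab.
rewrite /sstep divr_ge0 ?expinv_ge0 ?(ltW d) //= ler_pdivrMr // mul1r lerDl expinv_ge0 //.
Qed.

Lemma sstep0 (a b t : R) : t <= a -> sstep a b t = 0.
Proof. by move=> h; rewrite /sstep expinv_le0 ?mul0r // subr_le0. Qed.

Lemma sstep1 (a b t : R) : a < b -> b <= t -> sstep a b t = 1.
Proof.
move=> ab h; have := sstep_den t ab; rewrite /sstep (expinv_le0 0 (_ : b - t <= 0)) ?subr_le0 //.
by rewrite addr0 => d; rewrite divff // gt_eqF.
Qed.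

Lemma smth_sstep (a b : R) (f : pt R -> R) : a < b -> smth f -> smth (fun x => sstep a b (f x)).
Proof.
move=> ab hf; rewrite /sstep; apply: smth_mul.
  by apply/smth_expinv/smth_add => //; exact: smth_cst.
apply: smth_inv => [x|]; first by rewrite gt_eqF // sstep_den.
apply: smth_add; apply: smth_expinv; apply: smth_add => //; try exact: smth_cst.
exact: smth_opp.
Qed.

Variables (m : pt R) (lam : R).
Hypothesis lam0 : 0 < lam.

(** The factor lam / 4 makes the Hessian of - rad equal to - lam / 2 times the identity: its trace
    with one direction removed is - lam, the value the multiplier needs at m. The set rad < 1 is the
    ball of radius 2 / sqrt lam. *)
Definition rad (x : pt R) : R :=
  lam / 4 * ((coord 0 x - coord 0 m) * (coord 0 x - coord 0 m)
  + (coord 1 x - coord 1 m) * (coord 1 x - coord 1 m)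
  + (coord 2 x - coord 2 m) * (coord 2 x - coord 2 m)).

(** The quadratic term keeps the profile positive up to rad = 1, where 1 - rad vanishes;
    [profile_ineq] is the condition that it has to meet. *)
Definition prof (x : pt R) : R := 1 - rad x + rad x * rad x * 5^-1.

(** Beyond rad = 1 the profile is joined to the constant 1, which makes G smooth and positive on all
    of R^3; the fields it is applied to vanish there. *)
Definition barrier (x : pt R) : R :=
  prof x * (1 - sstep 1 (21 / 20) (rad x)) + sstep 1 (21 / 20) (rad x).

Lemma smth_rad : smth rad.
Proof. rewrite /rad; sm. Qed.

Lemma smth_prof : smth prof.
Proof. have := smth_rad; rewrite /prof => H; sm. Qed.

Lemma smth_barrier : smth barrier.
Proof.
have h := smth_rad; have hp := smth_prof.
have hs : smth (fun x => sstep 1 (21 / 20) (rad x)) by apply: smth_sstep => //; lra.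
rewrite /barrier; sm.
Qed.

Lemma rad_ge0 x : 0 <= rad x.
Proof. by rewrite /rad mulr_ge0 ?divr_ge0 ?(ltW lam0) // -!expr2 !addr_ge0 ?sqr_ge0. Qed.

Lemma barrier_lower x : 3 / 20 <= barrier x.
Proof.
rewrite /barrier; have ab : (1 : R) < 21 / 20 by lra.
have [h|h] := leP (21 / 20) (rad x); first by rewrite (sstep1 ab h); lra.
have /andP[s0 s1] := sstep01 (rad x) ab.
have p : 3 / 20 <= prof x by rewrite /prof; have := rad_ge0 x; nra.
move: (sstep _ _ _) s0 s1 => t t0 t1; nra.
Qed.

Lemma barrier_gt0 x : 0 < barrier x.
Proof. by rewrite (lt_le_trans _ (barrier_lower x)). Qed.

Lemma near_rad x : rad x < 1 -> \forall y \near x, barrier y = prof y.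
Proof.
move=> h; have e0 : 0 < 1 - rad x by rewrite subr_gt0.
have [d d0 D] := continuous_near x (smth_cont smth_rad) e0.
apply/near_pt; exists d => // y /D hy; rewrite /barrier sstep0; first by rewrite subr0 mulr1 addr0.
by have := ler_norm (rad y - rad x); lra.
Qed.

Lemma partial_rad i x : (i < 3)%N -> partial i rad x = lam / 2 * (coord i x - coord i m).
Proof.
move=> hi; eassert (e : partial i rad x = _). { apply: partial_val; rewrite /rad; pd. }
rewrite e (@partial_coord R i 0 hi isT) (@partial_coord R i 1 hi isT) (@partial_coord R i 2 hi isT).
by case: i hi {e} => [|[|[|i]]] //= _; field.
Qed.

Lemma partial_prof i x : (i < 3)%N ->
  partial i prof x = (-1 + 2 / 5 * rad x) * (lam / 2 * (coord i x - coord i m)).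
Proof.
move=> hi.
have -> : partial i prof x = (-1 + 2 / 5 * rad x) * partial i rad x.
  have hr := smth_rad; eassert (e : partial i prof x = _).
    { apply: partial_val; rewrite /prof; pd. }
  by rewrite e; move: (partial i rad x) (rad x) => a b; field.
by rewrite partial_rad.
Qed.

Lemma partial2_prof i j x : (i < 3)%N -> (j < 3)%N ->
  partial i (partial j prof) x = (-1 + 2 / 5 * rad x) * (lam / 2 * (i == j)%:R)
    + lam ^+ 2 / 10 * (coord i x - coord i m) * (coord j x - coord j m).
Proof.
move=> hi hj; have hr := smth_rad.
have -> : partial j prof = fun x => (-1 + 2 / 5 * rad x) * (lam / 2 * (coord j x - coord j m)).
  by apply/funext => y; exact: partial_prof.
eassert (e : partial i (fun x => (-1 + 2 / 5 * rad x) * (lam / 2 * (coord j x - coord j m))) x = _).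
  { apply: partial_val; pd. }
rewrite e partial_rad // (@partial_coord R i j hi hj).
by move: (rad x) (coord i x) (coord i m) (coord j x) (coord j m) => a b b' b'' b3 /=; field.
Qed.

Lemma partial_barrier i x : rad x < 1 -> partial i barrier x = partial i prof x.
Proof. by move=> h; apply: partial_near; exact: near_rad. Qed.

Lemma partial2_barrier i j x : rad x < 1 ->
  partial i (partial j barrier) x = partial i (partial j prof) x.
Proof.
move=> h; apply: partial_near; have e0 : 0 < 1 - rad x by rewrite subr_gt0.
have [d d0 D] := continuous_near x (smth_cont smth_rad) e0.
apply/near_pt; exists d => // y /D hy; apply: partial_barrier.
by have := ler_norm (rad y - rad x); lra.
Qed.

(* With t = 1 - s this is a polynomial whose coefficients of order at least 3 are positive. *)
Lemma profile_ineq (s g : R) : 0 <= s <= 1 -> g = 1 - s + s ^+ 2 / 5 ->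
  (g ^+ 2 - 1 / 50) * (1 - 2 / 5 * s) ^+ 2 <= 3 * (3 / 5 - s / 5) * g ^+ 3.
Proof.
move=> /andP[s0 s1] ->; rewrite -subr_ge0; pose t := 1 - s.
have t0 : 0 <= t by rewrite subr_ge0.
have -> : 3 * (3 / 5 - s / 5) * (1 - s + s ^+ 2 / 5) ^+ 3
   - ((1 - s + s ^+ 2 / 5) ^+ 2 - 1 / 50) * (1 - 2 / 5 * s) ^+ 2 =
  3 / 1250 * (1 - t) ^+ 2 + 13 / 250 * t ^+ 2 + 6 / 25 * t ^+ 3 + 38 / 125 * t ^+ 4
  + 108 / 625 * t ^+ 5 + 29 / 625 * t ^+ 6 + 3 / 625 * t ^+ 7.
  by rewrite /t; field.
have P (a b k : nat) (u : R) : 0 <= u -> 0 <= a%:R / b%:R * u ^+ k.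
  by move=> u0; apply: mulr_ge0; [apply: divr_ge0; exact: ler0n|exact: exprn_ge0].
have u0 : 0 <= 1 - t by rewrite /t; lra.
do 5 (apply: addr_ge0; last exact: P).
by apply: addr_ge0; exact: P.
Qed.

Lemma mulq_logX (v : vfield R) x :
  mulq (logX barrier) v x = - (sum3 (fun i => partial i (partial i barrier) x) * nrm2 v x
    - sum3 (fun j => sum3 (fun i => partial j (partial i barrier) x * v i x * v j x))) / barrier x
  + (sum3 (fun i => partial i barrier x ^+ 2) * nrm2 v x
     - sum3 (fun i => partial i barrier x * v i x) ^+ 2) / barrier x ^+ 2.
Proof.
have sG := smth_barrier; have g0 y : barrier y != 0 by rewrite gt_eqF // barrier_gt0.
have P i j : partial j (logX barrier i) x = - partial j (partial i barrier) x / barrier x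
    + partial i barrier x * partial j barrier x / barrier x ^+ 2.
  have -> : partial j (logX barrier i) x = - partial j (partial i barrier) x * (barrier x)^-1
      + - partial i barrier x * (- (barrier x) ^- 2 * partial j barrier x).
    apply: partial_val; rewrite /logX; apply: pD_mul; first by pd.
    exact: (@pD_inv R j barrier x _ (g0 x) (smth_pD j x sG)).
  have gx := g0 x; move: (partial j (partial i barrier) x) (partial i barrier x)
    (partial j barrier x) => a b d; by field.
pose mulqa (D : nat -> nat -> R) := sum3 (fun i => D i i) * nrm2 v x
  - sum3 (fun j => sum3 (fun i => D i j * v i x * v j x)).
transitivity (mulqa (fun i j => - partial j (partial i barrier) x / barrier x
    + partial i barrier x * partial j barrier x / barrier x ^+ 2)).
  by rewrite -/(mulqa (fun i j => partial j (logX barrier i) x)); congr mulqa;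
    apply/funext => i; apply/funext => j; exact: P.
rewrite /mulqa /sum3; have gx := g0 x; clear P mulqa; rewrite /nrm2 /sum3.
by move: gx; gen_atoms x v; move: (barrier x) => g gx; field.
Qed.

(** Up to the factor lam / g the claim is s (1 - s) n / 5 + be k >= 0, where be = lam (z . v)^2 / 4
    lies between 0 and s n. The left side is affine in be; at the radial extreme be = s n it is
    [profile_ineq]. *)
Lemma barrier_pointwise (v : vfield R) x : rad x < 1 ->
  sum3 (fun i => logX barrier i x ^+ 2) <= 25 * lam /\
  lam * nrm2 v x <= mulq (logX barrier) v x - sum3 (fun i => logX barrier i x ^+ 2) * nrm2 v x
    + (2 / 3 + 1 / 50 / (3 * barrier x ^+ 2)) * sum3 (fun i => logX barrier i x * v i x) ^+ 2.
Proof.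
move=> h; have h0 := rad_ge0 x.
have eG : barrier x = 1 - rad x + rad x ^+ 2 / 5.
  by rewrite /barrier sstep0 ?(ltW h) // subr0 mulr1 addr0 /prof expr2.
have p1 i : (i < 3)%N -> partial i barrier x = (-1 + 2 / 5 * rad x) * (lam / 2 * (coord i x - coord i m)).
  by move=> hi; rewrite partial_barrier // partial_prof.
have p2 i j : (i < 3)%N -> (j < 3)%N -> partial i (partial j barrier) x =
    (-1 + 2 / 5 * rad x) * (lam / 2 * (i == j)%:R)
    + lam ^+ 2 / 10 * (coord i x - coord i m) * (coord j x - coord j m).
  by move=> hi hj; rewrite partial2_barrier // partial2_prof.
pose z i := coord i x - coord i m.
set s := rad x in h h0 eG p1 p2 *; set g := barrier x in eG *.
have ez : z 0%N ^+ 2 + z 1%N ^+ 2 + z 2%N ^+ 2 = 4 * s / lam.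
  by rewrite /s /rad /z; field; rewrite gt_eqF.
have g0 : 0 < g by exact: barrier_gt0.
have g15 : 1 / 5 <= g by rewrite eG; nra.
have gn : g != 0 by rewrite gt_eqF.
have ln : lam != 0 by rewrite gt_eqF.
have eX : sum3 (fun i => logX barrier i x ^+ 2) = lam * s * (1 - 2 / 5 * s) ^+ 2 / g ^+ 2.
  rewrite /logX /sum3 !p1 // -/g -!/(z _).
  have -> : (- ((-1 + 2 / 5 * s) * (lam / 2 * z 0%N)) / g) ^+ 2
     + (- ((-1 + 2 / 5 * s) * (lam / 2 * z 1%N)) / g) ^+ 2
     + (- ((-1 + 2 / 5 * s) * (lam / 2 * z 2%N)) / g) ^+ 2
     = lam ^+ 2 / 4 * (1 - 2 / 5 * s) ^+ 2 / g ^+ 2 * (z 0%N ^+ 2 + z 1%N ^+ 2 + z 2%N ^+ 2) by field.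
  by rewrite ez; field; rewrite gn ln.
split.
  rewrite eX ler_pdivrMr ?exprn_gt0 //.
  have : s * (1 - 2 / 5 * s) ^+ 2 <= 25 * g ^+ 2 by nra.
  by move=> q; rewrite (mulrC 25) -!(mulrA lam) ler_pM2l.
pose n := nrm2 v x; pose zv := z 0%N * v 0%N x + z 1%N * v 1%N x + z 2%N * v 2%N x.
pose be := lam * zv ^+ 2 / 4.
have n0 : 0 <= n by rewrite /n /nrm2 /sum3 !addr_ge0 ?sqr_ge0.
have be0 : 0 <= be by rewrite /be divr_ge0 // mulr_ge0 ?sqr_ge0 // ltW.
have be1 : be <= s * n.
  have := cauchy3 z (fun i => v i x); rewrite /sum3 -/zv ez => q.
  rewrite /be ler_pdivrMr // mulrC -ler_pdivlMr //; apply: (le_trans q).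
  by rewrite /n /nrm2 /sum3 le_eqVlt; apply/orP; left; apply/eqP; field.
have eXv : sum3 (fun i => logX barrier i x * v i x) ^+ 2 = lam * (1 - 2 / 5 * s) ^+ 2 * be / g ^+ 2.
  rewrite /logX /sum3 !p1 // -/g -!/(z _) /be /zv.
  by move: (z _) (z _) (z _) (v _ x) (v _ x) (v _ x) => z0 z1 z2 v0 v1 v2; field.
have eM : mulq (logX barrier) v x = - (lam * ((-1 + 4 / 5 * s) * n - 2 / 5 * be)) / g
   + (lam * s * (1 - 2 / 5 * s) ^+ 2 * n - lam * (1 - 2 / 5 * s) ^+ 2 * be) / g ^+ 2.
  rewrite mulq_logX /sum3 (p1 0%N isT) (p1 1%N isT) (p1 2%N isT).
  rewrite (p2 0%N 0%N isT isT) (p2 0%N 1%N isT isT) (p2 0%N 2%N isT isT) (p2 1%N 0%N isT isT) (p2 1%N 1%N isT isT) (p2 1%N 2%N isT isT).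
  rewrite (p2 2%N 0%N isT isT) (p2 2%N 1%N isT isT) (p2 2%N 2%N isT isT) /= -/g -!/(z _) -/n.
  have e1 : ((-1 + 2 / 5 * s) * (lam / 2 * z 0%N)) ^+ 2 + ((-1 + 2 / 5 * s) * (lam / 2 * z 1%N)) ^+ 2
     + ((-1 + 2 / 5 * s) * (lam / 2 * z 2%N)) ^+ 2 = lam * s * (1 - 2 / 5 * s) ^+ 2.
    have -> : ((-1 + 2 / 5 * s) * (lam / 2 * z 0%N)) ^+ 2 + ((-1 + 2 / 5 * s) * (lam / 2 * z 1%N)) ^+ 2
     + ((-1 + 2 / 5 * s) * (lam / 2 * z 2%N)) ^+ 2 =
     (1 - 2 / 5 * s) ^+ 2 * lam ^+ 2 / 4 * (z 0%N ^+ 2 + z 1%N ^+ 2 + z 2%N ^+ 2) by field.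
    by rewrite ez; field.
  rewrite e1.
  have e2 : (-1 + 2 / 5 * s) * (lam / 2 * 1) + lam ^+ 2 / 10 * z 0%N * z 0%N +
    ((-1 + 2 / 5 * s) * (lam / 2 * 1) + lam ^+ 2 / 10 * z 1%N * z 1%N) +
    ((-1 + 2 / 5 * s) * (lam / 2 * 1) + lam ^+ 2 / 10 * z 2%N * z 2%N)
    = lam * (- 3 / 2 + s).
    have -> : (-1 + 2 / 5 * s) * (lam / 2 * 1) + lam ^+ 2 / 10 * z 0%N * z 0%N +
    ((-1 + 2 / 5 * s) * (lam / 2 * 1) + lam ^+ 2 / 10 * z 1%N * z 1%N) +
    ((-1 + 2 / 5 * s) * (lam / 2 * 1) + lam ^+ 2 / 10 * z 2%N * z 2%N)
     = 3 * (-1 + 2 / 5 * s) * (lam / 2) + lam ^+ 2 / 10 * (z 0%N ^+ 2 + z 1%N ^+ 2 + z 2%N ^+ 2) by field.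
    by rewrite ez; field.
  rewrite e2 /be /zv /n /nrm2 /sum3.
  by move: (z _) (z _) (z _) (v _ x) (v _ x) (v _ x) => z0 z1 z2 v0 v1 v2; field.
rewrite eM eX eXv -/n -subr_ge0.
pose k := 2 / 5 - (1 - 1 / 50 / g ^+ 2) * (1 - 2 / 5 * s) ^+ 2 / (3 * g).
have -> : - (lam * ((-1 + 4 / 5 * s) * n - 2 / 5 * be)) / g
   + (lam * s * (1 - 2 / 5 * s) ^+ 2 * n - lam * (1 - 2 / 5 * s) ^+ 2 * be) / g ^+ 2
   - lam * s * (1 - 2 / 5 * s) ^+ 2 / g ^+ 2 * n
   + (2 / 3 + 1 / 50 / (3 * g ^+ 2)) * (lam * (1 - 2 / 5 * s) ^+ 2 * be / g ^+ 2) - lam * n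
  = lam / g * ((1 - 4 / 5 * s - g) * n + be * k) by rewrite /k; field.
apply: mulr_ge0; first by rewrite divr_ge0 // ltW.
have ks : 0 <= 1 / 5 - s / 5 + k.
  have q := profile_ineq (introT andP (conj h0 (ltW h))) eG.
  have -> : 1 / 5 - s / 5 + k = (3 * (3 / 5 - s / 5) * g ^+ 3
     - (g ^+ 2 - 1 / 50) * (1 - 2 / 5 * s) ^+ 2) / (3 * g ^+ 3) by rewrite /k; field.
  by rewrite divr_ge0 ?subr_ge0 // mulr_ge0 // exprn_ge0 // ltW.
have -> : 1 - 4 / 5 * s - g = s * (1 / 5 - s / 5) by rewrite eG; field.
have s15 : 0 <= 1 / 5 - s / 5 by lra.
clearbody k be n; have [k0|k0] := leP 0 k.
  by rewrite addr_ge0 // mulr_ge0 // mulr_ge0.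
have : s * n * k <= be * k by rewrite ler_nM2r.
have := mulr_ge0 (mulr_ge0 h0 n0) ks.
have -> : s * n * (1 / 5 - s / 5 + k) = s * (1 / 5 - s / 5) * n + s * n * k by ring.
by move=> p1' p2'; apply: (le_trans p1'); rewrite lerD2l.
Qed.

Theorem friedrichs_twisted (h : pt R -> R) (v : vfield R) (tau : R) : smth h ->
  (forall i, smth (v i)) -> (forall i, bsupp (v i)) -> (forall u x, 0 <= hessq h u x) ->
  0 < tau -> (forall x, (forall i, v i x = 0) \/ rad x < 1) ->
  (lam - tau) * J (nrm2 v) <=
    J (nrm2 (rotm h v)) + (1 / 2 + 25 * lam / (4 * tau)) * J (fun x => divp h v x ^+ 2).
Proof.
move=> sh sv bv Hq t0 H; apply: (@twisted_inequality _ _ sh barrier smth_barrier barrier_gt0 v (1 / 50)) => //.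
(* The constant c = 1 / 50 lies below (3 / 20)^2, the square of the lower bound of G. *)
- by move=> x; have := barrier_lower x; nra.
- by rewrite mulr_gt0.
- by move=> x; case: (H x) => [|/(barrier_pointwise v)]; [left|right].
Qed.

End Barrier.

#[local] Opaque partial J.

(** * Local energy estimates for a Schroedinger operator *)

Section Density.
Variable R : realType.
Implicit Types (f g k : pt R -> R) (x y z : pt R).

Lemma J_mul_young f g (t : R) : 0 < t -> Cc f -> Cc g ->
  2 * `|J (fun x => f x * g x)| <= t * J (fun x => f x ^+ 2) + t^-1 * J (fun x => g x ^+ 2).
Proof.
move=> t0 cf cg; have cfg : Cc (fun x => f x * g x) by apply: Cc_mull => //; case: cg.
have c1 := Cc_scale t (Cc_sqr cf); have c2 := Cc_scale t^-1 (Cc_sqr cg).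
have c3 := Cc_norm cfg.
apply: (@le_trans _ _ (2 * J (fun x => `|f x * g x|))).
  by rewrite ler_pM2l //; exact: J_abs.
rewrite -!J_scale //; try exact: Cc_sqr.
rewrite -J_add //; apply: J_le; [exact: Cc_scale|exact: Cc_add|move=> x].
rewrite normrM -(real_normK (num_real (f x))) -(real_normK (num_real (g x))).
move: (normr_ge0 (f x)) (normr_ge0 (g x)); set a := `|f x|; set b := `|g x| => a0 b0.
rewrite -subr_ge0.
have -> : t * a ^+ 2 + t^-1 * b ^+ 2 - 2 * (a * b) = (t * a - b) ^+ 2 / t by field; rewrite gt_eqF.
by rewrite divr_ge0 ?sqr_ge0 // ltW.
Qed.

Lemma J_sqr_add f g : Cc f -> Cc g ->
  J (fun x => (f x + g x) ^+ 2) <= 2 * J (fun x => f x ^+ 2) + 2 * J (fun x => g x ^+ 2).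
Proof.
move=> cf cg; have c1 := Cc_sqr cf; have c2 := Cc_sqr cg.
have c3 := Cc_scale 2 c1; have c4 := Cc_scale 2 c2.
rewrite -(J_scale _ c1) -(J_scale _ c2) -(J_add c3 c4); apply: J_le.
- exact/Cc_sqr/Cc_add.
- exact: Cc_add.
- move=> x; have := sqr_ge0 (f x - g x); rewrite sqrrB sqrrD; lra.
Qed.

Lemma mollifier_L2 f eta : Cc f -> smth eta -> bsupp eta -> (forall x, 0 <= eta x) ->
  J eta = 1 -> J (fun x => conv f eta x ^+ 2) <= 4 * J (fun x => f x ^+ 2).
Proof.
move=> cf se be e0 e1; have := conv_L2 cf be se be se.
rewrite e1 => H; have E : (1 + 1) ^+ 2 = 4 :> R by ring.
by rewrite -E; apply: H => z; rewrite ger0_norm.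
Qed.

Lemma sqr_sum4 (a b c d : R) :
  (- (a + b + c) + d) ^+ 2 <= 4 * (a ^+ 2 + b ^+ 2 + c ^+ 2 + d ^+ 2).
Proof.
rewrite -subr_ge0.
have -> : 4 * (a ^+ 2 + b ^+ 2 + c ^+ 2 + d ^+ 2) - (- (a + b + c) + d) ^+ 2 =
  (a - b) ^+ 2 + (a - c) ^+ 2 + (a + d) ^+ 2 + (b - c) ^+ 2 + (b + d) ^+ 2 + (c + d) ^+ 2 by ring.
by rewrite !addr_ge0 ?sqr_ge0.
Qed.

Variable q : pt R -> R.
Hypotheses (sq : smth q) (q0 : forall x, 0 <= q x).

(** For q = |grad h|^2 + Lap h this is a Witten Laplacian: the composition of the twisted gradient
    e^h grad e^(-h) with its adjoint. *)
Definition Hop k x := - sum3 (fun i => partial i (partial i k) x) + q x * k x.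

Lemma smth_Hop k : smth k -> smth (Hop k).
Proof. by move=> sk; rewrite /Hop /sum3; sm. Qed.
Lemma bsupp_Hop k : bsupp k -> bsupp (Hop k).
Proof. by move=> bk; rewrite /Hop /sum3; bs. Qed.

Section Mollify.
Variables (eta zeta : pt R -> R) (s : R).
Hypotheses (se : smth eta) (be : bsupp eta) (eta_supp : forall x, s < `|x| -> eta x = 0)
  (eta0 : forall x, 0 <= eta x) (eta_even : forall x, eta (- x) = eta x) (eta1 : J eta = 1)
  (sz : smth zeta) (bz : bsupp zeta) (zeta1 : forall x, `|zeta x| <= 1).

(** Pairing g with [Hop] of this test function moves the outer mollification onto g, so that the
    local energy of the mollified g is tested although only the L^2 norm of g is under control. *)
Definition probe g := conv (fun x => zeta x * zeta x * conv g eta x) eta.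

Lemma probe_tst g : continuous g -> smth (probe g) /\ bsupp (probe g).
Proof.
move=> cg; have s1 := smth_conv cg be se.
have s2 : smth (fun x => zeta x * zeta x * conv g eta x) by sm.
have b2 : bsupp (fun x => zeta x * zeta x * conv g eta x) by bs.
by split; [exact: smth_conv (smth_cont s2) be se|exact: conv_bsupp].
Qed.

(** A Caccioppoli estimate. With gs the mollified g, |grad (zeta gs)|^2 = |grad zeta|^2 gs^2 + grad
    gs . grad (zeta^2 gs), and the last term is the gradient part of the pairing of g with
    [Hop (probe g)]. The potential contributes q (zeta gs)^2 >= 0 up to the commutator of q with
    mollification, which the oscillation w of q at scale s bounds. *)
Lemma mollified_energy g (w : R) : smth g -> bsupp g -> 0 <= w ->
  (forall x y, zeta x != 0 -> `|x - y| <= s -> `|q y - q x| <= w) ->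
  J (fun x => sum3 (fun i => partial i (fun y => zeta y * conv g eta y) x ^+ 2)) <=
  J (fun x => sum3 (fun i => partial i zeta x ^+ 2) * conv g eta x ^+ 2)
  + J (fun x => g x * Hop (probe g) x) + 4 * w * J (fun x => g x ^+ 2).
Proof.
move=> sg bg w0 Hw; have cg := smth_cont sg; have Cg := smth_Cc sg bg.
have Ce := smth_Cc se be.
set gs := conv g eta; set k := fun x => zeta x * zeta x * gs x.
have sgs : smth gs by exact: smth_conv cg be se.
have bgs : bsupp gs by exact: conv_bsupp.
have sk : smth k by rewrite /k; sm.
have bk : bsupp k by rewrite /k; bs.
have [sp bp] := probe_tst cg.
have epsi : probe g = conv k eta by [].
move: (probe g) epsi sp bp => psi epsi sp bp.
have egs : gs = conv g eta by [].
clearbody gs.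
have dpsi i : (i < 3)%N -> partial i psi = conv (partial i k) eta.
  by move=> hi; rewrite epsi partial_conv //; [exact: conv_partial hi (sk 2%N) be se|exact: smth_cont].
have dgs i : (i < 3)%N -> partial i gs = conv (partial i g) eta.
  by move=> hi; rewrite egs partial_conv //; exact: conv_partial hi (sg 2%N) be se.
have E1 i : (i < 3)%N -> J (fun x => g x * partial i (partial i psi) x) =
    - J (fun x => partial i gs x * partial i k x).
  move=> hi; have sdp := smth_partial i sp.
  have b1 : bsupp (fun x => g x * partial i psi x) by bs.
  have c1 : Cc (fun x => partial i g x * partial i psi x) by cc.
  have c2 : Cc (fun x => g x * partial i (partial i psi) x) by cc.
  have H := etrans (esym (J_add c1 c2)) (J_ibp hi b1 (sg 2%N) (sdp 2%N)).
  have H' : J (fun x => partial i g x * partial i psi x) = J (fun x => partial i gs x * partial i k x).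
    have A1 := conv_adj (smth_Cc (smth_partial i sg) (bsupp_partial i bg))
     (smth_Cc (smth_partial i sk) (bsupp_partial i bk)) Ce eta_even.
    by rewrite -(dgs i hi) -(dpsi i hi) in A1; exact: (esym A1).
  by rewrite -H'; apply/eqP; rewrite -addr_eq0 addrC; apply/eqP.
have Cqg : Cc (fun x => g x * q x) by cc.
have E2 : J (fun x => g x * (q x * psi x)) = J (fun x => conv (fun x => g x * q x) eta x * k x).
  rewrite (conv_adj Cqg (smth_Cc sk bk) Ce eta_even) epsi.
  by congr J; apply/funext => x; rewrite mulrA.
have E3 : J (fun x => g x * Hop psi x) =
    sum3 (fun i => J (fun x => partial i gs x * partial i k x))
    + J (fun x => conv (fun x => g x * q x) eta x * k x).
  have c i : Cc (fun x => g x * partial i (partial i psi) x) by cc.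
  have cq : Cc (fun x => g x * (q x * psi x)) by cc.
  have -> : (fun x => g x * Hop psi x) = fun x => g x * (q x * psi x)
     - (g x * partial 0 (partial 0 psi) x + g x * partial 1 (partial 1 psi) x
        + g x * partial 2 (partial 2 psi) x).
    by apply/funext => x; rewrite /Hop /sum3; gen_atoms x psi; ring.
  have c01 := Cc_add (c 0%N) (c 1%N); have c012 := Cc_add c01 (c 2%N).
  have L (a b0 b1 b2 a' b0' b1' b2' b01 b012 t : R) : t = a - b012 -> b012 = b01 + b2 ->
      b01 = b0 + b1 -> b0 = - b0' -> b1 = - b1' -> b2 = - b2' -> a = a' ->
      t = (b0' + b1' + b2') + a' by lra.
  exact: (L _ _ _ _ _ _ _ _ _ _ _ (J_sub cq c012) (J_add c01 (c 2%N)) (J_add (c 0%N) (c 1%N))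
    (E1 0%N isT) (E1 1%N isT) (E1 2%N isT) E2).
have sy : smth (fun x => zeta x * gs x) by sm.
have by_ : bsupp (fun x => zeta x * gs x) by bs.
have dz i x : partial i (fun y => zeta y * gs y) x = partial i zeta x * gs x + zeta x * partial i gs x.
  by apply: partial_val; pd.
have dk i x : partial i k x = 2 * zeta x * partial i zeta x * gs x + zeta x * zeta x * partial i gs x.
  rewrite (_ : partial i k x = (partial i zeta x * zeta x + zeta x * partial i zeta x) * gs x
     + zeta x * zeta x * partial i gs x); last by apply: partial_val; rewrite /k; pd.
  by congr (_ + _); ring.
have Cgk i : Cc (fun x => partial i gs x * partial i k x) by cc.
have E4 : J (fun x => sum3 (fun i => partial i (fun y => zeta y * gs y) x ^+ 2)) =
   J (fun x => sum3 (fun i => partial i zeta x ^+ 2) * gs x ^+ 2)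
   + sum3 (fun i => J (fun x => partial i gs x * partial i k x)).
  have c1 : Cc (fun x => sum3 (fun i => partial i zeta x ^+ 2) * gs x ^+ 2) by rewrite /sum3; cc.
  have c01 := Cc_add (Cgk 0%N) (Cgk 1%N); have c012 := Cc_add c01 (Cgk 2%N).
  have L (t a b0 b1 b2 b01 b012 : R) : t = a + b012 -> b012 = b01 + b2 -> b01 = b0 + b1 ->
      t = a + (b0 + b1 + b2) by lra.
  apply: L (J_add c01 (Cgk 2%N)) (J_add (Cgk 0%N) (Cgk 1%N)).
  apply: etrans (J_add c1 c012); congr J; apply/funext => x; rewrite /sum3 !dz !dk.
  by gen_atoms x zeta; gen_atoms x gs; ring.
have Cgq : Cc (conv (fun x => g x * q x) eta) := Cc_conv Cqg be se.
have Cn := Cc_norm Cg; have Ccn : Cc (conv (fun x => `|g x|) eta) := Cc_conv Cn be se.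
have Cgs := smth_Cc sgs bgs.
have E5 : - (4 * w * J (fun x => g x ^+ 2)) <= J (fun x => conv (fun x => g x * q x) eta x * k x).
  have c1 : Cc (fun x => w * (conv (fun x => `|g x|) eta x * `|gs x|)).
    by apply: Cc_scale; apply: Cc_mull => //; exact: (Cc_norm Cgs).1.
  have c2 : Cc (fun x => conv (fun x => g x * q x) eta x * k x).
    by apply: Cc_mull => //; exact: smth_cont.
  apply: (@le_trans _ _ (- J (fun x => w * (conv (fun x => `|g x|) eta x * `|gs x|)))).
    rewrite lerN2 J_scale; last by apply: Cc_mull => //; exact: (Cc_norm Cgs).1.
    rewrite (mulrC 4) -mulrA; apply: ler_wpM2l => //.
    have := J_mul_young ltr01 Ccn (Cc_norm Cgs).
    have h1 := mollifier_L2 Cn se be eta0 eta1; have h2 := mollifier_L2 Cg se be eta0 eta1.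
    have e1 : (fun x => `|g x| ^+ 2) = (fun x => g x ^+ 2).
      by apply/funext => x; rewrite real_normK ?num_real.
    have e2 : (fun x => `|gs x| ^+ 2) = (fun x => gs x ^+ 2).
      by apply/funext => x; rewrite real_normK ?num_real.
    rewrite e1 in h1; rewrite e2 mul1r invr1 mul1r; have := ler_norm (J (fun x => conv (fun x => `|g x|) eta x * `|gs x|)).
    by move: h1 h2; rewrite -egs; move: (J _) (J _) (J _) (J _) => a b d e; lra.
  rewrite -J_opp //; apply: J_le => //; first exact: Cc_opp.
  move=> x; have [z0|z0] := eqVneq (zeta x) 0.
    rewrite /k z0 !mul0r mulr0 oppr_le0 mulr_ge0 // mulr_ge0 //.
    by apply: J_ge0 => y; rewrite mulr_ge0.
  have D : `|conv (fun x => g x * q x) eta x - q x * gs x| <= w * conv (fun x => `|g x|) eta x.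
    have a1 := Cc_conv_int x Cqg.1 Ce; have a2 := Cc_conv_int x cg Ce.
    have a3 := Cc_conv_int x Cn.1 Ce; have a4 := Cc_scale (q x) a2.
    rewrite egs /conv -(J_scale _ a2) -(J_sub a1 a4) -(J_scale _ a3).
    apply: le_trans (J_abs (Cc_sub a1 a4)) _; apply: J_le.
    - exact/Cc_norm/Cc_sub.
    - exact: Cc_scale.
    move=> y; have [h|h] := leP `|x - y| s; last by rewrite eta_supp // !mulr0 subrr normr0.
    rewrite (_ : _ - _ = (q y - q x) * (g y * eta (x - y))); last by ring.
    rewrite normrM normrM (ger0_norm (eta0 _)); apply: ler_wpM2r; last exact: Hw.
    by rewrite mulr_ge0.
  have P : 0 <= q x * gs x * k x.
    by rewrite /k (_ : _ * _ = q x * (zeta x * gs x) ^+ 2); [rewrite mulr_ge0 ?sqr_ge0|ring].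
  have kb : `|k x| <= `|gs x|.
    rewrite /k !normrM -[leRHS]mul1r; apply: ler_wpM2r => //.
    by rewrite -[leRHS]mul1r ler_pM.
  have : - (w * (conv (fun x => `|g x|) eta x * `|gs x|)) <=
      (conv (fun x => g x * q x) eta x - q x * gs x) * k x.
    rewrite lerNl -mulNr (le_trans (ler_norm _)) // normrM normrN mulrA ler_pM //.
  move: P; rewrite mulrBl; move: (q x * gs x * k x) => a; lra.
rewrite E4 E3; move: E5; move: (J _) (J _) (J _) (sum3 _) => a b d e; lra.
Qed.

(** Second derivatives are put on the kernel, so K depends on eta, zeta and q but not on g. It may
    be huge: the precision that multiplies it is chosen last. *)
Lemma Hop_probe_bound : exists2 K, 0 <= K & forall g, smth g -> bsupp g ->
  J (fun x => Hop (probe g) x ^+ 2) <= K * J (fun x => g x ^+ 2).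
Proof.
have [hm hmP hmb] : exists2 hm : nat -> pt R -> R, (forall i, smth (hm i) /\ bsupp (hm i)) &
    forall i x, `|partial i (partial i eta) x| <= hm i x.
  have H i : exists hm, (smth hm /\ bsupp hm) /\ forall x, `|partial i (partial i eta) x| <= hm x.
    have c : Cc (partial i (partial i eta)) by cc.
    have [hm h1 h2] := smooth_majorant c; by exists hm; split.
  have [hm hP] := choice H.
  exists hm => [i|i x]; first exact: (hP i).1.
  exact: (hP i).2.
have [rz rz0 hrz] := bsuppP bz; have [re re0 hre] := bsuppP be.
have [M M0 hM] := continuous_box (rz + re) (smth_cont sq).
pose B i := (J (hm i) + 1) ^+ 2.
have B0 i : 0 <= B i by exact: sqr_ge0.
exists (16 * (4 * B 0%N + 4 * B 1%N + 4 * B 2%N + 16 * M ^+ 2)).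
  have h4 i : 0 <= 4 * B i by rewrite mulr_ge0.
  by rewrite mulr_ge0 // !addr_ge0 ?h4 // mulr_ge0 ?sqr_ge0.
move=> g sg bg; have cg := smth_cont sg; have Cg := smth_Cc sg bg.
set gs := conv g eta; set k := fun x => zeta x * zeta x * gs x.
have sgs : smth gs by exact: smth_conv cg be se.
have bgs : bsupp gs by exact: conv_bsupp.
have sk : smth k by rewrite /k; sm.
have bk : bsupp k by rewrite /k; bs.
have Ck_ := smth_Cc sk bk.
have [sp bp] := probe_tst cg.
have dpsi i : partial i (partial i (probe g)) = conv k (partial i (partial i eta)).
  rewrite /probe -/gs -/k partial_conv //; last exact: smth_cont.
  by rewrite partial_conv //; [exact: smth_cont|exact: bsupp_partial|exact: smth_partial].
have N0 : 0 <= J (fun x => g x ^+ 2) by apply: J_ge0 => x; exact: sqr_ge0.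
have Jk : J (fun x => k x ^+ 2) <= 4 * J (fun x => g x ^+ 2).
  apply: le_trans (mollifier_L2 Cg se be eta0 eta1); apply: J_le.
  - exact: Cc_sqr.
  - exact/Cc_sqr/smth_Cc.
  move=> x; rewrite -(real_normK (num_real (k x))) -(real_normK (num_real (gs x))).
  rewrite ler_pXn2r ?nnegrE // /k !normrM -[leRHS]mul1r; apply: ler_wpM2r => //.
  by rewrite -[leRHS]mul1r ler_pM.
have Jd i : J (fun x => partial i (partial i (probe g)) x ^+ 2) <= B i * (4 * J (fun x => g x ^+ 2)).
  rewrite dpsi; apply: (@le_trans _ _ (B i * J (fun x => k x ^+ 2))).
    have [s1 b1] := hmP i.
    by apply: conv_L2 => //; [bs|sm].
  exact: ler_wpM2l.
have Jq : J (fun x => (q x * probe g x) ^+ 2) <= M ^+ 2 * (16 * J (fun x => g x ^+ 2)).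
  apply: (@le_trans _ _ (M ^+ 2 * J (fun x => probe g x ^+ 2))); last first.
    rewrite ler_wpM2l ?sqr_ge0 //; apply: le_trans (mollifier_L2 Ck_ se be eta0 eta1) _.
    by move: Jk; move: (J _) (J _) => a b; lra.
  have c : Cc (fun x => probe g x ^+ 2) by cc.
  rewrite -J_scale //; apply: J_le; [by cc|exact: Cc_scale|move=> x].
  rewrite exprMn; have [h|h] := leP `|x| (rz + re).
    rewrite ler_wpM2r ?sqr_ge0 // -(real_normK (num_real (q x))) ler_pXn2r ?nnegrE ?hM //.
    exact: ltW.
  suff -> : probe g x = 0 by rewrite expr0n !mulr0.
  rewrite /probe /conv -[RHS](J0 R); congr J; apply/funext => y.
  have [h'|h'] := leP rz `|y|; first by rewrite hrz // !mul0r.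
  rewrite hre ?mulr0 //.
  have : `|x| <= `|y| + `|x - y| by rewrite -[in leLHS](subrK y x) addrC ler_normD.
  by move: h h'; lra.
have cd i : Cc (fun x => partial i (partial i (probe g)) x) by cc.
have cq : Cc (fun x => q x * probe g x) by cc.
have cd2 i := Cc_sqr (cd i); have cq2 := Cc_sqr cq.
pose S x := partial 0 (partial 0 (probe g)) x ^+ 2 + partial 1 (partial 1 (probe g)) x ^+ 2
   + partial 2 (partial 2 (probe g)) x ^+ 2 + (q x * probe g x) ^+ 2.
have c01 := Cc_add (cd2 0%N) (cd2 1%N); have c012 := Cc_add c01 (cd2 2%N).
have cS : Cc S := Cc_add c012 cq2.
apply: (@le_trans _ _ (4 * J S)).
  rewrite -J_scale //; apply: J_le; [|exact: Cc_scale|move=> x].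
    by apply: Cc_sqr; apply: smth_Cc; [exact: smth_Hop|exact: bsupp_Hop].
  exact: sqr_sum4.
have L (t a b d e b0 b1 b2 N m2 u u' : R) : t = u + e -> u = u' + d -> u' = a + b ->
    a <= b0 * (4 * N) -> b <= b1 * (4 * N) -> d <= b2 * (4 * N) -> e <= m2 * (16 * N) ->
    0 <= b0 * N -> 0 <= b1 * N -> 0 <= b2 * N -> 0 <= m2 * N ->
    4 * t <= 16 * (4 * b0 + 4 * b1 + 4 * b2 + 16 * m2) * N by lra.
exact: (L _ _ _ _ _ _ _ _ _ _ _ _ (J_add c012 cq2) (J_add c01 (cd2 2%N)) (J_add (cd2 0%N) (cd2 1%N))
  (Jd 0%N) (Jd 1%N) (Jd 2%N) Jq (mulr_ge0 (B0 0%N) N0) (mulr_ge0 (B0 1%N) N0)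
  (mulr_ge0 (B0 2%N) N0) (mulr_ge0 (sqr_ge0 M) N0)).
Qed.

End Mollify.
End Density.

#[local] Transparent partial J.

(** * Cut-offs and approximate solvability of the equation for P *)

Section DensityTheorem.
Variable R : realType.
Implicit Types (f g k : pt R -> R) (x y z : pt R).

Lemma small_pos (C e : R) : 0 <= C -> 0 < e -> exists2 d, 0 < d <= 1 & C * d <= e.
Proof.
move=> C0 e0; exists (Num.min 1 (e / (C + 1))).
  by rewrite lt_min ltr01 ge_min lexx divr_gt0 // ltr_wpDl.
apply: (@le_trans _ _ (C * (e / (C + 1)))); first by rewrite ler_wpM2l // ge_min lexx orbT.
by rewrite mulrA ler_pdivrMr ?ltr_wpDl // mulrC ler_wpM2l ?(ltW e0) // lerDl.
Qed.

Lemma pD_scale c f i x : smth f -> pD i (fun x => f (c *: x)) x (c * partial i f (c *: x)).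
Proof.
move=> sf; have := der_upd i (c *: x) (c * coord i x) (sf 1%N).
rewrite -coordZ upd_coord => H.
have H1 : is_derive (coord i x) (1 : R) (fun t => c * t) c.
  by have := is_deriveZ c (is_derive_id (coord i x) (1 : R)); rewrite [c *: _]mulr1.
rewrite coordZ in H.
have := @is_derive1_comp R (fun s => f (upd i (c *: x) s)) (fun t => c * t) _ _ _ H H1.
rewrite mulrC /pD; congr is_derive; apply/funext => t /=; congr f.
by apply: pt_ext; rewrite ?coordZ; move: x {H H1} => [[x0 x1] x2]; case: i => [|[|i]].
Qed.

Lemma smth_scale c f : smth f -> smth (fun x => f (c *: x)).
Proof.
move=> sf m; elim: m f sf => [|m IH] f sf.
  split => // x; apply: (continuous_comp (f := fun x => c *: x) (g := f)).
    exact: scaler_continuous.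
  exact: smth_cont.
apply: (@Ck_intro _ _ _ (fun i x => c * partial i f (c *: x))).
- by move=> x; apply: (continuous_comp (f := fun x => c *: x) (g := f));
    [exact: scaler_continuous|exact: smth_cont].
- by move=> i x; exact: pD_scale.
- by move=> i; apply: Ck_mul; [exact: Ck_cst|apply: IH; exact: smth_partial].
Qed.

Definition sqn x : R := coord 0 x * coord 0 x + coord 1 x * coord 1 x + coord 2 x * coord 2 x.

Definition cutoff0 x : R := 1 - sstep 1 2 (sqn x).

Lemma smth_cutoff0 : smth cutoff0.
Proof.
have s1 : smth (fun x => sstep 1 2 (sqn x)).
  by apply: smth_sstep; [lra|rewrite /sqn; sm].
by rewrite /cutoff0; sm.
Qed.

Lemma sqn_lower x r : 0 <= r -> r <= `|x| -> r ^+ 2 <= sqn x.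
Proof.
move=> r0; rewrite leNgt normpt_lt !negb_and -!leNgt /sqn -!expr2.
have q i : 0 <= coord i x ^+ 2 by exact: sqr_ge0.
have E i : r <= `|coord i x| -> r ^+ 2 <= coord i x ^+ 2.
  by move=> h; rewrite -(real_normK (num_real (coord i x))) ler_pXn2r ?nnegrE.
by case/or3P => /E; have := q 0%N; have := q 1%N; have := q 2%N; lra.
Qed.

Lemma sqn_upper x r : `|x| <= r -> sqn x <= 3 * r ^+ 2.
Proof.
move=> h; have r0 : 0 <= r by exact: le_trans h.
have E i : coord i x ^+ 2 <= r ^+ 2.
  rewrite -(real_normK (num_real (coord i x))) ler_pXn2r ?nnegrE //.
  exact: le_trans (normpt_coord _ _) h.
by rewrite /sqn -!expr2; have := E 0%N; have := E 1%N; have := E 2%N; lra.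
Qed.

Lemma cutoff0_supp x : 2 <= `|x| -> cutoff0 x = 0.
Proof.
move=> h; rewrite /cutoff0 sstep1 ?subrr //; first by lra.
by have := sqn_lower (_ : 0 <= 2) h; rewrite ler0n => /(_ isT); lra.
Qed.

Lemma cutoff0_one x : `|x| <= 1 / 2 -> cutoff0 x = 1.
Proof. by move=> h; rewrite /cutoff0 sstep0 ?subr0 //; have := sqn_upper h; lra. Qed.

Lemma cutoff0_01 x : 0 <= cutoff0 x <= 1.
Proof.
have ab : (1 : R) < 2 by lra.
by rewrite /cutoff0; have /andP[a b] := sstep01 (sqn x) ab; apply/andP; split; lra.
Qed.

Lemma cutoff_family : exists2 C, 0 < C & forall r, 0 < r -> exists zeta : pt R -> R,
  [/\ smth zeta, bsupp zeta, (forall x, `|zeta x| <= 1),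
      (forall x, `|x| <= r -> zeta x = 1) &
      (forall x, sum3 (fun i => partial i zeta x ^+ 2) <= C / r ^+ 2)].
Proof.
have s0 := smth_cutoff0.
have b0 : bsupp cutoff0 by exists 2 => x h; apply: cutoff0_supp; exact: ltW.
have [C C0 hC] : exists2 C, 0 < C & forall x, `|sum3 (fun i => partial i cutoff0 x ^+ 2)| <= C.
  by apply: Cc_bounded; rewrite /sum3; cc.
exists C => // r r0; pose c := (2 * r)^-1.
have c0 : 0 < c by rewrite invr_gt0 mulr_gt0.
exists (fun x => cutoff0 (c *: x)); split.
- exact: smth_scale.
- exists (2 / c) => x h; apply: cutoff0_supp.
  by rewrite normrZ gtr0_norm // mulrC -ler_pdivrMr // ltW.
- by move=> x; have /andP[a b] := cutoff0_01 (c *: x); rewrite ger0_norm.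
- move=> x h; apply: cutoff0_one; rewrite normrZ gtr0_norm // /c.
  by rewrite mulrC ler_pdivrMr ?mulr_gt0 //; lra.
- move=> x; have E i : partial i (fun x => cutoff0 (c *: x)) x = c * partial i cutoff0 (c *: x).
    by apply: partial_val; exact: pD_scale.
  apply: (@le_trans _ _ (c ^+ 2 * C)).
    have L (a b d a' b' d' : R) : a = c * a' -> b = c * b' -> d = c * d' ->
        a' ^+ 2 + b' ^+ 2 + d' ^+ 2 <= C -> a ^+ 2 + b ^+ 2 + d ^+ 2 <= c ^+ 2 * C.
      by move=> -> -> -> h; rewrite !exprMn -!mulrDr ler_wpM2l ?sqr_ge0.
    exact: (L _ _ _ _ _ _ (E 0%N) (E 1%N) (E 2%N) (le_trans (ler_norm _) (hC (c *: x)))).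
  rewrite mulrC ler_wpM2l ?(ltW C0) // /c exprVn lef_pV2 ?posrE ?exprn_gt0 ?mulr_gt0 //.
  by rewrite ler_pXn2r ?nnegrE ?mulr_ge0 ?(ltW r0) // ler_peMl ?(ltW r0) //; lra.
Qed.

Variable q : pt R -> R.
Hypotheses (sq : smth q) (q0 : forall x, 0 <= q x).

Lemma Hop_add k g (t : R) x : smth k -> smth g ->
  Hop q (fun x => k x + t * g x) x = Hop q k x + t * Hop q g x.
Proof.
move=> sk sg; have E i : partial i (partial i (fun x => k x + t * g x)) x =
    partial i (partial i k) x + t * partial i (partial i g) x.
  have -> : partial i (fun x => k x + t * g x) = fun x => partial i k x + t * partial i g x.
    apply/funext => y; rewrite (_ : _ + _ = partial i k y + (0 * g y + t * partial i g y)); last by ring.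
    by apply: partial_val; pd.
  rewrite (_ : _ + _ = partial i (partial i k) x + (0 * partial i g x + t * partial i (partial i g) x)).
    by apply: partial_val; pd.
  by rewrite mul0r add0r.
by rewrite /Hop /sum3 !E; gen_atoms x k; gen_atoms x g; ring.
Qed.

(** P nearly minimises the norm of f0 + Hop P. Comparison with P = 0 bounds the residual; comparison
    with P + t psi and P - t psi makes it nearly orthogonal to the range of Hop. *)
Lemma near_minimizer f0 (del : R) : smth f0 -> bsupp f0 -> 0 < del ->
  exists P, [/\ smth P, bsupp P,
    J (fun x => (f0 x + Hop q P x) ^+ 2) <= J (fun x => f0 x ^+ 2) + del ^+ 2 &
    forall psi t, smth psi -> bsupp psi -> 0 < t ->
      2 * `|J (fun x => (f0 x + Hop q P x) * Hop q psi x)| <=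
        del ^+ 2 / t + t * J (fun x => Hop q psi x ^+ 2)].
Proof.
move=> sf bf d0.
pose I P := J (fun x => (f0 x + Hop q P x) ^+ 2).
pose S : set R := [set r | exists P, [/\ smth P, bsupp P & r = I P]].
have I0 P : 0 <= I P by apply: J_ge0 => x; exact: sqr_ge0.
have hS : has_inf S.
  split; last by exists 0 => r [P [_ _ ->]].
  exists (I (fun=> 0)), (fun=> 0); split => //; first exact: smth_cst.
  by exists 0.
have d2 : 0 < del ^+ 2 by rewrite exprn_gt0.
have [r [P [sP bP ->]] hr] := inf_adherent d2 hS.
have lb Q : smth Q -> bsupp Q -> inf S <= I Q.
  by move=> sQ bQ; apply: ge_inf; [exact: hS.2|exists Q].
exists P; split => //.
  apply: (le_trans (ltW hr)); rewrite lerD2r.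
  have s0 : smth (fun _ : pt R => 0 : R) by exact: smth_cst.
  have b0 : bsupp (fun _ : pt R => 0 : R) by exists 0.
  apply: (le_trans (lb _ s0 b0)); rewrite le_eqVlt; apply/orP; left; apply/eqP.
  congr J; apply/funext => x; rewrite /Hop /sum3.
  have p i : partial i (fun _ : pt R => 0 : R) = fun=> 0 by exact: partial_cst.
  by rewrite !p mulr0 !addr0 oppr0 addr0.
move=> psi t sp bp t0.
have sH := smth_Hop sq sP; have bH := bsupp_Hop q bP.
have sHp := smth_Hop sq sp; have bHp := bsupp_Hop q bp.
set g := fun x => f0 x + Hop q P x.
have sg : smth g by rewrite /g; sm.
have bg : bsupp g by rewrite /g; bs.
have K (s : R) : - (del ^+ 2) <= 2 * s * J (fun x => g x * Hop q psi x) + s ^+ 2 * J (fun x => Hop q psi x ^+ 2).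
  have sQ : smth (fun x => P x + s * psi x) by sm.
  have bQ : bsupp (fun x => P x + s * psi x) by bs.
  have := lb _ sQ bQ.
  have c1 : Cc (fun x => g x ^+ 2) by cc.
  have c2 : Cc (fun x => g x * Hop q psi x) by cc.
  have c3 : Cc (fun x => Hop q psi x ^+ 2) by cc.
  have c4 := Cc_scale (2 * s) c2; have c5 := Cc_scale (s ^+ 2) c3.
  have -> : I (fun x => P x + s * psi x) =
     J (fun x => (g x ^+ 2 + 2 * s * (g x * Hop q psi x)) + s ^+ 2 * Hop q psi x ^+ 2).
    by congr J; apply/funext => x; rewrite Hop_add // /g; ring.
  have L (a b c a' b' c' ab abc d i m : R) : abc = ab + c' -> ab = a + b' -> b' = b -> c' = c ->
     m < i + d -> m = a -> i <= abc -> - d <= b + c by lra.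
  exact: L (J_add (Cc_add c1 c4) c5) (J_add c1 c4) (J_scale _ c2) (J_scale _ c3) hr erefl.
have := K (- t); have := K t; set a := J (fun x => g x * _); set b := J _ => k1 k2.
have e : del ^+ 2 / t * t = del ^+ 2 by rewrite divfK // gt_eqF.
rewrite sqrrN in k2; move: e k1 k2; move: (del ^+ 2) (del ^+ 2 / t) b a => d w b a.
rewrite expr2 => e h1 h2.
have h : t * (2 * `|a|) <= t * (w + t * b).
  rewrite mulrDr [t * w]mulrC e.
  by have [a0|a0] := ger0P a; lra.
by rewrite ler_pM2l in h.
Qed.

Lemma density_arith (N A X E sig si r s d C L LV K e j1 j2 j3 : R) :
  N = j1 + j2 + j3 -> 0 <= N -> N <= A + 1 -> 0 < sig -> 0 < si ->
  2 * `|j3| <= d * (1 + 4 * (A + 1)) -> 2 * `|j1| <= sig * N + si * (LV * s) ->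
  2 * `|j2| <= si * E + sig * X ->
  E <= 4 * C * (A + 1) * r + 12 * L * (A + 1) * s + d * (1 + K * (A + 1)) ->
  (A + 1 + X) * sig <= e / 4 -> (si * (4 * C * (A + 1))) * r <= e / 4 ->
  (si * (LV + 12 * L * (A + 1))) * s <= e / 4 ->
  ((1 + 4 * (A + 1)) + si * (1 + K * (A + 1))) * d <= e / 4 -> N <= e.
Proof.
move=> NE N0 N1 sig0 si0 h3 h1 h2 hE e1 e2 e3 e4.
have := ler_norm j1; have := ler_norm j2; have := ler_norm j3.
have : sig * N <= sig * (A + 1) by rewrite ler_pM2l.
have := hE; rewrite -(ler_pM2l si0).
lra.
Qed.

(* Order of the choices: first the Young weight sig, then the cut-off radius r,
   then the mollification scale s, and only then the precision del. *)
Theorem Hop_dense (chi : vfield R) (e : R) : (forall i, smth (chi i)) ->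
  (forall i, bsupp (chi i)) -> 0 < e -> exists P, [/\ smth P, bsupp P &
    J (fun x => (sum3 (fun i => partial i (chi i) x) + Hop q P x) ^+ 2) <= e].
Proof.
move=> sc bc e0.
set f0 := fun x => sum3 (fun i => partial i (chi i) x).
have sf : smth f0 by rewrite /f0 /sum3; sm.
have bf : bsupp f0 by rewrite /f0 /sum3; bs.
have Cf := smth_Cc sf bf.
set A := J (fun x => f0 x ^+ 2); have A0 : 0 <= A by apply: J_ge0 => x; exact: sqr_ge0.
have A1 : 0 <= A + 1 by rewrite addr_ge0 // ler01.
set X := J (nrm2 chi); have X0 : 0 <= X.
  by apply: J_ge0 => x; rewrite /nrm2 /sum3 !addr_ge0 ?sqr_ge0.
have e4 : 0 < e / 4 by rewrite divr_gt0.
have [sig /andP[sig0 sig1] hsig] : exists2 d, 0 < d <= 1 & (A + 1 + X) * d <= e / 4.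
  by apply: small_pos => //; lra.
have si0 : 0 < sig^-1 by rewrite invr_gt0.
have [C C0 HC] := cutoff_family.
have [r0 r00 hr0] := bsuppP bf.
have [ri /andP[ri0 ri1] hri] : exists2 d, 0 < d <= 1 & (sig^-1 * (4 * C * (A + 1))) * d <= e / 4.
  by apply: small_pos => //; rewrite mulr_ge0 ?(ltW si0) // mulr_ge0 ?mulr_ge0 ?(ltW C0) //; lra.
(* Since r >= r0, zeta = 1 on the support of f0; since r >= 1 / ri >= 1, the squared gradient of
   zeta is at most C ri. *)
pose r := r0 + ri^-1.
have r1 : ri^-1 <= r by rewrite /r lerDr ltW.
have rpos : 0 < r by rewrite (lt_le_trans _ r1) // invr_gt0.
have [zeta [sz bz z1 zone zgrad]] := HC r rpos.
have [rz rz0 hrz] := bsuppP bz.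
have [L L0 hL] : exists2 L, 0 < L & forall i z, `|z| <= rz + 1 -> `|partial i q z| <= L.
  have [L0 p0 h0] := continuous_box (rz + 1) (smth_cont (smth_partial 0 sq)).
  have [L1 p1 h1] := continuous_box (rz + 1) (smth_cont (smth_partial 1 sq)).
  have [L2 p2 h2] := continuous_box (rz + 1) (smth_cont (smth_partial 2 sq)).
  exists (L0 + L1 + L2); first lra.
  by case=> [|[|i]] z hz; [have := h0 z hz|have := h1 z hz|rewrite partial_coord_ge2; have := h2 z hz]; lra.
have [Lf Lf0 hLf] := Cc_Lipschitz bf sf.
have [s /andP[s0 s1] hs] : exists2 d, 0 < d <= 1 &
    (sig^-1 * (Lf ^+ 2 * vol (r0 + 1) + 12 * L * (A + 1))) * d <= e / 4.
  apply: small_pos => //; rewrite mulr_ge0 ?(ltW si0) // addr_ge0 ?mulr_ge0 ?sqr_ge0 ?vol_ge0 ?(ltW L0) //; lra.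
have [eta [se be supe [eta0 etae] eta1]] := mollifier s0.
have [K K0 hK] := Hop_probe_bound sq se be eta0 eta1 sz bz z1.
have [del /andP[d0 d1] hd] : exists2 d, 0 < d <= 1 &
    ((1 + 4 * (A + 1)) + sig^-1 * (1 + K * (A + 1))) * d <= e / 4.
  apply: small_pos => //; rewrite addr_ge0 //; first by lra.
  by rewrite mulr_ge0 ?(ltW si0) // addr_ge0 ?ler01 // mulr_ge0.
have [P [sP bP hP1 hP2]] := near_minimizer sf bf d0.
exists P; split => //.
have sH := smth_Hop sq sP; have bH := bsupp_Hop q bP.
set g := fun x => f0 x + Hop q P x in hP1 hP2 *.
have sg : smth g by rewrite /g; sm.
have bg : bsupp g by rewrite /g; bs.
have Cg := smth_Cc sg bg; have cg := smth_cont sg.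
set N := J (fun x => g x ^+ 2) in hP1 *.
have N0 : 0 <= N by apply: J_ge0 => x; exact: sqr_ge0.
have del2 : del ^+ 2 <= del by rewrite expr2 ler_piMl // ltW.
have N1 : N <= A + 1 by move: hP1; rewrite -/A; lra.
have CHP := smth_Cc sH bH.
have a1 : 2 * `|J (fun x => g x * Hop q P x)| <= del * (1 + 4 * (A + 1)).
  have q1 := hP2 P del sP bP d0.
  have q2 : J (fun x => Hop q P x ^+ 2) <= 2 * N + 2 * A.
    have := J_sqr_add Cg (Cc_opp Cf); rewrite -/N.
    have -> : (fun x => (g x + - f0 x) ^+ 2) = fun x => Hop q P x ^+ 2.
      by apply/funext => x; congr (_ ^+ 2); rewrite /g; ring.
    by have -> : (fun x => (- f0 x) ^+ 2) = fun x => f0 x ^+ 2 by apply/funext => x; rewrite sqrrN.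
  have q3 : del ^+ 2 / del = del by rewrite expr2 mulfK // gt_eqF.
  apply: (le_trans q1); rewrite q3 mulrDr mulr1 lerD2l ler_pM2l //.
  by apply: (le_trans q2); lra.
set gs := conv g eta.
have Cgs : Cc gs := Cc_conv Cg be se.
have sgs : smth gs by exact: smth_conv cg be se.
have bgs : bsupp gs := Cgs.2.
have Cfe : Cc (conv f0 eta) := Cc_conv Cf be se.
pose u x := f0 x - conv f0 eta x.
have Cu : Cc u := Cc_sub Cf Cfe.
have a2 : 2 * `|J (fun x => g x * u x)| <= sig * N + sig^-1 * (Lf ^+ 2 * vol (r0 + 1) * s).
  apply: (le_trans (J_mul_young sig0 Cg Cu)); rewrite -/N lerD2l ler_pM2l //.
  have ub x : `|u x| <= Lf * s.
    rewrite /u distrC; apply: (@conv_approx _ f0 eta x s) => //; first exact: smth_cont.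
      exact: smth_Cc.
    move=> z hz; apply: (le_trans (hLf x (x - z))).
    by rewrite addrAC subrr add0r normrN ler_pM2l.
  have ub2 x : `|u x ^+ 2| <= Lf ^+ 2 * s.
    rewrite normrX (@le_trans _ _ ((Lf * s) ^+ 2)) //.
      by rewrite ler_pXn2r ?nnegrE // mulr_ge0 // ltW.
    by rewrite exprMn ler_pM2l ?exprn_gt0 // expr2 ler_piMl // ltW.
  have us x : r0 + 1 < `|x| -> u x ^+ 2 = 0.
    move=> hx; suff -> : u x = 0 by rewrite expr0n.
    rewrite /u hr0 ?sub0r; last by lra.
    rewrite (_ : conv f0 eta x = 0) ?oppr0 // /conv -[RHS](J0 R); congr J; apply/funext => y.
    have [h'|h'] := leP r0 `|y|; first by rewrite hr0 // mul0r.
    rewrite supe ?mulr0 //.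
    have : `|x| <= `|y| + `|x - y| by rewrite -[in leLHS](subrK y x) addrC ler_normD.
    by lra.
  have := J_bound (Cc_sqr Cu) us ub2; rewrite [Lf ^+ 2 * s * _]mulrAC => b.
  exact: le_trans (ler_norm _) b.
pose zg := fun y => zeta y * gs y.
have szg : smth zg by rewrite /zg; sm.
have bzg : bsupp zg by rewrite /zg; bs.
set E := J (fun x => sum3 (fun i => partial i zg x ^+ 2)).
(* Being a divergence, f0 pairs with the gradient of zeta gs, whose energy E is small; a spectral
   gap of the operator is thus replaced by the form of f0. *)
have a3 : 2 * `|J (fun x => gs x * f0 x)| <= sig^-1 * E + sig * X.
  have -> : (fun x => gs x * f0 x) = fun x => zg x * f0 x.
    apply/funext => x; have [h|h] := leP r0 `|x|; first by rewrite hr0 // !mulr0.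
    by rewrite /zg zone ?mul1r // /r; apply: (le_trans (ltW h)); rewrite lerDl invr_ge0 ltW.
  have c1 i : Cc (fun x => zg x * partial i (chi i) x) by cc.
  have c2 i : Cc (fun x => partial i zg x * chi i x) by cc.
  have ib i : (i < 3)%N -> J (fun x => zg x * partial i (chi i) x) = - J (fun x => partial i zg x * chi i x).
    move=> hi; have b1 : bsupp (fun x => zg x * chi i x) by bs.
    have := etrans (esym (J_add (c2 i) (c1 i))) (J_ibp hi b1 (szg 2%N) (sc i 2%N)).
    by move=> H; apply/eqP; rewrite -addr_eq0 addrC; apply/eqP.
  have Cs1 : Cc (fun x => sum3 (fun i => partial i zg x ^+ 2)) by rewrite /sum3; cc.
  have CX : Cc (nrm2 chi) by rewrite /nrm2 /sum3; cc.
  have Jy i : 2 * `|J (fun x => partial i zg x * chi i x)| <=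
      sig^-1 * J (fun x => partial i zg x ^+ 2) + sig * J (fun x => chi i x ^+ 2).
    have ci : Cc (partial i zg) by cc.
    by have := J_mul_young si0 ci (smth_Cc (sc i) (bc i)); rewrite invrK.
  have d i : Cc (fun x => partial i zg x ^+ 2) by cc.
  have d' i : Cc (fun x => chi i x ^+ 2) by cc.
  have EE : E = J (fun x => partial 0 zg x ^+ 2) + J (fun x => partial 1 zg x ^+ 2)
      + J (fun x => partial 2 zg x ^+ 2).
    exact: etrans (J_add (Cc_add (d 0%N) (d 1%N)) (d 2%N)) (congr1 (+%R^~ _) (J_add (d 0%N) (d 1%N))).
  have XX : X = J (fun x => chi 0%N x ^+ 2) + J (fun x => chi 1%N x ^+ 2) + J (fun x => chi 2%N x ^+ 2).
    exact: etrans (J_add (Cc_add (d' 0%N) (d' 1%N)) (d' 2%N)) (congr1 (+%R^~ _) (J_add (d' 0%N) (d' 1%N))).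
  have JJ : J (fun x => zg x * f0 x) = - (J (fun x => partial 0 zg x * chi 0%N x)
      + J (fun x => partial 1 zg x * chi 1%N x) + J (fun x => partial 2 zg x * chi 2%N x)).
    have L3 (t a b c ab a' b' c' : R) : t = ab + c -> ab = a + b -> a = - a' -> b = - b' -> c = - c' ->
      t = - (a' + b' + c').
      by clear; move=> -> -> -> -> ->; rewrite !opprD.
    apply: L3 (J_add (c1 0%N) (c1 1%N)) (ib 0%N isT) (ib 1%N isT) (ib 2%N isT).
    apply: etrans (J_add (Cc_add (c1 0%N) (c1 1%N)) (c1 2%N)).
    by congr J; apply/funext => x; rewrite /f0 /sum3 !mulrDr.
  rewrite JJ normrN EE XX !mulrDr.
  have L4 (a b c ea eb ec xa xb xc m n : R) : 2 * `|a| <= m * ea + n * xa ->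
      2 * `|b| <= m * eb + n * xb -> 2 * `|c| <= m * ec + n * xc ->
      2 * `|a + b + c| <= m * ea + m * eb + m * ec + (n * xa + n * xb + n * xc).
    by clear => h1 h2 h3; have := ler_normD (a + b) c; have := ler_normD a b; lra.
  exact: L4 (Jy 0%N) (Jy 1%N) (Jy 2%N).
have a4 : E <= 4 * C * (A + 1) * ri + 12 * L * (A + 1) * s + del * (1 + K * (A + 1)).
  have w0 : 0 <= 3 * L * s by rewrite mulr_ge0 ?mulr_ge0 // ltW.
  have hw x y : zeta x != 0 -> `|x - y| <= s -> `|q y - q x| <= 3 * L * s.
    move=> zx xy; rewrite distrC in xy.
    apply: (le_trans (Lipschitz_pt (L := L) (sq 1%N) _)).
      move=> z i hz; apply: hL.
      have hx : `|x| < rz by rewrite ltNge; apply/negP => h; move: zx; rewrite hrz ?eqxx.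
      have : `|z| <= `|z - x| + `|x| by rewrite -[in leLHS](subrK x z) ler_normD.
      by move: hz; lra.
    by rewrite ler_wpM2l // mulr_ge0 // ltW.
  have M := mollified_energy sq q0 se be supe eta0 etae eta1 sz bz z1 sg bg w0 hw.
  have [sp bp] := probe_tst se be sz bz cg.
  have m1 : J (fun x => sum3 (fun i => partial i zeta x ^+ 2) * conv g eta x ^+ 2) <= 4 * C * (A + 1) * ri.
    apply: (@le_trans _ _ (C / r ^+ 2 * J (fun x => conv g eta x ^+ 2))).
      rewrite -J_scale; last exact: Cc_sqr.
      apply: J_le; [by rewrite /sum3 -/gs; cc|by apply: Cc_scale; exact: Cc_sqr|].
      by move=> x; rewrite ler_wpM2r ?sqr_ge0.
    have h1 := mollifier_L2 Cg se be eta0 eta1.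
    have h2 : (r ^+ 2)^-1 <= ri.
      rewrite -[ri]invrK lef_pV2 ?posrE ?exprn_gt0 ?invr_gt0 // expr2.
      rewrite (le_trans r1) // ler_peMl ?(ltW rpos) // (le_trans _ r1) // invf_ge1 //.
    apply: (@le_trans _ _ (C * ri * (4 * (A + 1)))); last by rewrite le_eqVlt; apply/orP; left; apply/eqP; ring.
    apply: ler_pM => //.
    - by rewrite divr_ge0 ?(ltW C0) // sqr_ge0.
    - by apply: J_ge0 => x; exact: sqr_ge0.
    - by rewrite ler_pM2l.
    - by apply: (le_trans h1); rewrite ler_pM2l.
  have m2 : J (fun x => g x * Hop q (probe eta zeta g) x) <= del * (1 + K * (A + 1)).
    have k1 := hP2 _ del sp bp d0; have k2 := hK g sg bg.
    have q3 : del ^+ 2 / del = del by rewrite expr2 mulfK // gt_eqF.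
    rewrite q3 in k1.
    have k3 : del * J (fun x => Hop q (probe eta zeta g) x ^+ 2) <= del * (K * (A + 1)).
      by rewrite ler_pM2l // (le_trans k2) // ler_wpM2l.
    have k4 := ler_norm (J (fun x => g x * Hop q (probe eta zeta g) x)).
    have k5 : 0 <= del * (1 + K * (A + 1)).
      by rewrite mulr_ge0 ?(ltW d0) // addr_ge0 ?ler01 // mulr_ge0.
    rewrite mulrDr mulr1 in k5 *.
    move: k1 k3 k4 k5; move: (J _) (J _) => j1 j2; clear; move: (K * _) => KK; lra.
  have m3 : 4 * (3 * L * s) * J (fun x => g x ^+ 2) <= 12 * L * (A + 1) * s.
    apply: (@le_trans _ _ (4 * (3 * L * s) * (A + 1))); first by rewrite ler_wpM2l // mulr_ge0.
    by rewrite le_eqVlt; apply/orP; left; apply/eqP; ring.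
  by apply: (le_trans M); rewrite addrAC; apply: lerD => //; apply: lerD.
(* The residual is tested against itself: g = f0 + Hop P, and the mollification is moved from f0 to
   g at the cost of u = f0 - f0 * eta. *)
have key : N = J (fun x => g x * u x) + J (fun x => gs x * f0 x) + J (fun x => g x * Hop q P x).
  have c1 : Cc (fun x => g x * u x) by apply: Cc_mull => //; exact: Cu.1.
  have c2 : Cc (fun x => g x * conv f0 eta x) by apply: Cc_mull => //; exact: Cfe.1.
  have c3 : Cc (fun x => g x * Hop q P x) by cc.
  have ad : J (fun x => gs x * f0 x) = J (fun x => g x * conv f0 eta x).
    exact: conv_adj Cg Cf (smth_Cc se be) etae.
  rewrite ad -(J_add c1 c2) -(J_add (Cc_add c1 c2) c3); congr J; apply/funext => x.
  by rewrite /u /g; ring.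
exact: density_arith key N0 N1 sig0 si0 a1 a2 a3 a4 hsig hri hs hd.
Qed.

End DensityTheorem.

(** * Smooth convex functions *)

Section Convexity.
Variable R : realType.
Implicit Types (f : pt R -> R) (x y u : pt R).

Definition slope f u x := sum3 (fun i => partial i f x * coord i u).

Lemma smth_slope f u : smth f -> smth (slope f u).
Proof.
move=> sf; rewrite /slope /sum3.
have c i : smth (fun _ : pt R => coord i u) by exact: smth_cst.
by repeat (apply: smth_add || apply: smth_mul) => //; exact: smth_partial.
Qed.

Lemma slopeN f u x : slope f (- u) x = - slope f u x.
Proof. by rewrite /slope /sum3 !coordN; clear; gen_atoms x f; ring. Qed.

Lemma der_slope f u x t : smth f ->
  is_derive t (1 : R) (fun s => f (x + s *: u)) (slope f u (x + t *: u)).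
Proof. by move=> sf; have := der_line x u t (sf 1%N); rewrite (sum3E (fun i => partial i f (x + t *: u) * coord i u)). Qed.

Definition hess f x (w : nat -> R) :=
  sum3 (fun j => sum3 (fun i => partial j (partial i f) x * w i * w j)).

Lemma slope_slope f u x : smth f -> slope (slope f u) u x = hess f x (fun i => coord i u).
Proof.
move=> sf; have E j : partial j (slope f u) x =
    partial j (partial 0 f) x * coord 0 u + partial j (partial 1 f) x * coord 1 u
    + partial j (partial 2 f) x * coord 2 u.
  have c i : pD j (fun y => partial i f y * coord i u) x (partial j (partial i f) x * coord i u).
    have p : pD j (partial i f) x (partial j (partial i f) x) by apply: smth_pD; exact: smth_partial.
    by have := pD_mul p (@pD_cst R j (coord i u) x); rewrite mulr0 addr0.
  by apply/partial_val/pD_add; [apply: pD_add|]; exact: c.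
rewrite {1}/slope /sum3 (E 0%N) (E 1%N) (E 2%N) /hess /sum3.
by clear; gen_atoms x f; ring.
Qed.

(** Midpoint convexity, the form that passes directly to distance functions and to convolutions. *)
Definition convex_fun f := forall x u, 2 * f x <= f (x + u) + f (x - u).

(** If the second derivative along u were negative at x, it would be so nearby, and f(x + t u) + f(x
    - t u) would decrease from t = 0 on. *)
Lemma convex_hess f x (w : nat -> R) : smth f -> convex_fun f -> 0 <= hess f x w.
Proof.
move=> sf cf; pose u : pt R := ((w 0%N, w 1%N), w 2%N).
have -> : hess f x w = hess f x (fun i => coord i u) by [].
rewrite -slope_slope // leNgt; apply/negP => neg.
have sg := smth_slope u sf; have sgg := smth_slope u sg.
have e0 : 0 < - slope (slope f u) u x by rewrite oppr_gt0.
have [d d0 hd] := continuous_near x (smth_cont sgg) e0.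
pose s := d / (1 + `|u|) / 4.
have u1 : 0 < 1 + `|u| by rewrite ltr_wpDr.
have s0 : 0 < s by rewrite !divr_gt0.
have near t : `|t| <= 3 * s -> slope (slope f u) u (x + t *: u) < 0.
  move=> ht; have : `|x + t *: u - x| < d.
    rewrite addrAC subrr add0r normrZ (@le_lt_trans _ _ (3 * s * (1 + `|u|))) //.
      by rewrite ler_pM // lerDr.
    suff -> : 3 * s * (1 + `|u|) = 3 / 4 * d by lra.
    by rewrite /s; field; rewrite gt_eqF.
  by move/hd; move: (slope _ _ _) (slope _ _ x) => a b; have := ler_norm (a - b); clear; lra.
pose psi t := f (x + t *: u) + f (x + t *: - u).
pose dpsi t := slope f u (x + t *: u) - slope f u (x - t *: u).
have D t : is_derive t (1 : R) psi (dpsi t).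
  have := is_deriveD (der_slope u x t sf) (der_slope (- u) x t sf); rewrite /psi /dpsi.
  by congr is_derive; rewrite scalerN slopeN.
have cpsi : {within `[0, s], continuous psi}.
  by apply: continuous_subspaceT => t; exact: (is_derive_continuous (D t)).
have [c] := MVT s0 (fun t _ => D t) cpsi.
rewrite in_itv /= => /andP[c0 cs] e.
have : psi 0 <= psi s.
  by rewrite /psi !scale0r !addr0 scalerN; have := cf x (s *: u); lra.
rewrite -subr_ge0 e subr0 pmulr_lge0 // leNgt /dpsi subr_lt0 => /negP; apply.
have [b hb] := MVT_abs (- c) c (fun t => der_slope u x t sg).
rewrite scaleNr => e2.
have L (p q g : R) : p - q = g * (c - - c) -> g < 0 -> p < q.
  by move: c0; clear => c0 e2 g0; rewrite -subr_lt0 e2 opprK nmulr_rlt0 ?addr_gt0.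
apply: L e2 _; apply: near.
by move: hb; rewrite !opprK ler_norml ger0_norm ?addr_ge0 ?(ltW c0) // ler_norml => /andP[h1 h2];
  apply/andP; split; lra.
Qed.

Lemma convex_gradient f x y : smth f -> convex_fun f -> f x + slope f (y - x) x <= f y.
Proof.
move=> sf cf; set u := y - x.
have D t := der_slope u x t sf.
have cphi : {within `[0, 1], continuous (fun t : R => f (x + t *: u))}.
  by apply: continuous_subspaceT => t; exact: (is_derive_continuous (D t)).
have [c] := MVT ltr01 (fun t _ => D t) cphi.
rewrite in_itv /= => /andP[c0 c1]; rewrite scale1r scale0r addr0 subr0 mulr1 /u subrKC -/u => e.
have sg := smth_slope u sf; have Dg t := der_slope u x t sg.
have cg : {within `[0, c], continuous (fun t : R => slope f u (x + t *: u))}.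
  by apply: continuous_subspaceT => t; exact: (is_derive_continuous (Dg t)).
have [b _] := MVT c0 (fun t _ => Dg t) cg.
rewrite scale0r addr0 subr0 slope_slope // => e2.
have := convex_hess (x + b *: u) (fun i => coord i u) sf cf; rewrite -(pmulr_lge0 _ c0) -e2.
by move: e; move: (slope f u _) (slope f u _) => p q; lra.
Qed.

(** For the Hessian H, tr H |v|^2 - H(v, v) is the sum over k of H evaluated at the cross product of
    the k-th basis vector with v. *)
Lemma hessq_convex f (v : vfield R) x : smth f -> convex_fun f -> 0 <= hessq f v x.
Proof.
move=> sf cf.
have h k := convex_hess x (fun i => cross (fun j => (j == k)%:R) (fun j => v j x) i) sf cf.
have e : hessq f v x = 2 * (hess f x (fun i => cross (fun j => (j == 0%N)%:R) (fun j => v j x) i)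
  + hess f x (fun i => cross (fun j => (j == 1%N)%:R) (fun j => v j x) i)
  + hess f x (fun i => cross (fun j => (j == 2%N)%:R) (fun j => v j x) i)).
  by rewrite /hess /hessq /nrm2 /cross /sum3 /=; clear; gen_atoms x f; gen_atoms x v; ring.
by rewrite e mulr_ge0 //; exact: addr_ge0 (addr_ge0 (h 0%N) (h 1%N)) (h 2%N).
Qed.

End Convexity.

(** * Construction of the convex weight *)

Section ConvexWeight.
Variable R : realType.
Implicit Types (x y u z : pt R).

Section Distance.
Variable C : set (pt R).
Hypothesis C0 : C !=set0.

Definition infdist x : R := inf [set r | exists2 y, C y & r = `|x - y|].

Lemma infdist_has_inf x : has_inf [set r | exists2 y, C y & r = `|x - y|].
Proof.
split; first by have [y Cy] := C0; exists `|x - y|, y.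
by exists 0 => r [y _ ->].
Qed.

Lemma infdist_le x y : C y -> infdist x <= `|x - y|.
Proof. by move=> Cy; apply: ge_inf; [exact: (infdist_has_inf x).2|exists y]. Qed.

Lemma infdist_near x e : 0 < e -> exists2 y, C y & `|x - y| < infdist x + e.
Proof. by move=> e0; have [_ [y Cy ->] h] := inf_adherent e0 (infdist_has_inf x); exists y. Qed.

Lemma infdist_ge x r : (forall y, C y -> r <= `|x - y|) -> r <= infdist x.
Proof.
move=> h; apply: lb_le_inf; first exact: (infdist_has_inf x).1.
by move=> _ [y Cy ->]; exact: h.
Qed.

Lemma infdist_ge0 x : 0 <= infdist x.
Proof. by apply: infdist_ge => y _; exact: normr_ge0. Qed.

Lemma infdist0 x : C x -> infdist x = 0.
Proof.
by move=> Cx; apply/eqP; rewrite eq_le infdist_ge0 (le_trans (infdist_le _ Cx)) // subrr normr0.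
Qed.

Lemma infdist_lip x y : `|infdist y - infdist x| <= `|y - x|.
Proof.
have H a b : infdist a - `|b - a| <= infdist b.
  apply: infdist_ge => z Cz; rewrite lerBlDr (le_trans (infdist_le a Cz)) //.
  by rewrite -[a - z](subrKA b) addrC (le_trans (ler_normD _ _)) // [`|a - b|]distrC.
rewrite ler_norml; have := H x y; have := H y x; rewrite distrC => h1 h2.
by apply/andP; split; lra.
Qed.

Lemma infdist_continuous : continuous infdist.
Proof.
move=> x; apply/cvgrPdist_lt => e e0; apply/near_pt; exists e => // y h.
by rewrite (le_lt_trans (infdist_lip _ _)) // distrC.
Qed.

Lemma infdist_convex : (forall y z, C y -> C z -> C ((1 / 2) *: (y + z))) -> convex_fun infdist.
Proof.
move=> cC x u; apply/ler_addgt0Pr => e e0; have e2 : 0 < e / 2 by rewrite divr_gt0.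
have [y Cy hy] := infdist_near (x + u) e2; have [z Cz hz] := infdist_near (x - u) e2.
have := infdist_le x (cC y z Cy Cz).
have E : x - (1 / 2) *: (y + z) = (1 / 2) *: ((x + u - y) + (x - u - z)).
  by apply: pt_ext; rewrite !(coordD, coordN, coordZ); field.
have n2 : `|1 / 2 : R| = 1 / 2 by rewrite ger0_norm.
rewrite E normrZ n2; have := ler_normD (x + u - y) (x - u - z).
by move: hy hz; lra.
Qed.

End Distance.

Lemma conv_convex f k : continuous f -> Cc k -> (forall x, 0 <= k x) -> convex_fun f ->
  convex_fun (conv f k).
Proof.
move=> cf ck k0 h x u; rewrite !conv_comm //.
have c y : Cc (fun z => f (y - z) * k z) by apply: Cc_mulr => //; exact: continuous_reflect.
rewrite -J_scale // -J_add //; apply: J_le; [exact: Cc_scale|exact: Cc_add|].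
move=> z; rewrite mulrA -mulrDl ler_wpM2r //; have := h (x - z) u.
by rewrite addrAC [x - z - u]addrAC.
Qed.

(** As J k = 0, the constant f(x) can be subtracted under the integral, and the Lipschitz bound is
    uniform in x. For derivatives of a mollifier this bounds the derivatives of W although W itself
    grows. *)
Lemma conv_null_bound f k : continuous f -> Cc k -> J k = 0 ->
  (forall x y, `|f y - f x| <= `|y - x|) -> exists2 M, 0 <= M & forall x, `|conv f k x| <= M.
Proof.
move=> cf ck k0 lip.
have cn : Cc (fun z : pt R => `|z| * `|k z|).
  apply: Cc_mulr; last exact: Cc_norm.
  exact: norm_continuous.
exists (J (fun z : pt R => `|z| * `|k z|)); first by apply: J_ge0 => z; rewrite mulr_ge0.
move=> x; rewrite conv_comm //.
have c1 : Cc (fun z => f (x - z) * k z) by apply: Cc_mulr => //; exact: continuous_reflect.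
have -> : J (fun z => f (x - z) * k z) = J (fun z => f (x - z) * k z - f x * k z).
  by rewrite J_sub // ?J_scale // ?k0 ?mulr0 ?subr0 //; exact: Cc_scale.
have c2 : Cc (fun z => f (x - z) * k z - f x * k z) by apply: Cc_sub => //; exact: Cc_scale.
apply: (le_trans (J_abs c2)); apply: J_le => //; first exact: Cc_norm.
move=> z; rewrite -mulrBl normrM ler_wpM2r //.
by rewrite (le_trans (lip _ _)) // addrAC subrr add0r normrN.
Qed.

Lemma compact_margin (K O : set (pt R)) : compact K -> open O -> K `<=` O ->
  exists2 r, 0 < r & forall x y, K x -> `|y - x| < r -> O y.
Proof.
move=> /compact_near_coveringP cK oO KO.
have := cK R (0 : R)^'+ (fun e x => forall y, `|y - x| < e -> O y) _.
case=> [x Kx|]; last first.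
  move=> e /= e0 h; exists (e / 2); first by rewrite divr_gt0.
  move=> x y Kx; apply: h => //=; rewrite ?divr_gt0 //.
  by rewrite sub0r normrN ger0_norm ?divr_ge0 ?(ltW e0) //; move: e0; lra.
have := oO _ (KO _ Kx); rewrite /interior => /near_pt [d d0 hd].
have d2 : 0 < d / 2 by rewrite divr_gt0.
near=> x' e; move=> y yx'; apply: hd.
have h1 : `|x' - x| < d / 2.
  near: x'; apply/near_pt; exists (d / 2) => //.
have h2 : e < d / 2 by near: e; exact: nbhs_right_lt.
have := ler_normD (y - x') (x' - x); rewrite addrA subrK.
by move: yx' h1 h2 => /=; lra.
Unshelve. all: by end_near.
Qed.

Lemma erosion_convex (O : set (pt R)) r : convex_set3 O ->
  let C := [set x | forall y, `|y - x| < r -> O y] in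
  forall y z, C y -> C z -> C ((1 / 2) *: (y + z)).
Proof.
move=> cO C y z Cy Cz w hw; set m := (1 / 2) *: (y + z) in hw.
have Oy : O (y + (w - m)) by apply: Cy; rewrite addrAC subrr add0r.
have Oz : O (z + (w - m)) by apply: Cz; rewrite addrAC subrr add0r.
have t2 : 0 <= (1 / 2 : R) <= 1 by apply/andP; split; lra.
have := cO _ _ _ Oy Oz t2; congr O.
have E i (p q : pt R) : coord i ((1 / 2 * p.1.1 + (1 - 1 / 2) * q.1.1,
    1 / 2 * p.1.2 + (1 - 1 / 2) * q.1.2), 1 / 2 * p.2 + (1 - 1 / 2) * q.2)
    = 1 / 2 * coord i p + (1 - 1 / 2) * coord i q by rewrite /coord; case: i => [|[|i]].
by apply: pt_ext; rewrite E /m !(coordD, coordN, coordZ); clear; field.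
Qed.

(** W is the distance to the points of depth r0 / 2 in O, mollified at scale r0 / 8 and divided by
    r0 / 16. Points of K have depth r0, so W vanishes there; where W <= 3 the distance is at most 3
    r0 / 16 + r0 / 8 < r0 / 2, hence the point is still in O. *)
Theorem convex_weight (O K : set (pt R)) (D : R) a : open O -> convex_set3 O ->
  (forall x, O x -> `|x| <= D) -> compact K -> K `<=` O -> K a ->
  exists W M K', [/\ smth W, convex_fun W, (forall x, 0 <= W x), (forall x, K x -> W x = 0) &
    [/\ 0 < M, (forall i x, `|partial i W x| <= M), (forall i x, `|partial i (partial i W) x| <= M),
        [/\ compact K', K' `<=` O & forall x, W x <= 3 -> K' x] &
        forall x, 1 <= W x -> `|x - a| <= M * W x]].
Proof.
move=> oO cO bO cK KO Ka.
have [r0 r00 hr0] := compact_margin cK oO KO.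
pose C := [set x | forall y, `|y - x| < r0 / 2 -> O y].
have KC x : K x -> C x by move=> Kx y hy; apply: (hr0 x) => //; move: hy r00; lra.
have C0 : C !=set0 by exists a; exact: KC.
pose s := r0 / 8; have s0 : 0 < s by rewrite divr_gt0.
have [eta [se be supe [eta0 etae] eta1]] := mollifier s0.
pose F := infdist C; have cF : continuous F := infdist_continuous C0.
have Ce := smth_Cc se be.
pose W0 := conv F eta.
have sW0 : smth W0 by exact: smth_conv.
have approx x : `|W0 x - F x| <= s.
  apply: (@conv_approx _ F eta x s) => // z hz.
  by rewrite (le_trans (infdist_lip C0 _ _)) // addrAC subrr add0r normrN.
have W0K x : K x -> W0 x = 0.
  move=> Kx; rewrite /W0 conv_comm // -[RHS](J0 R); congr J; apply/funext => z.
  have [hz|hz] := ltP s `|z|; first by rewrite supe // mulr0.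
  rewrite /F infdist0 ?mul0r //; move=> y hy; apply: (hr0 x) => //.
  have := ler_normD (y - (x - z)) (- z).
  have -> : y - (x - z) + - z = y - x by rewrite opprB addrA addrAC addrK.
  by rewrite normrN; move: hy hz r00; rewrite /s; clear; lra.
have W00 x : 0 <= W0 x.
  by rewrite /W0 conv_comm //; apply: J_ge0 => z; rewrite mulr_ge0 // infdist_ge0.
have bnd k : smth k -> bsupp k -> J k = 0 -> exists2 M, 0 <= M & forall x, `|conv F k x| <= M.
  by move=> sk bk k0; apply: conv_null_bound => //; [exact: smth_Cc|exact: infdist_lip].
have bnd1 i : (i < 3)%N -> exists2 M, 0 <= M &
    forall x, `|partial i W0 x| <= M /\ `|partial i (partial i W0) x| <= M.
  move=> hi; have sp := smth_partial i se; have bp := bsupp_partial i be.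
  have [M1 p1 h1] := bnd _ sp bp (J_partial hi be (se 2%N)).
  have [M2 p2 h2] := bnd _ (smth_partial i sp) (bsupp_partial i bp) (J_partial hi bp (sp 2%N)).
  exists (M1 + M2); first by rewrite addr_ge0.
  move=> x; rewrite /W0 !partial_conv //.
  by split; [apply: le_trans (h1 x) _|apply: le_trans (h2 x) _]; rewrite ?lerDl ?lerDr.
have [M0 p0 h0] := bnd1 0%N isT; have [M1 p1 h1] := bnd1 1%N isT.
have [M2 p2 h2] := bnd1 2%N isT.
have hM i x : `|partial i W0 x| <= M0 + M1 + M2 /\ `|partial i (partial i W0) x| <= M0 + M1 + M2.
  have L (b m : R) : b <= m -> m <= M0 + M1 + M2 -> b <= M0 + M1 + M2 by exact: le_trans.
  case: i => [|[|i]].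
  - by have [q1 q2] := h0 x; split; [apply: L q1 _|apply: L q2 _]; rewrite -addrA lerDl addr_ge0.
  - by have [q1 q2] := h1 x; split; [apply: L q1 _|apply: L q2 _]; rewrite addrAC lerDr addr_ge0.
  - rewrite !partial_coord_ge2.
    by have [q1 q2] := h2 x; split; [apply: L q1 _|apply: L q2 _]; rewrite lerDr addr_ge0.
pose c := r0 / 16; have c0 : 0 < c by rewrite divr_gt0.
have D0 : 0 <= D by rewrite (le_trans (normr_ge0 a)) // bO //; exact: KO.
pose M := c^-1 * (M0 + M1 + M2) + c + s + 2 * D + 1.
have ci : 0 < c^-1 by rewrite invr_gt0.
have cM : 0 <= c^-1 * (M0 + M1 + M2) by rewrite mulr_ge0 ?(ltW ci) // !addr_ge0.
have E i : partial i (fun x => c^-1 * W0 x) = fun x => c^-1 * partial i W0 x.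
  exact: partialZ (sW0 1%N).
have nE (p : R) : `|p| <= M0 + M1 + M2 -> `|c^-1 * p| <= M.
  move=> h; rewrite normrM (gtr0_norm ci); apply: (@le_trans _ _ (c^-1 * (M0 + M1 + M2))).
    by rewrite ler_pM2l.
  by rewrite /M; move: c0 s0 D0; clear; lra.
have sW : smth (fun x => c^-1 * W0 x) by apply: smth_mul => //; exact: smth_cst.
exists (fun x => c^-1 * W0 x), M, [set x | c^-1 * W0 x <= 3]; split => //.
- move=> x u; rewrite mulrCA -mulrDr ler_pM2l //.
  apply: conv_convex => //; apply: infdist_convex => //.
  exact: erosion_convex.
- by move=> x; rewrite mulr_ge0 // ltW.
- by move=> x Kx; rewrite W0K // mulr0.
have K3 x : c^-1 * W0 x <= 3 -> O x.
  rewrite mulrC ler_pdivrMr // => h; have := approx x; rewrite ler_norml => /andP[h' _].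
  have f1 : 0 < r0 / 2 - F x by move: h h' r00; rewrite /c /s; clear; lra.
  have [y Cy hy] := infdist_near C0 x f1.
  by apply: Cy; move: hy; rewrite /F; lra.
split.
- by rewrite /M; move: cM c0 s0 D0; clear; lra.
- by move=> i x; rewrite E; apply: nE; have [] := hM i x.
- move=> i x; rewrite E (partialZ _ _ (smth_partial i sW0 1%N)); apply: nE.
  by have [] := hM i x.
- split => //.
  apply: subclosed_compact; [|exact: (@box_compact R D)|]; last by move=> x /K3 /bO.
  have -> : [set x | c^-1 * W0 x <= 3] = (fun x => c^-1 * W0 x) @^-1` [set t | t <= 3] by [].
  by apply: closed_comp; [move=> x _; exact: smth_cont|exact: closed_le].
- move=> x; rewrite mulrC ler_pdivlMr // mul1r => h.
  have f1 : `|x| - D <= F x.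
    apply: infdist_ge => // y Cy; have Oy : O y by apply: Cy; rewrite subrr normr0 divr_gt0.
    have := ler_normD (x - y) y; rewrite subrK; have := bO y Oy; lra.
  have f2 : `|x - a| <= `|x| + D.
    by rewrite (le_trans (ler_normB _ _)) // lerD2l bO //; exact: KO.
  have := approx x; rewrite ler_norml => /andP[h' _].
  have f3 : `|x - a| <= W0 x + (s + 2 * D) by move: f1 f2 h'; clear; lra.
  apply: (le_trans f3).
  rewrite [W0 x / c]mulrC; have k1 : 1 <= c^-1 * W0 x by rewrite mulrC ler_pdivlMr // mul1r.
  have e1 : W0 x = c * (c^-1 * W0 x) by rewrite mulrA divff ?mul1r // gt_eqF.
  have L (w b g u v : R) : 0 < b -> 0 <= g -> 0 < u -> 0 <= v -> 1 <= w ->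
      b * w + (u + 2 * v) <= (g + b + u + 2 * v + 1) * w.
    clear => b0 g0 u0 v0 w1; have := mulr_ge0 (ltW u0) (_ : 0 <= w - 1).
    have := mulr_ge0 v0 (_ : 0 <= w - 1); have := mulr_ge0 g0 (_ : 0 <= w).
    by rewrite subr_ge0 => /(_ (le_trans ler01 w1)) q1 /(_ w1) q2 /(_ w1) q3; lra.
  have e2 : W0 x + (s + 2 * D) = c * (c^-1 * W0 x) + (s + 2 * D) by rewrite -e1.
  by rewrite e2; exact: L.
Qed.

End ConvexWeight.

(** * Hardy and mass estimates in the collar *)

Section Collar.
Variable R : realType.
Implicit Types (x y z : pt R).

(** The difference of the sides is r (|y|^2 |s|^2 - (y . s)^2) + r (p + y . s)^2 + (t . y) p^2. The
    term r p^2 is left because div y = 3 exceeds the factor 2. *)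
Lemma hardy_algebra (r p s0 s1 s2 t0 t1 t2 y0 y1 y2 : R) : 0 <= r ->
  (y0 * s0 + y1 * s1 + y2 * s2) ^+ 2 <=
    (y0 ^+ 2 + y1 ^+ 2 + y2 ^+ 2) * (s0 ^+ 2 + s1 ^+ 2 + s2 ^+ 2) ->
  0 <= t0 * y0 + t1 * y1 + t2 * y2 ->
  2 * (r * p ^+ 2) <= r * ((y0 ^+ 2 + y1 ^+ 2 + y2 ^+ 2) * (s0 ^+ 2 + s1 ^+ 2 + s2 ^+ 2))
   + ((t0 * y0 + r * 1) * (p * p) + r * y0 * (s0 * p + p * s0)
    + ((t1 * y1 + r * 1) * (p * p) + r * y1 * (s1 * p + p * s1))
    + ((t2 * y2 + r * 1) * (p * p) + r * y2 * (s2 * p + p * s2))).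
Proof.
move=> r0; set D := y0 * s0 + y1 * s1 + y2 * s2; set E := (X in _ <= X -> _).
set S := t0 * y0 + _ + _ => C S0; rewrite -subr_ge0.
set u := (X in 0 <= X); have -> : u = r * (E - D ^+ 2) + r * (p + D) ^+ 2 + S * p ^+ 2.
  by rewrite /u /E /D /S; ring.
by rewrite !addr_ge0 // mulr_ge0 ?sqr_ge0 // subr_ge0.
Qed.

(** Pointwise form of [collar_mass]: g is grad W, t is grad psi, k the pure second derivatives of W,
    d the derivatives of v. Squares are completed in the twisted gradient d + w g v minus r g v; r
    <= 3 M^2 r |g|^2 then removes |g|^2 from the gain 2 w r |g|^2 |v|^2. *)
Lemma collar_algebra (M L w r v0 v1 v2 g0 g1 g2 t0 t1 t2 k0 k1 k2
    d00 d01 d02 d10 d11 d12 d20 d21 d22 : R) : 0 < M -> 0 < L -> 0 <= w -> 0 <= r <= 1 ->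
  `|g0| <= M -> `|g1| <= M -> `|g2| <= M -> `|t0| <= L -> `|t1| <= L -> `|t2| <= L ->
  `|k0| <= M -> `|k1| <= M -> `|k2| <= M ->
  r <= r * (3 * M ^+ 2 * (g0 ^+ 2 + g1 ^+ 2 + g2 ^+ 2)) ->
  2 * w * (r * (v0 ^+ 2 + v1 ^+ 2 + v2 ^+ 2)) <=
  3 * M ^+ 2 * ((3 * L * M + 3 * M + 3 * M ^+ 2) * (v0 ^+ 2 + v1 ^+ 2 + v2 ^+ 2)
   + ((d00 + w * g0 * v0) ^+ 2 + (d01 + w * g0 * v1) ^+ 2 + (d02 + w * g0 * v2) ^+ 2
    + ((d10 + w * g1 * v0) ^+ 2 + (d11 + w * g1 * v1) ^+ 2 + (d12 + w * g1 * v2) ^+ 2)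
    + ((d20 + w * g2 * v0) ^+ 2 + (d21 + w * g2 * v1) ^+ 2 + (d22 + w * g2 * v2) ^+ 2))
   - ((t0 * g0 + r * k0) * (v0 * v0 + v1 * v1 + v2 * v2) + r * g0 *
        (d00 * v0 + v0 * d00 + (d01 * v1 + v1 * d01) + (d02 * v2 + v2 * d02))
    + ((t1 * g1 + r * k1) * (v0 * v0 + v1 * v1 + v2 * v2) + r * g1 *
        (d10 * v0 + v0 * d10 + (d11 * v1 + v1 * d11) + (d12 * v2 + v2 * d12)))
    + ((t2 * g2 + r * k2) * (v0 * v0 + v1 * v1 + v2 * v2) + r * g2 *
        (d20 * v0 + v0 * d20 + (d21 * v1 + v1 * d21) + (d22 * v2 + v2 * d22))))).
Proof.
move=> M0 L0 w0 /andP[r0 r1] hg0 hg1 hg2 ht0 ht1 ht2 hk0 hk1 hk2 hr.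
have P (c d u : R) : 0 < u -> `|c| <= u -> `|d| <= M -> c * d <= u * M.
  move=> u0 h1 h2; rewrite (le_trans (ler_norm _)) // normrM ler_pM //.
have Q (c : R) : `|c| <= M -> c ^+ 2 <= M ^+ 2.
  by move=> h; rewrite -(real_normK (num_real c)) ler_pXn2r ?nnegrE // ltW.
have q (c : R) : `|c| <= M -> r * c <= M.
  move=> h; rewrite (le_trans (ler_norm _)) // normrM (ger0_norm r0) -[M]mul1r ler_pM //.
have B : t0 * g0 + r * k0 + (t1 * g1 + r * k1) + (t2 * g2 + r * k2)
    + r ^+ 2 * (g0 ^+ 2 + g1 ^+ 2 + g2 ^+ 2) <= 3 * L * M + 3 * M + 3 * M ^+ 2.
  have G : r ^+ 2 * (g0 ^+ 2 + g1 ^+ 2 + g2 ^+ 2) <= 3 * M ^+ 2.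
    have h : g0 ^+ 2 + g1 ^+ 2 + g2 ^+ 2 <= 3 * M ^+ 2.
      by have := Q _ hg0; have := Q _ hg1; have := Q _ hg2; clear; lra.
    apply: le_trans h; rewrite ler_piMl ?addr_ge0 ?sqr_ge0 //.
    by rewrite expr2 mulr_ile1.
  have := P _ _ _ L0 ht0 hg0; have := P _ _ _ L0 ht1 hg1; have := P _ _ _ L0 ht2 hg2.
  by have := q _ hk0; have := q _ hk1; have := q _ hk2; move: G; clear; lra.
set G := g0 ^+ 2 + _ + _ in hr B; set S := v0 ^+ 2 + _ + _.
set C := _ + _ + 3 * M ^+ 2 in B *.
have S0 : 0 <= S by rewrite /S !addr_ge0 ?sqr_ge0.
have m0 : 0 <= 3 * M ^+ 2 by rewrite mulr_ge0 ?sqr_ge0.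
apply: (@le_trans _ _ (3 * M ^+ 2 * (2 * w * (r * G * S)))).
  have -> : 3 * M ^+ 2 * (2 * w * (r * G * S)) = 2 * w * (r * (3 * M ^+ 2 * G) * S) by ring.
  by rewrite ler_wpM2l ?mulr_ge0 // ler_wpM2r.
apply: ler_wpM2l => //; rewrite -subr_ge0; set u := (X in 0 <= X).
have -> : u = (C - (t0 * g0 + r * k0 + (t1 * g1 + r * k1) + (t2 * g2 + r * k2) + r ^+ 2 * G)) * S
   + (((d00 + w * g0 * v0 - r * g0 * v0) ^+ 2 + (d01 + w * g0 * v1 - r * g0 * v1) ^+ 2
       + (d02 + w * g0 * v2 - r * g0 * v2) ^+ 2)
    + ((d10 + w * g1 * v0 - r * g1 * v0) ^+ 2 + (d11 + w * g1 * v1 - r * g1 * v1) ^+ 2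
       + (d12 + w * g1 * v2 - r * g1 * v2) ^+ 2)
    + ((d20 + w * g2 * v0 - r * g2 * v0) ^+ 2 + (d21 + w * g2 * v1 - r * g2 * v1) ^+ 2
       + (d22 + w * g2 * v2 - r * g2 * v2) ^+ 2)).
  by rewrite /u /S /G; ring.
by rewrite addr_ge0 ?mulr_ge0 ?subr_ge0 // !addr_ge0 ?sqr_ge0.
Qed.

Lemma bounded_gradient (k : pt R -> R) : bsupp k -> smth k -> exists2 L, 0 < L &
  forall i x, `|partial i k x| <= L.
Proof.
move=> bk sk.
have [L0 p0 h0] := Cc_bounded (Cc_partial 0 bk (sk 1%N)).
have [L1 p1 h1] := Cc_bounded (Cc_partial 1 bk (sk 1%N)).
have [L2 p2 h2] := Cc_bounded (Cc_partial 2 bk (sk 1%N)).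
exists (L0 + L1 + L2) => [|i x]; first by rewrite !addr_gt0.
case: i => [|[|i]].
- by rewrite (le_trans (h0 x)) // -addrA lerDl addr_ge0 // ltW.
- by rewrite (le_trans (h1 x)) // addrAC lerDr addr_ge0 // ltW.
- by rewrite partial_coord_ge2 (le_trans (h2 x)) // lerDr addr_ge0 // ltW.
Qed.

Lemma sstep_derive (b c t : R) : b < c ->
  exists2 d, 0 <= d & is_derive t (1 : R) (sstep b c) d.
Proof.
move=> bc; pose f s := expinv 0 (s - b); pose g s := expinv 0 (c - s).
have den s : 0 < f s + g s by exact: sstep_den.
have df : is_derive t (1 : R) f (expinv 2 (t - b)).
  have h1 : is_derive t (1 : R) (fun s => s - b) 1.
    by have := is_deriveB (is_derive_id t (1 : R)) (is_derive_cst b t 1); rewrite subr0.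
  have := @is_derive1_comp R (expinv 0) (fun s => s - b) _ _ _ (is_derive_expinv 0 (t - b)) h1.
  by rewrite mul0r subr0 mulr1.
have dg : is_derive t (1 : R) g (- expinv 2 (c - t)).
  have h1 : is_derive t (1 : R) (fun s => c - s) (- 1).
    by have := is_deriveB (is_derive_cst c t 1) (is_derive_id t (1 : R)); rewrite sub0r.
  have := @is_derive1_comp R (expinv 0) (fun s => c - s) _ _ _ (is_derive_expinv 0 (c - t)) h1.
  by rewrite mul0r subr0 mulrN mulr1.
have n0 : f t + g t != 0 by rewrite gt_eqF.
have dV : is_derive t (1 : R) (fun s => (f s + g s)^-1)
    (- (f t + g t) ^- 2 *: (expinv 2 (t - b) - expinv 2 (c - t))).
  by apply: is_deriveV => //; exact: is_deriveD.
have := is_deriveM df dV.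
set d := _ + _ => H; exists d; last exact: H.
rewrite /d /GRing.scale /=.
have -> : f t * (- (f t + g t) ^- 2 * (expinv 2 (t - b) - expinv 2 (c - t)))
    + (f t + g t)^-1 * expinv 2 (t - b) =
  (f t + g t) ^- 2 * (f t * expinv 2 (c - t) + g t * expinv 2 (t - b)) by field.
by rewrite mulr_ge0 ?invr_ge0 ?exprn_ge0 ?(ltW (den t)) // addr_ge0 // mulr_ge0 // expinv_ge0.
Qed.

Variables (W : pt R -> R) (M : R) (a : pt R).
Hypotheses (sW : smth W) (cW : convex_fun W) (W0 : forall x, 0 <= W x) (Wa : W a = 0).
Hypotheses (M0 : 0 < M) (dW : forall i x, `|partial i W x| <= M)
  (ddW : forall i x, `|partial i (partial i W) x| <= M)
  (growth : forall x, 1 <= W x -> `|x - a| <= M * W x).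

Lemma partial_at_min i x : W x = 0 -> partial i W x = 0.
Proof.
move=> h; apply: partial_val; rewrite /pD.
apply: (@derive1_at_min _ _ (coord i x - 1) (coord i x + 1)).
- lra.
- move=> t _; exact: (ex_derive (is_derive := der_upd i x t (sW 1%N))).
- by rewrite in_itv /=; apply/andP; split; lra.
- by move=> t _; rewrite upd_coord h.
Qed.

Lemma radial_slope x : W x <= slope W (x - a) x.
Proof.
have := convex_gradient x a sW cW; rewrite Wa -opprB slopeN.
by move: (slope _ _ _) => s; lra.
Qed.

Lemma euclid_sup x r : `|x| <= r -> sum3 (fun i => coord i x ^+ 2) <= 3 * r ^+ 2.
Proof. by move=> /sqn_upper; rewrite /sqn /sum3 !expr2. Qed.

(** Convexity and W(a) = 0 give W(x) <= grad W . (x - a), and the Euclidean length of x - a is at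
    most sqrt 3 M W(x). *)
Lemma gradient_lower x : 1 <= W x -> 1 <= 3 * M ^+ 2 * sum3 (fun i => partial i W x ^+ 2).
Proof.
move=> h; have w0 : 0 < W x by exact: lt_le_trans h.
have e := euclid_sup (growth h).
have s := radial_slope x; have := cauchy3 (fun i => partial i W x) (fun i => coord i (x - a)).
move: s e; rewrite /slope; set s := sum3 _; set E := sum3 _; set G := sum3 _.
move=> s1 e1 c1; have G0 : 0 <= G by rewrite /G /sum3 !addr_ge0 ?sqr_ge0.
have k : W x ^+ 2 <= s ^+ 2 by rewrite ler_pXn2r ?nnegrE // (le_trans _ s1).
have : W x ^+ 2 * 1 <= W x ^+ 2 * (3 * M ^+ 2 * G).
  rewrite mulr1 (le_trans k) // (le_trans c1) // (@le_trans _ _ (G * (3 * (M * W x) ^+ 2))) //.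
    by rewrite ler_wpM2l.
  by rewrite le_eqVlt; apply/orP; left; apply/eqP; ring.
by rewrite ler_pM2l ?exprn_gt0.
Qed.

Lemma partial_sstep b c x : b < c -> exists2 d, 0 <= d &
  forall i, partial i (fun y => sstep b c (W y)) x = d * partial i W x.
Proof.
move=> bc; have [d d0 hd] := sstep_derive (W x) bc; exists d => // i.
by apply: partial_val; apply: pD_comp => //; exact: smth_pD.
Qed.

(** psi marks the collar W > 1, and zeta cuts off between W = 2 and W = 3, where psi = 1. All errors
    caused by the cut-off are therefore collar terms. *)
Definition psi x := sstep 1 2 (W x).
Definition zeta x := 1 - sstep 2 3 (W x).

Let lt12 : (1 : R) < 2. Proof. by rewrite ltr1n. Qed.
Let lt23 : (2 : R) < 3. Proof. by rewrite ltr_nat. Qed.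

Lemma smth_psi : smth psi. Proof. exact: smth_sstep. Qed.
Lemma smth_zeta : smth zeta.
Proof. by apply: smth_add; [exact: smth_cst|apply/smth_opp; exact: smth_sstep]. Qed.
Lemma psi01 x : 0 <= psi x <= 1. Proof. exact: sstep01. Qed.
Lemma zeta01 x : 0 <= zeta x <= 1.
Proof. by have /andP[p q] := sstep01 (W x) lt23; rewrite /zeta subr_ge0 q lerBlDl lerDr p. Qed.
Lemma psi0 x : W x <= 1 -> psi x = 0. Proof. exact: sstep0. Qed.
Lemma psi1 x : 2 <= W x -> psi x = 1. Proof. exact: sstep1. Qed.
Lemma zeta0 x : 3 <= W x -> zeta x = 0. Proof. by move=> h; rewrite /zeta sstep1 // subrr. Qed.
Lemma zeta1 x : W x <= 2 -> zeta x = 1. Proof. by move=> h; rewrite /zeta sstep0 // subr0. Qed.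

Lemma partial_zeta0 i x : W x < 2 -> partial i zeta x = 0.
Proof.
move=> h; have e0 : 0 < 2 - W x by rewrite subr_gt0.
have [d d0 hd] := continuous_near x (smth_cont sW) e0.
rewrite (@partial_near _ i zeta (fun=> 1) x) ?partial_cst //.
apply/near_pt; exists d => // y /hd hy; rewrite zeta1 //.
by have := ler_norm (W y - W x); move: hy; lra.
Qed.

Lemma radial_psi x : 0 <= slope psi (x - a) x.
Proof.
have [d d0 hd] := partial_sstep x lt12.
have -> : slope psi (x - a) x = d * slope W (x - a) x.
  have e i : partial i psi x = d * partial i W x by exact: hd.
  have E (p q r c0 c1 c2 p' q' r' : R) : p' = d * p -> q' = d * q -> r' = d * r ->
      p' * c0 + q' * c1 + r' * c2 = d * (p * c0 + q * c1 + r * c2).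
    by move=> -> -> ->; rewrite !mulrDr !mulrA.
  exact: E (e 0%N) (e 1%N) (e 2%N).
by rewrite mulr_ge0 // (le_trans _ (radial_slope x)).
Qed.

Hypothesis bW : exists r, forall x, r < `|x| -> 3 <= W x.

Lemma bsupp_zeta : bsupp zeta.
Proof. by have [r hr] := bW; exists r => x /hr; exact: zeta0. Qed.

Lemma cutoff_gradient : exists2 L, 0 < L &
  forall i x, `|partial i psi x| <= L /\ `|partial i zeta x| <= L.
Proof.
have s1 : smth (fun x => 1 - psi x).
  by apply: smth_add; [exact: smth_cst|apply/smth_opp/smth_psi].
have b1 : bsupp (fun x => 1 - psi x).
  by have [r hr] := bW; exists r => x /hr h; rewrite psi1 ?subrr // (le_trans _ h) // ler_nat.
have [L1 p1 h1] := bounded_gradient b1 s1.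
have [L2 p2 h2] := bounded_gradient bsupp_zeta smth_zeta.
exists (L1 + L2); first exact: addr_gt0.
move=> i x; split; last by rewrite (le_trans (h2 i x)) // lerDr ltW.
have := h1 i x; have -> : partial i (fun x => 1 - psi x) x = - partial i psi x.
  rewrite -[RHS]add0r; apply: partial_val; apply: pD_add; first exact: pD_cst.
  by apply: pD_opp; apply: smth_pD; exact: smth_psi.
by rewrite normrN => h; rewrite (le_trans h) // lerDl ltW.
Qed.

Lemma zeta_gradient L x : (forall i x, `|partial i psi x| <= L /\ `|partial i zeta x| <= L) ->
  sum3 (fun i => partial i zeta x ^+ 2) <= 3 * L ^+ 2 * psi x.
Proof.
move=> hL; have [h|h] := ltP (W x) 2.
  rewrite /sum3 !partial_zeta0 // expr0n /= !addr0; have /andP[p _] := psi01 x.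
  by rewrite mulr_ge0 // mulr_ge0 ?sqr_ge0.
rewrite psi1 // mulr1.
have e i : partial i zeta x ^+ 2 <= L ^+ 2.
  have [_ hi] := hL i x; rewrite -(real_normK (num_real (partial i zeta x))).
  by rewrite ler_pXn2r ?nnegrE // (le_trans _ hi).
have := e 0%N; have := e 1%N; have := e 2%N; rewrite /sum3.
move: (partial 0 _ _) (partial 1 _ _) (partial 2 _ _) => p q r; lra.
Qed.

(* The field Y = psi (x - a) p^2 is outward, so its divergence controls psi p^2. *)
Lemma hardy_collar p : smth p -> bsupp p ->
  2 * J (fun x => psi x * p x ^+ 2) <=
  J (fun x => psi x * (sum3 (fun i => coord i (x - a) ^+ 2) * sum3 (fun i => partial i p x ^+ 2))).
Proof.
move=> sp bp; have ss := smth_psi.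
have sc i : smth (fun x => coord i x - coord i a) by apply: smth_add; [exact: smth_coord|exact: smth_cst].
pose T i x := psi x * (coord i x - coord i a) * (p x * p x).
have sT i : smth (T i).
  by have := sc i => h; rewrite /T; apply: smth_mul; apply: smth_mul.
have bT i : bsupp (T i) by apply: bsupp_mulr; exact: bsupp_mull.
have cc1 : Cc (fun x => psi x * p x ^+ 2) by cc.
have sr i : smth (fun x => coord i (x - a) ^+ 2).
  by have := smth_exp 2 (sc i); under eq_fun do rewrite -coordB.
have cc2 : Cc (fun x => psi x * (sum3 (fun i => coord i (x - a) ^+ 2) * sum3 (fun i => partial i p x ^+ 2))).
  apply: smth_Cc; last by rewrite /sum3; apply: bsupp_mulr; apply: bsupp_mulr; bs.
  apply: smth_mul => //; rewrite /sum3; apply: smth_mul; last by sm.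
  by repeat apply: smth_add; exact: sr.
have sD : smth (fun x => sum3 (fun i => partial i (T i) x)).
  by rewrite /sum3; repeat apply: smth_add; apply: smth_partial; exact: sT.
have bD : bsupp (fun x => sum3 (fun i => partial i (T i) x)).
  by rewrite /sum3; repeat apply: bsupp_add; apply: bsupp_partial; exact: bT.
rewrite -(J_scale _ cc1) -[leRHS]addr0 -(J_div sT bT) -(J_add cc2 (smth_Cc sD bD)).
apply: J_le; [exact: Cc_scale|exact: Cc_add (smth_Cc _ _)|move=> x].
have pc i : (i < 3)%N -> pD i (fun x => coord i x - coord i a) x 1.
  move=> hi; rewrite -[X in pD _ _ _ X]subr0; apply: pD_add; last by apply: pD_opp; exact: pD_cst.
  by have := smth_pD i x (smth_coord R i); rewrite partial_coord // eqxx.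
have E i : (i < 3)%N -> partial i (T i) x =
    (partial i psi x * (coord i x - coord i a) + psi x * 1) * (p x * p x)
    + psi x * (coord i x - coord i a) * (partial i p x * p x + p x * partial i p x).
  move=> hi; apply: partial_val; rewrite /T.
  by apply: pD_mul; [apply: pD_mul; [exact: smth_pD|exact: pc]|apply: pD_mul; exact: smth_pD].
have := radial_psi x; have /andP[q0 _] := psi01 x.
have := cauchy3 (fun i => coord i (x - a)) (fun i => partial i p x).
rewrite /slope /sum3 !coordB (E 0%N) // (E 1%N) // (E 2%N) //.
move=> C S; apply: hardy_algebra => //.
Qed.

Lemma partial_weight w i x : partial i (fun y => w * W y) x = w * partial i W x.
Proof. by rewrite (partialZ _ _ (sW 1%N)). Qed.

(* The divergence of Y = psi (grad W) |v|^2 exhibits the collar mass of v with the large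
   factor w; the remaining terms are of order zero or bounded by the twisted gradient. *)
Lemma collar_mass L w (v : vfield R) : 0 < L -> 0 <= w ->
  (forall i x, `|partial i psi x| <= L /\ `|partial i zeta x| <= L) ->
  (forall i, smth (v i)) -> (forall i, bsupp (v i)) ->
  2 * w * J (fun x => psi x * nrm2 v x) <=
  3 * M ^+ 2 * ((3 * L * M + 3 * M + 3 * M ^+ 2) * J (nrm2 v) + J (gradp2 (fun x => w * W x) v)).
Proof.
move=> L0 w0 hL sv bv; have ss := smth_psi.
pose T j x := psi x * partial j W x * (v 0%N x * v 0%N x + v 1%N x * v 1%N x + v 2%N x * v 2%N x).
have sT j : smth (T j) by rewrite /T; sm.
have bT j : bsupp (T j) by rewrite /T; bs.
have cn : Cc (nrm2 v) by rewrite /nrm2 /sum3; cc.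
have cpn : Cc (fun x => psi x * nrm2 v x) by rewrite /nrm2 /sum3; cc.
have sh : smth (fun x => w * W x) by apply: smth_mul => //; exact: smth_cst.
have cg : Cc (gradp2 (fun x => w * W x) v).
  by rewrite /gradp2 /gradp /sum3; cc.
have cD : Cc (fun x => sum3 (fun i => partial i (T i) x)).
  by rewrite /sum3; apply: smth_Cc; [repeat apply: smth_add; apply: smth_partial; exact: sT
    |repeat apply: bsupp_add; apply: bsupp_partial; exact: bT].
set C1 := 3 * L * M + _ + _.
have c1 := Cc_scale C1 cn; have c2 := Cc_add c1 cg; have c3 := Cc_sub c2 cD.
rewrite -(J_scale _ cpn) -(J_scale _ cn) -(J_add c1 cg) -[J (fun x => C1 * _ + _)]subr0.
rewrite -(J_div sT bT) -(J_sub c2 cD) -(J_scale _ c3).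
apply: J_le; [exact: Cc_scale|exact: Cc_scale|move=> x].
have E j : partial j (T j) x =
   (partial j psi x * partial j W x + psi x * partial j (partial j W) x)
     * (v 0%N x * v 0%N x + v 1%N x * v 1%N x + v 2%N x * v 2%N x)
   + psi x * partial j W x * (partial j (v 0%N) x * v 0%N x + v 0%N x * partial j (v 0%N) x
     + (partial j (v 1%N) x * v 1%N x + v 1%N x * partial j (v 1%N) x)
     + (partial j (v 2%N) x * v 2%N x + v 2%N x * partial j (v 2%N) x)).
  apply: partial_val; rewrite /T; have := smth_partial j sW => sp.
  by apply: pD_mul; [apply: pD_mul; exact: smth_pD|
    repeat apply: pD_add; apply: pD_mul; exact: smth_pD].
have hr : psi x <= psi x * (3 * M ^+ 2 * sum3 (fun i => partial i W x ^+ 2)).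
  have [h|h] := leP (W x) 1; first by rewrite psi0 // mul0r.
  by rewrite ler_peMr ?gradient_lower ?(ltW h) //; have /andP[] := psi01 x.
move: hr; rewrite /gradp2 /gradp /nrm2 /sum3 (E 0%N) (E 1%N) (E 2%N) !partial_weight => hr.
by apply: collar_algebra (psi01 x) _ _ _ _ _ _ _ _ _ hr => //; have [] := hL 0%N x;
  have [] := hL 1%N x; have [] := hL 2%N x.
Qed.

End Collar.

(** * Estimates for the twisted field v *)

Section TwistedField.
Variable R : realType.
Implicit Types (x y z : pt R).

Lemma convex_partial2_ge0 (W : pt R -> R) i x : smth W -> convex_fun W -> (i < 3)%N ->
  0 <= partial i (partial i W) x.
Proof.
move=> sW cW hi; have := convex_hess x (fun j => (j == i)%:R) sW cW; rewrite /hess /sum3.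
by case: i hi => [|[|[|i]]] // _ /=; gen_atoms x W; rewrite !(mulr0, mulr1, addr0, add0r).
Qed.

Lemma exp_decay (w t : R) : 1 <= w -> 0 <= t -> t * expR (- (w * t)) <= 1.
Proof.
move=> w1 t0; rewrite expRN; have e0 := expR_gt0 (w * t).
rewrite ler_pdivrMr // mul1r (le_trans _ (expR_ge1Dx _)) //.
by rewrite (@le_trans _ _ (w * t)) ?lerDr // ler_peMl.
Qed.

Lemma sqr_add_le (tau a b : R) : 0 < tau ->
  (a + b) ^+ 2 <= (1 + tau) * a ^+ 2 + (1 + tau^-1) * b ^+ 2.
Proof.
move=> t0; rewrite -subr_ge0.
have -> : (1 + tau) * a ^+ 2 + (1 + tau^-1) * b ^+ 2 - (a + b) ^+ 2 = (tau * a - b) ^+ 2 / tau.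
  by field; rewrite gt_eqF.
by rewrite divr_ge0 ?sqr_ge0 // ltW.
Qed.

Lemma cross_le (a b : nat -> R) :
  sum3 (fun i => cross a b i ^+ 2) <= sum3 (fun i => a i ^+ 2) * sum3 (fun i => b i ^+ 2).
Proof.
rewrite -subr_ge0 /sum3 /cross /=; move: (a _) (a _) (a _) (b _) (b _) (b _) => p q r s t u.
set z := (X in 0 <= X); have -> : z = (p * s + q * t + r * u) ^+ 2 by rewrite /z; ring.
exact: sqr_ge0.
Qed.

Lemma sum3_sqr_add (tau : R) (a b : nat -> R) : 0 < tau ->
  sum3 (fun i => (a i + b i) ^+ 2) <=
  (1 + tau) * sum3 (fun i => a i ^+ 2) + (1 + tau^-1) * sum3 (fun i => b i ^+ 2).
Proof.
move=> t0; have h i := sqr_add_le (a i) (b i) t0.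
by rewrite /sum3 !mulrDr; have := h 0%N; have := h 1%N; have := h 2%N; clear; lra.
Qed.

Lemma sum3_scale (c : R) (a : nat -> R) : 0 <= c <= 1 ->
  sum3 (fun i => (c * a i) ^+ 2) <= sum3 (fun i => a i ^+ 2).
Proof.
move=> /andP[c0 c1]; rewrite /sum3 !exprMn -!mulrDr ler_piMl ?addr_ge0 ?sqr_ge0 //.
by rewrite expr2 mulr_ile1.
Qed.

Variables (W : pt R -> R) (chi : vfield R) (P : pt R -> R) (w : R).
Hypotheses (sW : smth W) (cW : convex_fun W) (W0 : forall x, 0 <= W x).
Hypotheses (sc : forall i, smth (chi i)) (bc : forall i, bsupp (chi i)).
Hypothesis disj : forall i x, chi i x = 0 \/ W x = 0.
Hypotheses (sP : smth P) (bP : bsupp P) (w1 : 1 <= w).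

Let h x := w * W x.
Definition tpot x := sum3 (fun i => (w * partial i W x) ^+ 2)
  + w * sum3 (fun i => partial i (partial i W) x).
(** The subtracted vector is e^h grad (e^(-h) P). *)
Definition tfield : vfield R := fun i x => chi i x - (partial i P x - w * partial i W x * P x).
Definition tscalar x := expR (- (w * W x)) * P x.

Let w0 : 0 <= w. Proof. exact: le_trans w1. Qed.

Lemma smth_tpot : smth tpot.
Proof.
have cw : smth (fun _ : pt R => w) by exact: smth_cst.
by rewrite /tpot /sum3; sm.
Qed.

Lemma tpot_ge0 x : 0 <= tpot x.
Proof.
rewrite /tpot addr_ge0 //; first by rewrite /sum3 !addr_ge0 ?sqr_ge0.
by rewrite mulr_ge0 // /sum3 !addr_ge0 // convex_partial2_ge0.
Qed.

Lemma smth_tfield i : smth (tfield i).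
Proof. by rewrite /tfield; sm. Qed.

Lemma bsupp_tfield i : bsupp (tfield i).
Proof. by rewrite /tfield; bs. Qed.

Let gradW0 k j x : partial k W x * chi j x = 0.
Proof.
by have [->|e] := disj j x; rewrite ?mulr0 // partial_at_min // mul0r.
Qed.

Let dh i x : partial i h x = w * partial i W x.
Proof. exact: partial_weight. Qed.

Let dfield j i x : partial j (tfield i) x = partial j (chi i) x
  - (partial j (partial i P) x - (w * partial j (partial i W) x * P x + w * partial i W x * partial j P x)).
Proof.
have sp := smth_partial i sW; have sp' := smth_partial i sP.
have e : pD j (fun x => w * partial i W x) x (w * partial j (partial i W) x).
  have := pD_mul (@pD_cst R j w x) (smth_pD j x sp); by rewrite mul0r add0r.
apply: partial_val; rewrite /tfield; apply: pD_add; first exact: smth_pD.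
apply: pD_opp; apply: pD_add; first exact: smth_pD.
by apply: pD_opp; apply: pD_mul => //; exact: smth_pD.
Qed.

(** The twisted rotation annihilates e^h grad (e^(-h) P), and grad h x chi = 0 since W is minimal
    wherever chi does not vanish. *)
Lemma rotm_tfield i x : rotm h tfield i x = Defs.rot chi i x.
Proof.
have E : rotm h tfield i x = Defs.rot chi i x
    - w * cross (fun k => partial k W x) (fun k => chi k x) i.
  have c10 := @smth_comm R 1 0 W x isT isT sW; have c20 := @smth_comm R 2 0 W x isT isT sW.
  have c21 := @smth_comm R 2 1 W x isT isT sW.
  have d10 := @smth_comm R 1 0 P x isT isT sP; have d20 := @smth_comm R 2 0 P x isT isT sP.
  have d21 := @smth_comm R 2 1 P x isT isT sP.
  case: i => [|[|i]]; rewrite /rotm /Defs.rot /cross /= !dh /tfield.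
  - rewrite (dfield 1 2) (dfield 2 1) c21 d21; clear; gen_atoms x chi; gen_atoms x W; ring.
  - rewrite (dfield 2 0) (dfield 0 2) c20 d20; clear; gen_atoms x chi; gen_atoms x W; ring.
  - rewrite (dfield 0 1) (dfield 1 0) c10 d10; clear; gen_atoms x chi; gen_atoms x W; ring.
rewrite E; suff -> : cross (fun k => partial k W x) (fun k => chi k x) i = 0 by rewrite mulr0 subr0.
by rewrite /cross; case: i {E} => [|[|i]] /=; rewrite !gradW0 subr0.
Qed.

Lemma divp_tfield x :
  divp h tfield x = sum3 (fun i => partial i (chi i) x) + Hop tpot P x.
Proof.
have E : divp h tfield x = sum3 (fun i => partial i (chi i) x) + Hop tpot P x
    + w * sum3 (fun i => partial i W x * chi i x).
  rewrite /divp /gradp /Hop /tpot /sum3 !dh (dfield 0 0) (dfield 1 1) (dfield 2 2) /tfield.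
  by clear; gen_atoms x chi; gen_atoms x W; ring.
by rewrite E /sum3 !gradW0 !addr0 mulr0 addr0.
Qed.

Lemma smth_tscalar : smth tscalar.
Proof.
have sh : smth (fun x => expR (- (w * W x))).
  move=> m; apply: Ck_expR; apply/Ck_opp/Ck_mul; [exact: Ck_cst|exact: sW].
by rewrite /tscalar; sm.
Qed.

Lemma bsupp_tscalar : bsupp tscalar.
Proof. exact: bsupp_mulr. Qed.

(** Multiplying v by e^(-h) leaves chi unchanged, because h = 0 on its support. *)
Lemma tscalar_gradient i x :
  chi i x - partial i tscalar x = expR (- (w * W x)) * tfield i x.
Proof.
have sh : smth (fun x => - (w * W x)) by apply: smth_opp; apply: smth_mul => //; exact: smth_cst.
have e : partial i (fun x => expR (- (w * W x))) x = expR (- (w * W x)) * - (w * partial i W x).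
  rewrite (partial_expR i (sh 1%N)); congr (_ * _).
  by apply: partial_val; apply: pD_opp; rewrite -dh; apply: smth_pD; apply: smth_mul => //; exact: smth_cst.
have se : smth (fun x => expR (- (w * W x))) by move=> m; exact: Ck_expR.
have E : partial i tscalar x = expR (- (w * W x)) * - (w * partial i W x) * P x
    + expR (- (w * W x)) * partial i P x.
  by apply: partial_val; rewrite /tscalar -e; apply: pD_mul; exact: smth_pD.
have E2 : expR (- (w * W x)) * chi i x = chi i x.
  by have [->|->] := disj i x; rewrite ?mulr0 // oppr0 expR0 mul1r.
rewrite E /tfield mulrDr E2; move: (expR _) (partial i W x) (partial i P x) => a b d; ring.
Qed.

Variables (M L : R) (a : pt R).
Hypotheses (Wa : W a = 0) (M0 : 0 < M) (L0 : 0 < L) (dW : forall i x, `|partial i W x| <= M)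
  (ddW : forall i x, `|partial i (partial i W) x| <= M)
  (growth : forall x, 1 <= W x -> `|x - a| <= M * W x)
  (bW : exists r, forall x, r < `|x| -> 3 <= W x)
  (hL : forall i x, `|partial i (psi W) x| <= L /\ `|partial i (zeta W) x| <= L).

Let R0 := J (nrm2 (Defs.rot chi)).
Let D0 := J (fun x => (sum3 (fun i => partial i (chi i) x) + Hop tpot P x) ^+ 2).
Let Y := J (fun x => psi W x * nrm2 tfield x).
Definition zfield : vfield R := fun i x => zeta W x * tfield i x.

Let sh : smth h. Proof. by apply: smth_mul => //; exact: smth_cst. Qed.
Let ch : convex_fun h.
Proof. by move=> x u; rewrite /h mulrCA -mulrDr ler_wpM2l. Qed.
Let ss := smth_psi sW.
Let sz := smth_zeta sW.
Let bz := bsupp_zeta bW.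
Let st := smth_tfield.
Let bt := bsupp_tfield.

Let cn (v : vfield R) : (forall i, smth (v i)) -> (forall i, bsupp (v i)) -> Cc (nrm2 v).
Proof. by move=> sv bv; rewrite /nrm2 /sum3; cc. Qed.

Let cpn : Cc (fun x => psi W x * nrm2 tfield x).
Proof. by apply: Cc_mulr; [exact: smth_cont|exact: cn]. Qed.

Let srot i : smth (Defs.rot chi i).
Proof. by rewrite /Defs.rot; case: i => [|[|i]] /=; sm. Qed.
Let brot i : bsupp (Defs.rot chi i).
Proof. by rewrite /Defs.rot; case: i => [|[|i]] /=; bs. Qed.

Let cD : Cc (fun x => (sum3 (fun i => partial i (chi i) x) + Hop tpot P x) ^+ 2).
Proof.
apply: Cc_sqr; apply: Cc_add; first by rewrite /sum3; cc.
have sH := smth_Hop smth_tpot sP; have bH := bsupp_Hop tpot bP.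
by split; [exact: (smth_cont sH)|exact: bH].
Qed.

Lemma twisted_gradient_energy : J (gradp2 h tfield) <= R0 + D0.
Proof.
have g := gaffney sh st bt.
have cg : Cc (gradp2 h tfield) by rewrite /gradp2 /gradp /sum3; cc.
have chq : Cc (fun x => gradp2 h tfield x + hessq h tfield x).
  by apply: Cc_add => //; rewrite /hessq /nrm2 /sum3; cc.
apply: (@le_trans _ _ (J (fun x => gradp2 h tfield x + hessq h tfield x))).
  by apply: J_le => // x; rewrite lerDl hessq_convex.
rewrite -g le_eqVlt; apply/orP; left; apply/eqP.
rewrite /R0 /D0 -(J_add (cn srot brot) cD); congr J; apply/funext => x.
by rewrite divp_tfield; congr (_ + _); rewrite /nrm2 /sum3 !rotm_tfield.
Qed.

(** The factor w stands on the left only, apart from quantities that are bounded independently of it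
    later; large w thus makes the collar mass Y small. *)
Lemma twisted_collar :
  2 * w * Y <= 3 * M ^+ 2 * ((3 * L * M + 3 * M + 3 * M ^+ 2) * J (nrm2 tfield) + (R0 + D0)).
Proof.
apply: (le_trans (collar_mass sW cW W0 Wa M0 dW ddW growth L0 w0 hL st bt)).
rewrite ler_pM2l ?mulr_gt0 ?exprn_gt0 // lerD2l; exact: twisted_gradient_energy.
Qed.

(** zeta = 1 where W <= 2, and psi = 1 where W >= 2. *)
Lemma twisted_split : J (nrm2 tfield) <= J (nrm2 zfield) + Y.
Proof.
have szf i : smth (zfield i) by apply: smth_mul; [exact: sz|exact: st].
have bzf i : bsupp (zfield i) by apply: bsupp_mull; exact: bz.
have c := cn szf bzf; rewrite /Y -(J_add c cpn); apply: J_le; [exact: cn|exact: Cc_add|move=> x].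
have n0 v : 0 <= nrm2 v x by rewrite /nrm2 /sum3 !addr_ge0 ?sqr_ge0.
have [h2|h2] := leP (W x) 2.
  have z i : zfield i x = tfield i x by rewrite /zfield zeta1 // mul1r.
  have -> : nrm2 zfield x = nrm2 tfield x by rewrite /nrm2 /sum3 !z.
  by rewrite lerDl mulr_ge0 //; have /andP[] := psi01 W x.
by rewrite psi1 ?(ltW h2) // mul1r lerDr.
Qed.

Let zgrad x : sum3 (fun i => partial i (zeta W) x ^+ 2) <= 3 * L ^+ 2 * psi W x.
Proof. exact: zeta_gradient. Qed.

Let dz j i x : partial j (zfield i) x =
  partial j (zeta W) x * tfield i x + zeta W x * partial j (tfield i) x.
Proof. by apply: partial_val; rewrite /zfield; apply: pD_mul; exact: smth_pD. Qed.

Let rotm_zfield i x : rotm h zfield i x =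
  zeta W x * Defs.rot chi i x + cross (fun k => partial k (zeta W) x) (fun k => tfield k x) i.
Proof.
rewrite -rotm_tfield; case: i => [|[|i]]; rewrite /rotm /Defs.rot /cross /=.
- rewrite (dz 1 2) (dz 2 1) /zfield; gen_atoms x h; gen_atoms x tfield; move: (zeta W x) => z; ring.
- rewrite (dz 2 0) (dz 0 2) /zfield; gen_atoms x h; gen_atoms x tfield; move: (zeta W x) => z; ring.
- rewrite (dz 0 1) (dz 1 0) /zfield; gen_atoms x h; gen_atoms x tfield; move: (zeta W x) => z; ring.
Qed.

Let divp_zfield x : divp h zfield x =
  zeta W x * divp h tfield x + sum3 (fun k => partial k (zeta W) x * tfield k x).
Proof.
rewrite /divp /gradp /sum3 (dz 0 0) (dz 1 1) (dz 2 2) /zfield.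
gen_atoms x h; gen_atoms x tfield; move: (zeta W x) => z; ring.
Qed.

Let cross_zeta x : sum3 (fun i => partial i (zeta W) x ^+ 2) * nrm2 tfield x <=
  3 * L ^+ 2 * (psi W x * nrm2 tfield x).
Proof.
by rewrite mulrA ler_wpM2r // /nrm2 /sum3 !addr_ge0 ?sqr_ge0.
Qed.

(** The field is cut off so that it lives in the ball of the barrier; the terms with grad zeta are
    paid for by Y. *)
Lemma twisted_friedrichs lam (m : pt R) (tau : R) : 0 < lam -> 0 < tau ->
  (forall x, W x < 3 -> rad m lam x < 1) ->
  (lam - tau) * J (nrm2 zfield) <= (1 + tau) * R0 + (1 + tau^-1) * (3 * L ^+ 2 * Y)
    + (1 / 2 + 25 * lam / (4 * tau)) * (2 * D0 + 2 * (3 * L ^+ 2 * Y)).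
Proof.
move=> lam0 tau0 hrad.
have szf i : smth (zfield i) by apply: smth_mul; [exact: sz|exact: st].
have bzf i : bsupp (zfield i) by apply: bsupp_mull; exact: bz.
have hq u x : 0 <= hessq h u x by exact: hessq_convex.
have dj x : (forall i, zfield i x = 0) \/ rad m lam x < 1.
  have [h3|h3] := leP 3 (W x); [left => i; by rewrite /zfield zeta0 // mul0r|right; exact: hrad].
apply: (le_trans (friedrichs_twisted lam0 sh szf bzf hq tau0 dj)).
have cR := cn srot brot; have cY := Cc_scale (3 * L ^+ 2) cpn.
have t1 : 0 <= 1 + tau^-1 by rewrite addr_ge0 // invr_ge0 ltW.
have crz : Cc (nrm2 (rotm h zfield)).
  by rewrite /nrm2 /sum3; under eq_fun do rewrite !rotm_zfield; rewrite /cross /=; cc.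
have cdz : Cc (fun x => divp h zfield x ^+ 2) by rewrite /divp /gradp /sum3; cc.
apply: lerD.
  rewrite /R0 /Y -(J_scale _ cpn) -(J_scale _ cR) -(J_scale _ cY).
  rewrite -(J_add (Cc_scale _ cR) (Cc_scale _ cY)).
  apply: J_le => //; first exact: Cc_add (Cc_scale _ cR) (Cc_scale _ cY).
  move=> x; rewrite /nrm2 /sum3 !rotm_zfield.
  apply: (le_trans (sum3_sqr_add (fun i => zeta W x * Defs.rot chi i x)
    (cross (fun k => partial k (zeta W) x) (fun k => tfield k x)) tau0)).
  apply: lerD; first by rewrite ler_pM2l ?addr_gt0 //; exact: sum3_scale (zeta01 W x).
  by apply: ler_wpM2l => //; apply: le_trans (cross_le _ _) (cross_zeta x).
have K0 : 0 <= 1 / 2 + 25 * lam / (4 * tau).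
  by rewrite addr_ge0 // divr_ge0 ?mulr_ge0 // ltW.
apply: ler_wpM2l => //; rewrite /D0 /Y -(J_scale _ cpn) -(J_scale _ cD) -(J_scale _ cY).
rewrite -(J_add (Cc_scale _ cD) (Cc_scale _ cY)).
apply: J_le => //; first exact: Cc_add (Cc_scale _ cD) (Cc_scale _ cY).
move=> x; have := sqr_add_le (zeta W x * divp h tfield x)
  (sum3 (fun k => partial k (zeta W) x * tfield k x)) ltr01.
rewrite -divp_zfield invr1 => h1; apply: (le_trans h1).
apply: lerD.
  rewrite -divp_tfield -[1 + 1]/2 ler_pM2l // exprMn ler_piMl ?sqr_ge0 //.
  by have /andP[z0 z1] := zeta01 W x; rewrite expr2 mulr_ile1.
rewrite -[1 + 1]/2 ler_pM2l //; apply: le_trans (cross_zeta x).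
exact: cauchy3.
Qed.

(** The Hardy inequality costs the weight |x - a|^2 <= 3 M^2 W^2. Where W > 1 the field chi
    vanishes, so the gradient of e^(-h) P is - e^(-h) v, and the decay W e^(-w W) <= 1 pays for the
    weight. *)
Lemma tscalar_collar : 2 * J (fun x => psi W x * tscalar x ^+ 2) <= 3 * M ^+ 2 * Y.
Proof.
have sp := smth_tscalar; have bp := bsupp_tscalar.
apply: (le_trans (hardy_collar sW cW W0 Wa sp bp)).
rewrite /Y -(J_scale _ cpn); apply: J_le; last 1 first; [move=> x|..].
- have [w1'|w1'] := leP (W x) 1; first by rewrite psi0 // !mul0r mulr0.
  have [p0 _] := andP (psi01 W x); rewrite [leRHS]mulrCA ler_wpM2l //.
  have c0 i : chi i x = 0 by have [//|e] := disj i x; move: w1'; rewrite e ltNge ler01.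
  set E := expR (- (w * W x)).
  have g i : partial i tscalar x ^+ 2 = E ^+ 2 * tfield i x ^+ 2.
    by have := tscalar_gradient i x; rewrite c0 sub0r -exprMn => <-; rewrite sqrrN.
  have -> : sum3 (fun i => partial i tscalar x ^+ 2) = E ^+ 2 * nrm2 tfield x.
    by rewrite /sum3 !g /nrm2 /sum3 !mulrDr.
  rewrite mulrA ler_wpM2r //; first by rewrite /nrm2 /sum3 !addr_ge0 ?sqr_ge0.
  apply: (@le_trans _ _ (3 * (M * W x) ^+ 2 * E ^+ 2)).
    by rewrite ler_wpM2r ?sqr_ge0 //; exact: euclid_sup (growth (ltW w1')).
  have ed : (W x * E) ^+ 2 <= 1.
    by rewrite expr2 mulr_ile1 ?mulr_ge0 ?expR_ge0 ?exp_decay.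
  have -> : 3 * (M * W x) ^+ 2 * E ^+ 2 = 3 * M ^+ 2 * (W x * E) ^+ 2 by ring.
  by rewrite ler_piMr // mulr_ge0 ?sqr_ge0.
- apply: smth_Cc; last by rewrite /sum3; apply: bsupp_mulr; apply: bsupp_mulr; bs.
  apply: smth_mul => //; rewrite /sum3; apply: smth_mul; last by sm.
  have sr i : smth (fun x => coord i (x - a) ^+ 2).
    under eq_fun do rewrite coordB; apply: smth_exp; apply: smth_add; first exact: smth_coord.
    exact: smth_cst.
  by repeat apply: smth_add; exact: sr.
- exact: Cc_scale.
Qed.

(** With p = e^(-h) P one has chi - grad (zeta p) = e^(-h) zeta v - p grad zeta; here e^(-h) <= 1,
    and the last term is a collar term. *)
Lemma gradient_distance tau : 0 < tau ->
  J (nrm2 (fun i x => chi i x - partial i (fun y => zeta W y * tscalar y) x)) <=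
  (1 + tau) * J (nrm2 zfield) + (1 + tau^-1) * (3 * L ^+ 2 * (3 * M ^+ 2 * Y)).
Proof.
move=> tau0; have sp := smth_tscalar; have bp := bsupp_tscalar.
have szf i : smth (zfield i) by apply: smth_mul; [exact: sz|exact: st].
have bzf i : bsupp (zfield i) by apply: bsupp_mull; exact: bz.
have cU := cn szf bzf.
have cp : Cc (fun x => psi W x * tscalar x ^+ 2) by cc.
have t1 : 0 <= 1 + tau^-1 by rewrite addr_ge0 // invr_ge0 ltW.
have cp2 := Cc_scale (3 * L ^+ 2) cp.
apply: (@le_trans _ _ ((1 + tau) * J (nrm2 zfield)
   + (1 + tau^-1) * (3 * L ^+ 2 * J (fun x => psi W x * tscalar x ^+ 2)))).
  rewrite -(J_scale _ cp) -(J_scale _ cU) -(J_scale _ cp2).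
  rewrite -(J_add (Cc_scale _ cU) (Cc_scale _ cp2)).
  apply: J_le; last 1 first; [move=> x|..].
  - have E i : chi i x - partial i (fun y => zeta W y * tscalar y) x =
        expR (- (w * W x)) * zfield i x + - (tscalar x * partial i (zeta W) x).
      have e : partial i (fun y => zeta W y * tscalar y) x =
          partial i (zeta W) x * tscalar x + zeta W x * partial i tscalar x.
        by apply: partial_val; apply: pD_mul; exact: smth_pD.
      have z : zeta W x * chi i x = chi i x.
        by have [->|e0] := disj i x; rewrite ?mulr0 // zeta1 ?mul1r // e0.
      have A (c d q t f u v : R) : c - d = u * f -> v * c = c ->
          c - (q * t + v * d) = u * (v * f) + - (t * q).
        by move=> h1 h2; rewrite [u * _]mulrCA -h1 mulrBr h2; ring.
      by rewrite e; apply: A z; exact: tscalar_gradient.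
    rewrite /nrm2 /sum3 !E; apply: (le_trans (sum3_sqr_add
      (fun i => expR (- (w * W x)) * zfield i x) (fun i => - (tscalar x * partial i (zeta W) x)) tau0)).
    apply: lerD.
      rewrite ler_pM2l ?addr_gt0 //; apply: sum3_scale.
      by rewrite expR_ge0 -expR0 ler_expR oppr_le0 mulr_ge0.
    have B (t r z0 z1 z2 k : R) : z0 ^+ 2 + z1 ^+ 2 + z2 ^+ 2 <= k * r ->
        (- (t * z0)) ^+ 2 + (- (t * z1)) ^+ 2 + (- (t * z2)) ^+ 2 <= k * (r * t ^+ 2).
      by move=> H; rewrite !sqrrN !exprMn -!mulrDr mulrC mulrA ler_wpM2r // sqr_ge0.
    exact: ler_wpM2l t1 _ _ (B _ _ _ _ _ _ (zgrad x)).
  - have sq : smth (fun y => zeta W y * tscalar y) by exact: smth_mul.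
    have bq : bsupp (fun y => zeta W y * tscalar y) by apply: bsupp_mulr.
    by apply: cn => i; [sm|bs].
  - exact: Cc_add (Cc_scale _ cU) (Cc_scale _ cp2).
rewrite lerD2l; apply: ler_wpM2l => //; apply: ler_wpM2l; first by rewrite mulr_ge0 ?sqr_ge0.
apply: le_trans tscalar_collar; rewrite ler_peMl //; last by rewrite ler1n.
by apply: J_ge0 => x; rewrite mulr_ge0 ?sqr_ge0 //; have /andP[] := psi01 W x.
Qed.

End TwistedField.

(** * Approximation of test fields by gradients *)

Section GradientApproximation.
Variable R : realType.

(* First the error e of the divergence, then the target y for the collar mass Y, and
   only then the slope w of the weight. *)
Lemma parameter_choice (lam tau M L R0 : R) : 0 < tau <= 1 -> tau < lam -> 0 < M -> 0 < L ->
  0 <= R0 -> exists e w, [/\ 0 < e, 1 <= w & forall X U Y Z E : R, 0 <= Y -> 0 <= E -> E <= e ->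
  2 * w * Y <= 3 * M ^+ 2 * ((3 * L * M + 3 * M + 3 * M ^+ 2) * X + (R0 + E)) ->
  (lam - tau) * U <= (1 + tau) * R0 + (1 + tau^-1) * (3 * L ^+ 2 * Y)
    + (1 / 2 + 25 * lam / (4 * tau)) * (2 * E + 2 * (3 * L ^+ 2 * Y)) ->
  X <= U + Y ->
  Z <= (1 + tau) * U + (1 + tau^-1) * (3 * L ^+ 2 * (3 * M ^+ 2 * Y)) ->
  (lam - tau) * Z <= (1 + 3 * tau) * R0 + tau].
Proof.
move=> /andP[t0 t1] tl M0 L0 R00; have lam0 := lt_trans t0 tl.
have mu0 : 0 < lam - tau by rewrite subr_gt0.
have A0 : 0 < 3 * M ^+ 2 by rewrite mulr_gt0 // exprn_gt0.
have b0 : 0 < 3 * L ^+ 2 by rewrite mulr_gt0 // exprn_gt0.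
have C0 : 0 < 3 * L * M + 3 * M + 3 * M ^+ 2 by rewrite !addr_gt0 // ?mulr_gt0 // exprn_gt0.
have T0 : 0 < 1 + tau^-1 by rewrite addr_gt0 // invr_gt0.
have K0 : 0 < 1 / 2 + 25 * lam / (4 * tau) by rewrite addr_gt0 // divr_gt0 // mulr_gt0.
move: A0 b0 C0 T0 K0 mu0.
set A := 3 * M ^+ 2; set b := 3 * L ^+ 2; set C := _ + _ + A; set T := 1 + _; set K := 1 / 2 + _.
set mu := lam - tau; clearbody A b C T K mu => A0 b0 C0 T0 K0 mu0.
have t2 : 0 < tau / 2 by rewrite divr_gt0.
have c10 : 0 < 2 * (T * b) + 4 * (K * b) + mu * (T * (b * A)).
  by rewrite !addr_gt0 // ?mulr_gt0 // !mulr_gt0.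
have [e /andP[e0 e1] he] := small_pos (ltW (mulr_gt0 (ltr0n R 4) K0)) t2.
have [y /andP[y0 y1] hy] := small_pos (ltW c10) t2.
pose c3 := A * (C * (T * b + 2 * (K * b) + mu)).
pose c4 := A * (C * (2 * R0 + 2 * K) + mu * (R0 + 1)).
have c30 : 0 < c3 by rewrite !mulr_gt0 // !addr_gt0 // ?mulr_gt0 // mulr_gt0.
have c40 : 0 < c4.
  rewrite mulr_gt0 // addr_gt0 // mulr_gt0 //.
    by rewrite ltr_wpDl ?mulr_ge0 // mulr_gt0.
  by rewrite ltr_wpDl.
(* The bound on the collar mass reads 2 w mu Y <= c3 Y + c4; with this w the left side is at least
   (c3 + c4 / y) Y, which forces Y <= y. *)
pose w := 1 + (c3 + c4 / y) / (2 * mu).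
have w1 : 1 <= w by rewrite lerDl divr_ge0 ?mulr_ge0 ?(ltW mu0) // addr_ge0 ?divr_ge0 // ltW.
exists e, w; split => // X U Y Z E Y0 E0 Ee ha hb hc hd.
have E1 : E <= 1 by exact: le_trans e1.
have tR : tau * R0 <= R0 by rewrite ler_piMl.
have muU : mu * U <= 2 * R0 + T * b * Y + (2 * K + 2 * (K * b) * Y).
  have : K * E <= K by rewrite ler_piMr // ltW.
  by move: hb tR; clear; lra.
have Yy : Y <= y.
  have k1 : mu * (2 * w * Y) <= c3 * Y + c4.
    apply: (@le_trans _ _ (A * (C * (mu * (U + Y)) + mu * (R0 + 1)))).
      have := ha; rewrite -(ler_pM2l mu0) => /le_trans; apply.
      rewrite mulrCA ler_pM2l // mulrDr [mu * (C * _)]mulrCA; apply: lerD.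
        by rewrite !ler_pM2l.
      by rewrite ler_pM2l // lerD2l.
    rewrite /c3 /c4 -!mulrA -mulrDr ler_pM2l //.
    have : C * (mu * (U + Y)) <= C * (2 * R0 + T * b * Y + (2 * K + 2 * (K * b) * Y) + mu * Y).
      by rewrite ler_pM2l // mulrDr lerD2r.
    by clear; lra.
  have k2 : (c3 + c4 / y) * Y <= mu * (2 * w * Y).
    rewrite mulrA ler_wpM2r // /w mulrCA mulrDr mulr1 [_ / (2 * mu)]mulrC.
    have -> : 2 * (mu + mu * ((2 * mu)^-1 * (c3 + c4 / y))) = 2 * mu + (c3 + c4 / y).
      by field; rewrite !gt_eqF.
    by rewrite lerDr mulr_ge0 // ltW.
  have k3 : c4 / y * Y <= c4 by move: k1 k2; clear; lra.
  by move: k3; rewrite mulrAC ler_pdivrMr // ler_pM2l.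
have muZ : mu * Z <= (1 + tau) * (mu * U) + mu * (T * (b * A)) * Y.
  by have := hd; rewrite -(ler_pM2l mu0) => /le_trans; apply; rewrite le_eqVlt; apply/orP; left;
    apply/eqP; ring.
have hB : (1 + tau) * (mu * U) <= (1 + tau) * ((1 + tau) * R0 + T * (b * Y) + K * (2 * E + 2 * (b * Y))).
  by rewrite ler_pM2l // addr_gt0.
have s1 : (1 + tau) * ((1 + tau) * R0) <= (1 + 3 * tau) * R0.
  have : tau * (tau * R0) <= tau * R0 by rewrite ler_pM2l.
  by clear; lra.
have s2 : (1 + tau) * (T * (b * Y) + K * (2 * E + 2 * (b * Y))) <=
    2 * (T * (b * Y) + K * (2 * E + 2 * (b * Y))).
  rewrite ler_wpM2r; [by []| |by move: t1; clear; lra].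
  by rewrite !(addr_ge0, mulr_ge0) // ltW.
have s3 : (2 * (T * b) + 4 * (K * b) + mu * (T * (b * A))) * Y <= tau / 2.
  by apply: le_trans hy; rewrite ler_pM2l.
have s4 : 4 * K * E <= tau / 2 by apply: le_trans he; rewrite ler_pM2l // mulr_gt0.
by move: muZ hB s1 s2 s3 s4; clear; lra.
Qed.

Lemma test_fun_smth (O : set (pt R)) f : test_fun O f -> smth f.
Proof. by case=> /smooth_Ck. Qed.

Lemma test_fun_bsupp (O : set (pt R)) (D : R) f : (forall x, O x -> `|x| <= D) -> test_fun O f ->
  bsupp f.
Proof.
move=> bO [_ [K [_ KO fK]]]; exists D => x hx; apply: fK => /KO /bO.
by rewrite leNgt hx.
Qed.

Theorem gradient_approx (O : set (pt R)) (D lam tau : R) (m : pt R) (chi : vfield R) :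
  open O -> convex_set3 O -> O !=set0 -> (forall x, O x -> `|x| <= D) -> 0 < lam ->
  (forall x, O x -> rad m lam x < 1) -> test_field O chi -> 0 < tau <= 1 -> tau < lam ->
  exists2 p, test_fun O p &
    (lam - tau) * J (nrm2 (fun i x => chi i x - partial i p x)) <=
    (1 + 3 * tau) * J (nrm2 (Defs.rot chi)) + tau.
Proof.
move=> oO cO [a Oa] bO lam0 hrad tchi tau01 tl; have /andP[tau0 tau1] := tau01.
(* [test_field] speaks of the indices 0, 1, 2, whereas the smoothness hypotheses of the estimates
   range over all indices. *)
pose ch : vfield R := fun i => if (i < 3)%N then chi i else fun=> 0.
have sc i : smth (ch i).
  by rewrite /ch; case: ifP => [/tchi /test_fun_smth //|_]; exact: smth_cst.
have bc i : bsupp (ch i).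
  by rewrite /ch; case: ifP => [/tchi /(test_fun_bsupp bO) //|_]; exists 0.
have [K0 [cK0 KO0 f0]] := (tchi 0%N isT).2; have [K1 [cK1 KO1 f1]] := (tchi 1%N isT).2.
have [K2 [cK2 KO2 f2]] := (tchi 2%N isT).2.
(* The point a makes K nonempty even for chi = 0 and serves as the origin of the radial estimates in
   the collar. *)
pose K := [set a] `|` (K0 `|` (K1 `|` K2)).
have cK : compact K by apply: compactU; [exact: compact_set1|apply: compactU => //; exact: compactU].
have KO : K `<=` O by move=> x [->//|[/KO0//|[/KO1//|/KO2//]]].
have Ka : K a by left.
have [W [M [K' [sW cW W0 WK [M0 dW ddW [cK' KO' hK'] growth]]]]] := convex_weight oO cO bO cK KO Ka.
have disj i x : ch i x = 0 \/ W x = 0.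
  have [Kx|nK] := pselect (K x); first by right; exact: WK.
  left; rewrite /ch; case: i => [|[|[|i]]] //=.
  - by apply: f0 => h; apply: nK; right; left.
  - by apply: f1 => h; apply: nK; right; right; left.
  - by apply: f2 => h; apply: nK; right; right; right.
have bW : exists r, forall x, r < `|x| -> 3 <= W x.
  exists D => x hx; rewrite leNgt; apply/negP => /ltW /hK' /KO' /bO.
  by rewrite leNgt hx.
have [L L0 hL] := cutoff_gradient sW bW.
have R0 : 0 <= J (nrm2 (Defs.rot ch)).
  by apply: J_ge0 => x; rewrite /nrm2 /sum3 !addr_ge0 ?sqr_ge0.
have [e [w [e0 w1 H]]] := parameter_choice tau01 tl M0 L0 R0.
have sq := smth_tpot w sW; have q0 := tpot_ge0 sW cW w1.
have [P [sP bP hP]] := Hop_dense sq q0 sc bc e0.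
exists (fun x => zeta W x * tscalar W P w x).
  split.
    apply/smooth_Ck; apply: smth_mul; [exact: smth_zeta|exact: smth_tscalar].
  exists K'; split => // x nK; rewrite zeta0 ?mul0r // leNgt; apply/negP => /ltW /hK'.
  exact: nK.
have -> : nrm2 (Defs.rot chi) = nrm2 (Defs.rot ch) by [].
have hr x : W x < 3 -> rad m lam x < 1 by move=> /ltW /hK' /KO' /hrad.
have Wa := WK a Ka.
have ha := twisted_collar sW cW W0 sc bc disj sP bP w1 Wa M0 L0 dW ddW growth hL.
have hb := twisted_friedrichs sW cW W0 sc bc disj sP bP w1 bW hL lam0 tau0 hr.
have hc := twisted_split w sW sc bc sP bP bW.
have hd := gradient_distance sW cW W0 sc bc disj sP bP w1 Wa growth bW hL tau0.
apply: H _ _ hP ha hb hc hd.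
- apply: J_ge0 => x; rewrite mulr_ge0 //; first by have /andP[] := psi01 W x.
  by rewrite /nrm2 /sum3 !addr_ge0 ?sqr_ge0.
- by apply: J_ge0 => x; exact: sqr_ge0.
Qed.

End GradientApproximation.

(** * An upper bound for pi *)

Section PiBound.
Variable R : realType.

Lemma derive_ge0_le (F dF : R -> R) (x : R) : (forall t, is_derive t (1 : R) F (dF t)) ->
  (forall t, 0 <= t -> 0 <= dF t) -> 0 <= x -> F 0 <= F x.
Proof.
move=> H dF0 x0; have cF : {within `[0, x], continuous F}.
  by apply: continuous_subspaceT => t; exact: (is_derive_continuous (H t)).
have [c] := MVT_segment x0 (fun t _ => H t) cF.
rewrite in_itv /= => /andP[c0 _] e; rewrite -subr_ge0 e subr0 mulr_ge0 //; exact: dF0.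
Qed.

(** Four successive integrations, starting from cos <= 1. *)
Lemma cos_upper (x : R) : 0 <= x -> cos x <= 1 - x ^+ 2 / 2 + x ^+ 4 / 24.
Proof.
have s1 (t : R) : 0 <= t -> sin t <= t.
  move=> t0; have := @derive_ge0_le (fun t => t - sin t) (fun t => 1 - cos t) t.
  rewrite sin0 subrr subr_ge0; by apply => // u; rewrite ?subr_ge0 ?cos_le1.
have c1 (t : R) : 0 <= t -> 1 - t ^+ 2 / 2 <= cos t.
  move=> t0; have := @derive_ge0_le (fun t => cos t - (1 - t ^+ 2 / 2)) (fun t => t - sin t) t.
  rewrite cos0 expr0n /= mul0r subr0 subrr subr_ge0; apply => // u; last by rewrite subr_ge0; exact: s1.
  by apply: is_derive_eq; rewrite /GRing.scale /=; field.
have s2 (t : R) : 0 <= t -> t - t ^+ 3 / 6 <= sin t.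
  move=> t0; have := @derive_ge0_le (fun t => sin t - (t - t ^+ 3 / 6))
    (fun t => cos t - (1 - t ^+ 2 / 2)) t.
  rewrite sin0 expr0n /= mul0r !subr0 subr_ge0; apply => // u; last by rewrite subr_ge0; exact: c1.
  by apply: is_derive_eq; rewrite /GRing.scale /=; field.
move=> x0; have := @derive_ge0_le (fun t => (1 - t ^+ 2 / 2 + t ^+ 4 / 24) - cos t)
  (fun t => sin t - (t - t ^+ 3 / 6)) x.
rewrite cos0 !expr0n /= !mul0r subr0 addr0 subrr subr_ge0; apply => // u; last first.
  by rewrite subr_ge0; exact: s2.
by apply: is_derive_eq; rewrite /GRing.scale /=; field.
Qed.

(** The polynomial of [cos_upper] is negative at 8 / 5, which therefore exceeds pi / 2. *)
Lemma pi_upper : pi <= 16 / 5 :> R.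
Proof.
rewrite leNgt; apply/negP => h.
have h2 : 8 / 5 <= pi / 2 :> R by lra.
have : 0 <= cos (8 / 5 : R) by apply: cos_ge0_pihalf; apply/andP; split; lra.
by have := @cos_upper (8 / 5); lra.
Qed.

End PiBound.

(** * The Friedrichs inequality in a slab *)

Section Friedrichs.
Variable R : realType.
Implicit Types (f g p : pt R -> R) (x : pt R).

Lemma Ck_sin_cos k f : Ck k f -> Ck k (fun x => sin (f x)) /\ Ck k (fun x => cos (f x)).
Proof.
elim: k f => [|k IH] f Hf.
  split; split => // x; apply: continuous_comp; try exact: (Ck_cont Hf).
    exact: continuous_sin.
  exact: continuous_cos.
have [s c] := IH f (CkSW Hf).
split.
  apply: (@Ck_intro _ _ _ (fun i x => cos (f x) * partial i f x)).
  - move=> x; apply: (@continuous_comp _ _ _ f sin); first exact: (Ck_cont Hf).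
    exact: continuous_sin.
  - by move=> i x; apply: (@pD_comp R i sin); apply: Ck_pD; eassumption.
  - by move=> i; apply: Ck_mul => //; exact: Ck_partial.
apply: (@Ck_intro _ _ _ (fun i x => - sin (f x) * partial i f x)).
- move=> x; apply: (@continuous_comp _ _ _ f cos); first exact: (Ck_cont Hf).
  exact: continuous_cos.
- by move=> i x; apply: (@pD_comp R i cos); apply: Ck_pD; eassumption.
- by move=> i; apply: Ck_mul; [exact: Ck_opp|exact: Ck_partial].
Qed.

Variables (i : nat) (l k : R).
Hypotheses (i3 : (i < 3)%N) (l0 : 0 < l) (k0 : 0 < k) (kl : k * l < pi).

Let th x := k * (coord i x - l / 2).
Let cmin := cos (k * (l / 2)).

Let cmin0 : 0 < cmin.
Proof.
apply: cos_gt0_pihalf; have : 0 < k * l by rewrite mulr_gt0.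
by move: kl; have := pi_gt0 R => a b c; apply/andP; split; lra.
Qed.

(* A positive smooth function that coincides with cos (th x) on the slab 0 < x_i < l. *)
Let den x := cos (th x) * sstep 0 cmin (cos (th x)) + (1 - sstep 0 cmin (cos (th x))).

Let den0 x : 0 < den x.
Proof.
rewrite /den; have /andP[s0 s1] := sstep01 (cos (th x)) cmin0.
have [h|h] := leP (cos (th x)) 0; first by rewrite sstep0 // mulr0 add0r subr0.
move: (sstep _ _ _) s0 s1 => s s0 s1.
have [->|sn] := eqVneq s 0; first by rewrite mulr0 add0r subr0.
by rewrite ltr_pwDl ?subr_ge0 // mulr_gt0 // lt_neqAle eq_sym sn.
Qed.

Let sth : smth th.
Proof.
rewrite /th; apply: smth_mul; first exact: smth_cst.
by apply: smth_add; [exact: smth_coord|exact: smth_cst].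
Qed.

Let scos : smth (fun x => cos (th x)). Proof. by move=> m; have [] := Ck_sin_cos (sth m). Qed.
Let ssin : smth (fun x => sin (th x)). Proof. by move=> m; have [] := Ck_sin_cos (sth m). Qed.

Let sden : smth den.
Proof.
have s := smth_sstep cmin0 scos; rewrite /den.
by apply: smth_add; [exact: smth_mul|apply: smth_add; [exact: smth_cst|exact: smth_opp]].
Qed.

Let slab x : 0 < coord i x < l -> cmin < cos (th x).
Proof.
move=> /andP[x0 x1]; have kl0 : 0 < k * l by rewrite mulr_gt0.
have a0 : `|th x| < k * (l / 2).
  rewrite /th normrM gtr0_norm // ltr_pM2l // ltr_norml.
  by apply/andP; split; lra.
have a1 : k * (l / 2) <= pi by move: kl kl0 (pi_gt0 R); lra.
have m1 : `|th x| \in `[0, pi] by rewrite in_itv /= normr_ge0 ltW // (lt_le_trans a0).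
have m2 : k * (l / 2) \in `[0, pi] by rewrite in_itv /= a1 mulr_ge0 ?divr_ge0 // ltW.
by rewrite -(cos_norm (th x)) /cmin ltr_cos.
Qed.

Let X x := k * sin (th x) * (den x)^-1.

Let sX : smth X.
Proof.
have si : smth (fun x => (den x)^-1) by apply: smth_inv => // x; rewrite gt_eqF.
by rewrite /X; apply: smth_mul => //; apply: smth_mul => //; exact: smth_cst.
Qed.

Let dX x : 0 < coord i x < l -> partial i X x = k ^+ 2 + X x ^+ 2.
Proof.
move=> hx; have hc := slab hx; have c0 : 0 < cos (th x) by exact: lt_trans hc.
have nd y : cmin < cos (th y) -> den y = cos (th y).
  by move=> h; rewrite /den sstep1 ?(ltW h) // mulr1 subrr addr0.
have e0 : 0 < cos (th x) - cmin by rewrite subr_gt0.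
have [d d0 hd] := continuous_near x (smth_cont scos) e0.
rewrite (@partial_near _ i X (fun y => k * sin (th y) * (cos (th y))^-1) x); last first.
  apply/near_pt; exists d => // y /hd hy; rewrite /X nd //.
  by have := ler_norm (- (cos (th y) - cos (th x))); rewrite normrN; lra.
have pth : pD i th x k.
  have := pD_mul (@pD_cst R i k x) (pD_add (smth_pD i x (smth_coord R i)) (@pD_cst R i (- (l / 2)) x)).
  by rewrite partial_coord // eqxx addr0 mulr1 mul0r add0r.
have ps : pD i (fun y => sin (th y)) x (cos (th x) * k) by exact: (pD_comp (is_derive_sin (th x)) pth).
have pc : pD i (fun y => cos (th y)) x (- sin (th x) * k) by exact: (pD_comp (is_derive_cos (th x)) pth).
have cn : cos (th x) != 0 by rewrite gt_eqF.
have := partial_val (pD_mul (pD_mul (@pD_cst R i k x) ps) (pD_inv cn pc)).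
rewrite /X nd // => ->; move: (cos _) (sin _) cn => c s cn.
by field.
Qed.

(* (d_i p)^2 - k^2 p^2 = (d_i p + X p)^2 - d_i (X p^2), since X' = k^2 + X^2 on the slab. *)
Lemma friedrichs_slab_lt p : smth p -> bsupp p -> (forall x, p x = 0 \/ 0 < coord i x < l) ->
  k ^+ 2 * J (fun x => p x ^+ 2) <= J (fun x => partial i p x ^+ 2).
Proof.
move=> sp bp hp; have c1 : Cc (fun x => p x ^+ 2) by cc.
have c2 : Cc (fun x => partial i p x ^+ 2) by cc.
pose T x := X x * (p x * p x).
have sT : smth T by rewrite /T; apply: smth_mul => //; exact: smth_mul.
have bT : bsupp T by rewrite /T; bs.
have cT := Cc_partial i bT (sT 1%N).
rewrite -(J_scale _ c1) -[leRHS]addr0 -(J_partial i3 bT (sT 2%N)) -(J_add c2 cT).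
apply: J_le; [exact: Cc_scale|exact: Cc_add|move=> x].
have -> : partial i T x = partial i X x * (p x * p x) + X x * (partial i p x * p x + p x * partial i p x).
  by apply: partial_val; rewrite /T; apply: pD_mul; [|apply: pD_mul]; exact: smth_pD.
have [->|hx] := hp x; first by rewrite expr0n /= !(mulr0, mul0r, addr0) sqr_ge0.
rewrite dX //; move: (X x) (partial i p x) (p x) => u q r; rewrite -subr_ge0.
set z := (X in 0 <= X); have -> : z = (q + u * r) ^+ 2 by rewrite /z; ring.
exact: sqr_ge0.
Qed.

End Friedrichs.

(** The frequency k tends to pi / l from below; as long as k l < pi, the cosine is bounded away from
    0 on the slab. *)
Lemma friedrichs_slab (R : realType) (i : nat) (l : R) (p : pt R -> R) : (i < 3)%N -> 0 < l ->
  smth p -> bsupp p -> (forall x, p x = 0 \/ 0 < coord i x < l) ->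
  pi ^+ 2 / l ^+ 2 * J (fun x => p x ^+ 2) <= J (fun x => partial i p x ^+ 2).
Proof.
move=> i3 l0 sp bp hp; apply/ler_addgt0Pr => e e0.
set A := J _; set B := J _; have pi0 := pi_gt0 R.
have A0 : 0 <= pi ^+ 2 / l ^+ 2 * A.
  by rewrite mulr_ge0 ?divr_ge0 ?sqr_ge0 //; apply: J_ge0 => x; exact: sqr_ge0.
have [d /andP[d0 d1] hd] := small_pos (mulr_ge0 (ler0n R 2) A0) e0.
pose k := (1 - d / 2) * pi / l.
have d2 : 0 < 1 - d / 2 by lra.
have k0 : 0 < k by rewrite divr_gt0 // mulr_gt0.
have kl : k * l < pi by rewrite divfK ?gt_eqF // gtr_pMl //; lra.
have := friedrichs_slab_lt i3 l0 k0 kl sp bp hp; rewrite -/A -/B.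
have -> : k ^+ 2 * A = (1 - d / 2) ^+ 2 * (pi ^+ 2 / l ^+ 2 * A).
  by rewrite /k; field; rewrite gt_eqF.
have : 0 <= (d / 2) ^+ 2 * (pi ^+ 2 / l ^+ 2 * A) by rewrite mulr_ge0 ?sqr_ge0.
by move: hd A0; move: (pi ^+ 2 / _ * A) => a; clear -d0; nra.
Qed.

(** * Jung's theorem by maximising the variance *)

Section Jung.
Variables (R : realType) (O : set (pt R)).
Implicit Types (f g : pt R -> R) (x y : pt R).

(* Expectations with respect to probability measures on O; only their linearity and
   positivity matter. *)
Definition state (E : (pt R -> R) -> R) :=
  [/\ forall f g, E (fun x => f x + g x) = E f + E g,
      forall c f, E (fun x => c * f x) = c * E f,
      forall f, (forall x, O x -> 0 <= f x) -> 0 <= E f & E (fun=> 1) = 1].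

Lemma state_sum E (s : seq (R * (pt R -> R))) : state E ->
  E (fun x => \sum_(p <- s) p.1 * p.2 x) = \sum_(p <- s) p.1 * E p.2.
Proof.
move=> [ad sc _ _]; elim: s => [|p s IH].
  under eq_fun do rewrite big_nil; rewrite big_nil.
  by have := sc 0 (fun=> 0); rewrite !mul0r.
by under eq_fun do rewrite big_cons; rewrite ad sc IH big_cons.
Qed.

Lemma state_eval x : O x -> state (fun f => f x).
Proof. by move=> Ox; split => // f; exact. Qed.

Lemma state_mix E F (t : R) : 0 <= t <= 1 -> state E -> state F ->
  state (fun f => (1 - t) * E f + t * F f).
Proof.
move=> /andP[t0 t1] [a1 b1 c1 d1] [a2 b2 c2 d2]; split.
- by move=> f g; rewrite a1 a2; ring.
- by move=> c f; rewrite b1 b2; ring.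
- by move=> f h; rewrite addr_ge0 // mulr_ge0 ?subr_ge0 ?c1 ?c2.
- by rewrite d1 d2; ring.
Qed.

Definition variance3 (E : (pt R -> R) -> R) :=
  E (fun x => sum3 (fun i => coord i x ^+ 2)) - sum3 (fun i => E (@coord R i) ^+ 2).

Definition center (E : (pt R -> R) -> R) : pt R :=
  ((E (@coord R 0), E (@coord R 1)), E (@coord R 2)).

Definition dist2 x y : R := sum3 (fun i => (coord i x - coord i y) ^+ 2).

(** The first variation at E in the direction of a point mass: the variance changes at the rate |x -
    center|^2 - variance, which cannot be large for a near maximiser. *)
Lemma variance3_mix E x (t : R) : state E ->
  variance3 (fun f => (1 - t) * E f + t * f x) =
  (1 - t) * variance3 E + t * (1 - t) * dist2 x (center E).
Proof.
move=> _; rewrite /variance3 /dist2 /center /sum3 /coord /=.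
move: (E _) (E _) (E _) (E _) (x.1.1) (x.1.2) (x.2) => q m0 m1 m2 x0 x1 x2; ring.
Qed.

Lemma variance_center E : state E -> E (fun x => dist2 x (center E)) = variance3 E.
Proof.
move=> hE; have [ad sc _ e1] := hE.
pose s := [:: (1, fun x => sum3 (fun i => coord i x ^+ 2));
  (- (2 * E (@coord R 0)), @coord R 0); (- (2 * E (@coord R 1)), @coord R 1);
  (- (2 * E (@coord R 2)), @coord R 2); (sum3 (fun i => E (@coord R i) ^+ 2), fun=> 1)].
have -> : (fun x => dist2 x (center E)) = fun x => \sum_(p <- s) p.1 * p.2 x.
  apply/funext => x; rewrite /s !big_cons big_nil /dist2 /center /sum3 /coord /=; ring.
by rewrite state_sum // /s !big_cons big_nil /variance3 e1 /sum3 /=; ring.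
Qed.

(* With c = <x - m, y - m> the product (rho - c) (c - (|x-m|^2 + |y-m|^2 - dd) / 2) is
   nonnegative on O; its average in x and y bounds the square of the covariance matrix. *)
Lemma variance_bound E (rho dd : R) : state E -> (forall x y, O x -> O y -> dist2 x y <= dd) ->
  (forall x, O x -> dist2 x (center E) <= rho) ->
  variance3 E ^+ 2 <= 3 * (rho * (dd / 2 - variance3 E)).
Proof.
move=> hE hdd hrho; have [ad sc pos e1] := hE.
pose a i x := coord i x - coord i (center E).
pose r x := dist2 x (center E).
have rE x : r x = a 0%N x ^+ 2 + a 1%N x ^+ 2 + a 2%N x ^+ 2 by [].
pose S i j := E (fun x => a i x * a j x).
have a0 i : (i < 3)%N -> E (a i) = 0.
  move=> hi; have -> : a i = fun x => coord i x + (- coord i (center E)) * 1.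
    by apply/funext => x; rewrite mulr1.
  rewrite ad sc e1 mulr1; apply/eqP; rewrite subr_eq0; apply/eqP.
  by case: i hi => [|[|[|]]].
have VE : variance3 E = E r by rewrite -variance_center.
have VS : E r = S 0%N 0%N + S 1%N 1%N + S 2%N 2%N.
  by rewrite /S -!ad; congr E; apply/funext => x; rewrite rE -!expr2.
pose c x y := a 0%N x * a 0%N y + a 1%N x * a 1%N y + a 2%N x * a 2%N y.
pose F x y := (rho - c x y) * (c x y - (r x + r y - dd) / 2).
have dE x y : dist2 x y = r x + r y - 2 * c x y.
  by rewrite !rE /c /a /dist2 /sum3; ring.
(* From |x - y|^2 >= 0 one gets c <= (r x + r y) / 2 <= rho; the second factor is the bound |x -
   y|^2 <= dd. *)
have F0 x y : O x -> O y -> 0 <= F x y.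
  move=> Ox Oy; have h1 := hdd _ _ Ox Oy; have h2 := hrho _ Ox; have h3 := hrho _ Oy.
  have h4 : 0 <= dist2 x y by rewrite /dist2 /sum3 !addr_ge0 ?sqr_ge0.
  rewrite -/(r x) -/(r y) dE in h1 h2 h3 h4.
  by rewrite mulr_ge0 // ?subr_ge0; move: h1 h2 h3 h4; move: (c x y) (r x) (r y); clear => *; lra.
have EF x : E (F x) = rho * (dd / 2) - rho / 2 * r x - rho / 2 * E r
   - (a 0%N x * a 0%N x * S 0%N 0%N + a 1%N x * a 1%N x * S 1%N 1%N + a 2%N x * a 2%N x * S 2%N 2%N
      + 2 * (a 0%N x * a 1%N x) * S 0%N 1%N + 2 * (a 0%N x * a 2%N x) * S 0%N 2%N
      + 2 * (a 1%N x * a 2%N x) * S 1%N 2%N)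
   + (a 0%N x * E (fun y => a 0%N y * r y) + a 1%N x * E (fun y => a 1%N y * r y)
      + a 2%N x * E (fun y => a 2%N y * r y)) / 2.
  pose s := [:: (rho * (dd / 2) - rho / 2 * r x, fun=> 1); (- (rho / 2), r);
    ((rho + r x / 2 - dd / 2) * a 0%N x, a 0%N); ((rho + r x / 2 - dd / 2) * a 1%N x, a 1%N);
    ((rho + r x / 2 - dd / 2) * a 2%N x, a 2%N);
    (- (a 0%N x * a 0%N x), fun y => a 0%N y * a 0%N y);
    (- (a 1%N x * a 1%N x), fun y => a 1%N y * a 1%N y);
    (- (a 2%N x * a 2%N x), fun y => a 2%N y * a 2%N y);
    (- (2 * (a 0%N x * a 1%N x)), fun y => a 0%N y * a 1%N y);
    (- (2 * (a 0%N x * a 2%N x)), fun y => a 0%N y * a 2%N y);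
    (- (2 * (a 1%N x * a 2%N x)), fun y => a 1%N y * a 2%N y);
    (a 0%N x / 2, fun y => a 0%N y * r y); (a 1%N x / 2, fun y => a 1%N y * r y);
    (a 2%N x / 2, fun y => a 2%N y * r y)].
  have -> : F x = fun y => \sum_(p <- s) p.1 * p.2 y.
    apply/funext => y; rewrite /s !big_cons big_nil /F /c /=.
    move: (a 0%N x) (a 1%N x) (a 2%N x) (a 0%N y) (a 1%N y) (a 2%N y) (r x) (r y).
    by clear => *; field.
  rewrite state_sum // /s !big_cons big_nil /= e1 !a0 // /S.
  move: (E _) (E _) (E _) (E _) (E _) (E _) (E _) (E _) (E _) (E _).
  by move: (a 0%N x) (a 1%N x) (a 2%N x) (r x); clear => *; field.
pose G x := E (F x).
have G0 : 0 <= E G by apply: (pos) => x Ox; apply: (pos) => y Oy; exact: F0.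
have EG : E G = rho * (dd / 2) - rho * E r - (S 0%N 0%N ^+ 2 + S 1%N 1%N ^+ 2 + S 2%N 2%N ^+ 2
    + 2 * S 0%N 1%N ^+ 2 + 2 * S 0%N 2%N ^+ 2 + 2 * S 1%N 2%N ^+ 2).
  pose q i := E (fun y => a i y * r y).
  pose s := [:: (rho * (dd / 2) - rho / 2 * E r, fun=> 1); (- (rho / 2), r);
    (- S 0%N 0%N, fun y => a 0%N y * a 0%N y); (- S 1%N 1%N, fun y => a 1%N y * a 1%N y);
    (- S 2%N 2%N, fun y => a 2%N y * a 2%N y);
    (- (2 * S 0%N 1%N), fun y => a 0%N y * a 1%N y);
    (- (2 * S 0%N 2%N), fun y => a 0%N y * a 2%N y);
    (- (2 * S 1%N 2%N), fun y => a 1%N y * a 2%N y);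
    (q 0%N / 2, a 0%N); (q 1%N / 2, a 1%N); (q 2%N / 2, a 2%N)].
  have -> : G = fun y => \sum_(p <- s) p.1 * p.2 y.
    apply/funext => x; rewrite /G EF /s !big_cons big_nil /= -!/(q _).
    move: (q 0%N) (q 1%N) (q 2%N) (S 0%N 0%N) (S 1%N 1%N) (S 2%N 2%N) (S 0%N 1%N) (S 0%N 2%N)
      (S 1%N 2%N) (E r) (a 0%N x) (a 1%N x) (a 2%N x) (r x).
    by clear => *; field.
  rewrite state_sum // /s !big_cons big_nil /= e1 !a0 // -!/(S _ _).
  move: (q 0%N) (q 1%N) (q 2%N) (S 0%N 0%N) (S 1%N 1%N) (S 2%N 2%N) (S 0%N 1%N) (S 0%N 2%N)
      (S 1%N 2%N) (E r); by clear => *; field.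
rewrite VE; rewrite EG in G0; rewrite VS in G0 *.
move: (S 0%N 0%N) (S 1%N 1%N) (S 2%N 2%N) (S 0%N 1%N) (S 0%N 2%N) (S 1%N 2%N) G0.
clear => u v w p q s G0.
(* The squared trace of S is at most three times the sum of the squares of its entries. *)
have := sqr_ge0 (u - v); have := sqr_ge0 (u - w); have := sqr_ge0 (v - w).
have := sqr_ge0 p; have := sqr_ge0 q; have := sqr_ge0 s.
lra.
Qed.

(** A state of nearly maximal variance V stands in for an optimal measure, so no compactness is
    used. Admixing point masses puts every point of O at squared distance at most V + del' from its
    center; [variance_bound] then reads V^2 <= 3 V (dd / 2 - V) up to an error, that is V <= 3 dd /
    8. *)
Theorem jung (D dd del : R) : O !=set0 -> (forall x, O x -> `|x| <= D) ->
  (forall x y, O x -> O y -> dist2 x y <= dd) -> 0 < del ->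
  exists m, forall x, O x -> dist2 x m <= 3 / 8 * dd + del.
Proof.
move=> [x0 Ox0] bO hdd del0; have D0 : 0 <= D by apply: le_trans (bO _ Ox0).
pose B := 3 * D ^+ 2; have B0 : 0 <= B by rewrite mulr_ge0 ?sqr_ge0.
pose S : set R := [set v | exists2 E, state E & v = variance3 E].
have VB E : state E -> variance3 E <= B.
  move=> hE; have [ad sc pos e1] := hE.
  have q0 : 0 <= sum3 (fun i => E (@coord R i) ^+ 2) by rewrite /sum3 !addr_ge0 ?sqr_ge0.
  have h : 0 <= E (fun x => B * 1 + -1 * sum3 (fun i => coord i x ^+ 2)).
    by apply: pos => x /bO /euclid_sup; rewrite -/B mulr1 mulN1r subr_ge0.
  move: h; rewrite ad !sc e1 mulr1 mulN1r /variance3.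
  by move: (E _) (sum3 _) q0 => e q q0; lra.
have hS : has_sup S.
  split; first by exists (variance3 (fun f => f x0)), (fun f => f x0) => //; exact: state_eval.
  by exists B => _ [E hE ->]; exact: VB.
pose del' := del / 2; have d0 : 0 < del' by rewrite divr_gt0.
(* The weight t is so small that the second-order term t^2 (V + del') stays below t del' / 2. *)
have [t /andP[t0 t1] ht] : exists2 t, 0 < t <= 1 & (B + del' + 1) * t <= Num.min (del' / 2) (1 / 2).
  by apply: small_pos; [rewrite !addr_ge0 // ltW|rewrite lt_min !divr_gt0].
move: ht; rewrite le_min => /andP[ht1 ht2].
have tb : t <= 1 / 2.
  by apply: le_trans ht2; rewrite ler_peMl ?(ltW t0) // lerDr addr_ge0 // ltW.
have t2 : 0 < t * (del' / 2) by rewrite mulr_gt0 // divr_gt0.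
have [_ [E hE ->] hsup] := sup_adherent t2 hS.
have V0 : 0 <= variance3 E.
  rewrite -variance_center //; have [_ _ pos _] := hE; apply: pos => x _.
  by rewrite /dist2 /sum3 !addr_ge0 ?sqr_ge0.
set V := variance3 E in hsup V0.
have key x : O x -> dist2 x (center E) <= V + del'.
  move=> Ox; have t01 : 0 <= t <= 1 by rewrite (ltW t0).
  have SE : S ((1 - t) * V + t * (1 - t) * dist2 x (center E)).
    exists (fun f => (1 - t) * E f + t * f x); last by rewrite variance3_mix.
    by apply: state_mix => //; exact: state_eval.
  have H := sup_upper_bound hS SE.
  have VB' : V <= B by exact: VB.
  have tp : 0 < t * (1 - t) by rewrite mulr_gt0 // subr_gt0; move: tb; clear; lra.
  rewrite -(ler_pM2l tp).
  have e1 : t * t * (V + del') <= t * (del' / 2).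
    rewrite -mulrA ler_pM2l //; apply: le_trans ht1; rewrite mulrC ler_pM2r //.
    by move: VB'; clear; lra.
  by move: H hsup e1; move: (sup S) (dist2 _ _) => s q; clear; lra.
have rho0 : 0 < V + del' by rewrite ltr_wpDl.
have := variance_bound hE hdd key; rewrite -/V => h.
exists (center E) => x /key hx; apply: (le_trans hx).
have e2 : del' * 2 = del by rewrite divfK.
have h2 : (V + del') * (8 / 3 * (V + del')) <= (V + del') * (dd + 8 / 3 * del).
  have : 0 <= del' ^+ 2 by exact: sqr_ge0.
  have : 0 <= V * del' by rewrite mulr_ge0 // ltW.
  by rewrite -e2; move: h d0 V0; clear; nra.
by move: h2; rewrite ler_pM2l //; clear; lra.
Qed.

End Jung.

(** * Square integrable functions on the domain *)

Section SquareIntegrable.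
Variables (R : realType) (O : set (pt R)).
Hypothesis mO : measurable O.
Implicit Types (f g h p : pt R -> R) (u v : vfield R) (x : pt R).

Let integ f := (@lam3 R).-integrable O (EFin \o f).

Lemma L2_integrable f : L2 O f -> integ (fun x => f x ^+ 2).
Proof.
move=> [mf hf]; apply/integrableP; split.
  by apply/measurable_EFinP; exact: measurable_funX.
apply: le_lt_trans hf; rewrite le_eqVlt; apply/orP; left; apply/eqP.
by apply: eq_integral => x _ /=; rewrite ger0_norm // sqr_ge0.
Qed.

Lemma integrable_L2 f : measurable_fun O f -> integ (fun x => f x ^+ 2) -> L2 O f.
Proof.
move=> mf /integrableP[_ hf]; split => //.
apply: le_lt_trans hf; rewrite le_eqVlt; apply/orP; left; apply/eqP.
by apply: eq_integral => x _ /=; rewrite ger0_norm // sqr_ge0.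
Qed.

Lemma integ_le f g : measurable_fun O f -> integ g -> (forall x, `|f x| <= g x) -> integ f.
Proof.
move=> mf ig h; apply: le_integrable ig => //; first exact/measurable_EFinP.
by move=> x _; rewrite /= lee_fin (le_trans (h x)) // ler_norm.
Qed.

Lemma integ_add f g : integ f -> integ g -> integ (fun x => f x + g x).
Proof. by move=> hf hg; have := @integrableD _ _ R (@lam3 R) O mO _ _ hf hg; congr (integrable _ _ _). Qed.

Lemma integ_scale (c : R) f : integ f -> integ (fun x => c * f x).
Proof. by move=> hf; have := @integrableZl _ _ R (@lam3 R) O mO c _ hf; congr (integrable _ _ _). Qed.

Lemma L2_integ f g : L2 O f -> L2 O g -> integ (fun x => f x * g x).
Proof.
move=> hf hg; have s := integ_add (L2_integrable hf) (L2_integrable hg).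
apply: integ_le s _; first by apply: measurable_funM; [exact: hf.1|exact: hg.1].
move=> x; rewrite normrM -(real_normK (num_real (f x))) -(real_normK (num_real (g x))).
move: (normr_ge0 (f x)) (normr_ge0 (g x)); move: `|f x| `|g x| => a b a0 b0.
by have := sqr_ge0 (a - b); have := mulr_ge0 a0 b0; rewrite sqrrB; lra.
Qed.

Lemma L2_add f g : L2 O f -> L2 O g -> L2 O (fun x => f x + g x).
Proof.
move=> hf hg; have mfg : measurable_fun O (fun x => f x + g x).
  by apply: measurable_funD; [exact: hf.1|exact: hg.1].
apply: integrable_L2 => //.
have s := integ_scale 2 (integ_add (L2_integrable hf) (L2_integrable hg)).
apply: integ_le s _; first exact: measurable_funX.
move=> x; rewrite ger0_norm ?sqr_ge0 //.
by have := sqr_ge0 (f x - g x); rewrite sqrrB sqrrD; lra.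
Qed.

Lemma L2_scale (c : R) f : L2 O f -> L2 O (fun x => c * f x).
Proof.
move=> hf; have mf : measurable_fun O (fun x => c * f x).
  by apply: measurable_funM => //; exact: hf.1.
apply: integrable_L2 => //; have := integ_scale (c ^+ 2) (L2_integrable hf).
by congr (integrable _ _ _); apply/funext => x /=; rewrite exprMn.
Qed.

Lemma L2_sub f g : L2 O f -> L2 O g -> L2 O (fun x => f x - g x).
Proof.
by move=> hf /(L2_scale (-1)) hg; have := L2_add hf hg; under eq_fun do rewrite mulN1r.
Qed.

Lemma L2_bounded_mul (e f : pt R -> R) (M : R) : measurable_fun O e ->
  {ae @lam3 R, forall x, O x -> `|e x| <= M} -> L2 O f -> L2 O (fun x => e x * f x).
Proof.
move=> me ae hf; have mef : measurable_fun O (fun x => e x * f x).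
  by apply: measurable_funM => //; exact: hf.1.
split => //.
have /integrableP[ms hs] := integ_scale (M ^+ 2) (L2_integrable hf).
apply: le_lt_trans hs; apply: ae_ge0_le_integral => //.
- by move=> x _; rewrite lee_fin sqr_ge0.
- by apply/measurable_EFinP; exact: measurable_funX.
- exact: measurableT_comp.
- apply: (@negligibleS _ _ _ (@lam3 R) _ _ _ ae) => x /= nh h; apply: nh => Ox; rewrite /= lee_fin (le_trans _ (ler_norm _)) // exprMn.
  rewrite ler_wpM2r ?sqr_ge0 // -(real_normK (num_real (e x))) ler_pXn2r ?nnegrE //.
    exact: h.
  exact: le_trans (h Ox).
Qed.

Lemma ipC f g : ip O f g = ip O g f.
Proof. by rewrite /ip; under eq_fun do rewrite mulrC. Qed.

Lemma ip_add f g h : L2 O f -> L2 O g -> L2 O h ->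
  ip O (fun x => f x + g x) h = ip O f h + ip O g h.
Proof.
move=> hf hg hh; rewrite /ip -RintegralD //; [|exact: L2_integ|exact: L2_integ].
by under eq_fun do rewrite mulrDl.
Qed.

Lemma ip_scale (c : R) f h : L2 O f -> L2 O h -> ip O (fun x => c * f x) h = c * ip O f h.
Proof.
move=> hf hh; rewrite /ip -RintegralZl //; last exact: L2_integ.
by under eq_fun do rewrite -mulrA.
Qed.

Lemma ip_ge0 f : 0 <= ip O f f.
Proof. by apply: Rintegral_ge0 => x _; rewrite -expr2 sqr_ge0. Qed.

Lemma ip_sqr_add f g (t : R) : 0 < t -> L2 O f -> L2 O g ->
  ip O (fun x => f x + g x) (fun x => f x + g x) <=
  (1 + t) * ip O f f + (1 + t^-1) * ip O g g.
Proof.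
move=> t0 hf hg; have iff := L2_integ hf hf; have igg := L2_integ hg hg.
rewrite /ip -(@RintegralZl _ _ R (@lam3 R) O _ (1 + t) mO iff) -(@RintegralZl _ _ R (@lam3 R) O _ (1 + t^-1) mO igg).
rewrite -(@RintegralD _ _ R (@lam3 R) O _ _ mO (integ_scale _ iff) (integ_scale _ igg)).
apply: le_Rintegral => //; [by apply: L2_integ; exact: L2_add|by apply: integ_add; exact: integ_scale|].
by move=> x _; rewrite -!expr2; exact: sqr_add_le.
Qed.

Lemma ip_young f g (c : R) : 0 < c -> L2 O f -> L2 O g ->
  - (2 * ip O f g) <= ip O f f / c + c * ip O g g.
Proof.
move=> c0 hf hg; have hcg := L2_scale c hg; have := ip_ge0 (fun x => f x + c * g x).
have hs := L2_add hf hcg.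
have e1 : ip O f (fun x => f x + c * g x) = ip O f f + c * ip O f g.
  by rewrite ipC ip_add // ip_scale // (ipC g f).
have e2 : ip O g (fun x => f x + c * g x) = ip O f g + c * ip O g g.
  by rewrite ipC ip_add // ip_scale.
rewrite ip_add // ip_scale // e1 e2.
move: (ip O f f) (ip O f g) (ip O g g) => a b d h.
rewrite -subr_ge0; have -> : a / c + c * d - - (2 * b) = (a + c * b + (c * b + c * (c * d))) / c.
  by field; rewrite gt_eqF.
by rewrite divr_ge0 ?(ltW c0) //; move: h; lra.
Qed.

Lemma ip_J f g : (forall x, ~ O x -> f x = 0) -> ip O f g = J (fun x => f x * g x).
Proof.
move=> f0; rewrite /ip Rintegral_mkcond /J; congr Rintegral; apply/funext => x.
rewrite patchE; case: ifPn => //; rewrite notin_setE => /f0 ->.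
by rewrite mul0r.
Qed.

Lemma Cc_L2 f : Cc f -> L2 O f.
Proof.
move=> cf; apply: integrable_L2; first by apply: measurable_funTS; apply: measurable_cont; exact: cf.1.
exact: integrableS (Cc_integrable (Cc_sqr cf)).
Qed.

End SquareIntegrable.

(** The parameter tau is the loss in lam, the weight in Young's inequality, and, squared, the error
    of approximation, so that (1 + 1 / tau) E <= 2 tau for both errors. *)
Lemma passage_arith (R : realType) (lam tau A Q Z E1 E2 D1 : R) : 0 < lam -> 0 < tau <= 1 -> tau <= lam / 2 ->
  0 <= A -> 0 <= Z -> 0 <= Q -> E1 <= tau ^+ 2 -> E2 <= tau ^+ 2 ->
  (lam - tau) * Z <= (1 + 3 * tau) * Q + tau ->
  Q <= (1 + tau) * A + (1 + tau^-1) * E2 ->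
  D1 <= (1 + tau) * Z + (1 + tau^-1) * E1 ->
  lam * D1 <= A + (15 * A + 18 + 2 * lam + (2 / lam) * (16 * A + 18 + 2 * lam)) * tau.
Proof.
move=> l0 /andP[t0 t1] tl A0 Z0 Q0 hE1 hE2 hZ hQ hD.
have ti : (1 + tau^-1) * tau ^+ 2 <= 2 * tau.
  have -> : (1 + tau^-1) * tau ^+ 2 = tau * tau + tau by field; rewrite gt_eqF.
  have h : tau * tau <= tau * 1 by rewrite ler_pM2l.
  by move: h; clear; lra.
have T0 : 0 < 1 + tau^-1 by rewrite addr_gt0 // invr_gt0.
have hE1' : (1 + tau^-1) * E1 <= 2 * tau by apply: le_trans ti; rewrite ler_pM2l.
have hE2' : (1 + tau^-1) * E2 <= 2 * tau by apply: le_trans ti; rewrite ler_pM2l.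
have hQ' : Q <= (1 + tau) * A + 2 * tau by lra.
have hD' : D1 <= (1 + tau) * Z + 2 * tau by lra.
have mu0 : 0 < lam - tau by lra.
have s : tau * tau <= tau by rewrite ler_piMr // ltW.
have s3 : tau * tau * tau <= tau by rewrite (le_trans _ s) // ler_piMr // mulr_ge0 // ltW.
have sA : tau * tau * A <= tau * A by rewrite ler_wpM2r.
have s3A : tau * tau * tau * A <= tau * A by rewrite ler_wpM2r.
have k1 : (lam - tau) * D1 <= A + tau * (15 * A + 18 + 2 * lam).
  have a1 : (lam - tau) * D1 <= (1 + tau) * ((lam - tau) * Z) + (lam - tau) * (2 * tau).
    have := hD'; rewrite -(ler_pM2l mu0) => /le_trans; apply.
    by rewrite mulrDr [(lam - tau) * ((1 + tau) * _)]mulrCA.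
  have a2 : (1 + tau) * ((lam - tau) * Z) <= (1 + tau) * ((1 + 3 * tau) * ((1 + tau) * A + 2 * tau) + tau).
    rewrite ler_pM2l ?addr_gt0 //; apply: (le_trans hZ); rewrite lerD2r ler_pM2l //.
    by rewrite addr_gt0 // mulr_gt0.
  have a3 : 0 <= tau * tau by rewrite mulr_ge0 // ltW.
  have a4 : 0 <= tau * A by rewrite mulr_ge0 // ltW.
  by move: a1 a2 s s3 sA s3A a3 a4; clear -t0; lra.
have k2 : D1 <= (2 / lam) * (16 * A + 18 + 2 * lam).
  have [d0|d0] := leP D1 0.
    by apply: (le_trans d0); rewrite mulr_ge0 ?divr_ge0 ?(ltW l0) // !addr_ge0 // ?mulr_ge0 // ltW.
  have h1 : lam / 2 * D1 <= 16 * A + 18 + 2 * lam.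
    apply: (@le_trans _ _ ((lam - tau) * D1)); first by rewrite ler_pM2r //; lra.
    apply: (le_trans k1).
    have : tau * (15 * A + 18 + 2 * lam) <= 1 * (15 * A + 18 + 2 * lam).
      by rewrite ler_wpM2r // !addr_ge0 // ?mulr_ge0 // ltW.
    by lra.
  have -> : D1 = (2 / lam) * (lam / 2 * D1) by field; rewrite gt_eqF.
  by rewrite ler_wpM2l // divr_ge0 // ltW.
have k3 : tau * D1 <= tau * ((2 / lam) * (16 * A + 18 + 2 * lam)) by rewrite ler_pM2l.
by move: k1 k3; move: (2 / lam * _) => b; clear; lra.
Qed.

(** * From test fields to the energy estimate for u *)

Section Reduction.
Variables (R : realType) (O : set (pt R)).
Hypothesis mO : measurable O.
Implicit Types (f g p : pt R -> R) (u v w : vfield R) (x : pt R).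

Lemma ipv_sum3 u v : ipv O u v = sum3 (fun i => ip O (u i) (v i)).
Proof. exact: (sum3E (fun i => ip O (u i) (v i))). Qed.

Lemma ipv_ge0 u : 0 <= ipv O u u.
Proof. by rewrite ipv_sum3 /sum3 !addr_ge0 ?ip_ge0. Qed.

Lemma test_fun_partial i f : test_fun O f -> test_fun O (partial i f).
Proof.
move=> [sf [K [cK KO fK]]]; split.
  by apply/smooth_Ck; apply: smth_partial; apply/smooth_Ck.
exists K; split => // x nK; have cl : closed K.
  by apply: compact_closed => //; exact: norm_hausdorff.
rewrite (@partial_near _ i f (fun=> 0) x) ?partial_cst //.
have := closed_openC cl; rewrite openE => /(_ x nK).
by rewrite /interior; apply: filterS => y; exact: fK.
Qed.

Lemma test_fun_out f x : test_fun O f -> ~ O x -> f x = 0.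
Proof. by move=> [_ [K [_ KO fK]]] nO; apply: fK => /KO. Qed.

Variable D : R.
Hypothesis bO : forall x, O x -> `|x| <= D.

Lemma test_fun_Cc f : test_fun O f -> Cc f.
Proof. by move=> tf; apply: smth_Cc; [exact: test_fun_smth tf|exact: test_fun_bsupp bO tf]. Qed.

Lemma test_fun_L2 f : test_fun O f -> L2 O f.
Proof. by move=> /test_fun_Cc; exact: Cc_L2. Qed.

Lemma ipv_J v : (forall i, (i < 3)%N -> Cc (v i)) ->
  (forall i x, (i < 3)%N -> ~ O x -> v i x = 0) -> ipv O v v = J (nrm2 v).
Proof.
move=> cv v0; rewrite ipv_sum3 /nrm2 /sum3.
have c i : (i < 3)%N -> Cc (fun x => v i x ^+ 2) by move=> hi; apply: Cc_sqr; exact: cv.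
have c01 := Cc_add (c 0%N isT) (c 1%N isT).
rewrite (J_add c01 (c 2%N isT)) (J_add (c 0%N isT) (c 1%N isT)).
have e i : (i < 3)%N -> ip O (v i) (v i) = J (fun x => v i x ^+ 2).
  by move=> hi; rewrite ip_J // => x; exact: v0.
by rewrite (e 0%N) // (e 1%N) // (e 2%N).
Qed.

Lemma ip_subC f g : ip O (fun x => f x - g x) (fun x => f x - g x) =
  ip O (fun x => g x - f x) (fun x => g x - f x).
Proof. by rewrite /ip; congr Rintegral; apply/funext => x; ring. Qed.

Lemma ipv_sqr_add (t : R) u v w : 0 < t -> L2v O u -> L2v O v ->
  (forall i x, w i x = u i x + v i x) ->
  ipv O w w <= (1 + t) * ipv O u u + (1 + t^-1) * ipv O v v.
Proof.
move=> t0 hu hv hw; rewrite !ipv_sum3.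
have h i : (i < 3)%N -> ip O (w i) (w i) <=
    (1 + t) * ip O (u i) (u i) + (1 + t^-1) * ip O (v i) (v i).
  move=> hi; have -> : w i = fun x => u i x + v i x by apply/funext => x.
  by apply: ip_sqr_add => //; [exact: hu|exact: hv].
rewrite /sum3; have := h 0%N isT; have := h 1%N isT; have := h 2%N isT.
move: (ip _ _ _) (ip _ _ _) (ip _ _ _) (ip _ _ _) (ip _ _ _) (ip _ _ _) (ip _ _ _) (ip _ _ _) (ip _ _ _).
by move=> *; lra.
Qed.

(** The test fields of [in_Rcirc] approximate u and their rotations approximate w, so the estimate
    for one of them, chosen far out in the sequence, passes to the pair with arbitrarily small
    loss. *)
Lemma gradient_approx_weak (lam eta : R) (m : pt R) u w : open O -> convex_set3 O -> O !=set0 ->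
  0 < lam -> (forall x, O x -> rad m lam x < 1) -> L2v O u -> L2v O w -> in_Rcirc O u w ->
  0 < eta -> exists2 p, test_fun O p &
    lam * ipv O (fun i x => u i x - partial i p x) (fun i x => u i x - partial i p x) <=
    ipv O w w + eta.
Proof.
move=> oO cO nO l0 hrad hu hw [chi [tchi [cu cw]]] eta0.
pose A := ipv O w w; have A0 : 0 <= A by exact: ipv_ge0.
pose B := 15 * A + 18 + 2 * lam + (2 / lam) * (16 * A + 18 + 2 * lam).
have l2 : 0 <= 2 * lam by rewrite mulr_ge0 // ltW.
have a1 : 0 <= 15 * A + 18 + 2 * lam by rewrite !addr_ge0 // mulr_ge0.
have a2 : 0 <= 16 * A + 18 + 2 * lam by rewrite !addr_ge0 // mulr_ge0.
have B0 : 0 <= B by rewrite /B addr_ge0 // mulr_ge0 // divr_ge0 // ltW.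
have e0 : 0 < Num.min eta (lam / 2) by rewrite lt_min eta0 divr_gt0.
have [tau /andP[t0 t1] ht] := small_pos (addr_ge0 B0 ler01) e0.
move: ht; rewrite le_min => /andP[ht1 ht2].
have hB : B * tau <= eta by apply: le_trans ht1; rewrite ler_pM2r // lerDl.
have tl : tau <= lam / 2 by apply: le_trans ht2; rewrite mulrDl mul1r lerDr mulr_ge0 // ltW.
have t20 : 0 < tau ^+ 2 by rewrite exprn_gt0.
have [n [hn1 hn2]] : exists n,
    ipv O (fun i x => chi n i x - u i x) (fun i x => chi n i x - u i x) <= tau ^+ 2 /\
    ipv O (fun i x => Defs.rot (chi n) i x - w i x) (fun i x => Defs.rot (chi n) i x - w i x) <= tau ^+ 2.
  have [N1 _ h1] : \forall k \near \oo, `|0 - ipv O (fun i x => chi k i x - u i x)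
      (fun i x => chi k i x - u i x)| < tau ^+ 2
    by move/cvgrPdist_lt: cu; exact.
  have [N2 _ h2] : \forall k \near \oo, `|0 - ipv O (fun i x => Defs.rot (chi k) i x - w i x)
      (fun i x => Defs.rot (chi k) i x - w i x)| < tau ^+ 2
    by move/cvgrPdist_lt: cw; exact.
  exists (maxn N1 N2); have := h1 _ (leq_maxl N1 N2); have := h2 _ (leq_maxr N1 N2).
  rewrite /= !sub0r !normrN => q2 q1.
  by split; [exact: le_trans (ler_norm _) (ltW q1)|exact: le_trans (ler_norm _) (ltW q2)].
have tl' : tau < lam by lra.
have t01 : 0 < tau <= 1 by rewrite t0.
have [p tp hp] := gradient_approx oO cO nO bO l0 hrad (tchi n) t01 tl'.
exists p => //; apply: (@le_trans _ _ (A + B * tau)); last by rewrite lerD2l.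
have Cchi i : (i < 3)%N -> Cc (chi n i) by move=> hi; apply: test_fun_Cc; exact: tchi.
have Cp i : Cc (partial i p) by apply: test_fun_Cc; exact: test_fun_partial.
have Cd i : (i < 3)%N -> Cc (fun x => chi n i x - partial i p x) by move=> hi; apply: Cc_sub; auto.
have tr i : test_fun O (partial i (chi n 0%N)) /\ test_fun O (partial i (chi n 1%N)) /\
    test_fun O (partial i (chi n 2%N)).
  by split; [|split]; apply: test_fun_partial; exact: tchi.
have Cr i : Cc (Defs.rot (chi n) i).
  have c j := test_fun_Cc (tr j).1; have c' j := test_fun_Cc (tr j).2.1.
  have c'' j := test_fun_Cc (tr j).2.2.
  by rewrite /Defs.rot; case: i => [|[|i]] /=; apply: Cc_sub; auto.
have r0 i x : ~ O x -> Defs.rot (chi n) i x = 0.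
  move=> nx; have c j := test_fun_out (tr j).1 nx; have c' j := test_fun_out (tr j).2.1 nx.
  have c'' j := test_fun_out (tr j).2.2 nx.
  by rewrite /Defs.rot; case: i => [|[|i]] /=; rewrite ?c ?c' ?c'' subrr.
have d0 i x : (i < 3)%N -> ~ O x -> chi n i x - partial i p x = 0.
  move=> hi nx; rewrite (test_fun_out (tchi n i hi) nx).
  by rewrite (test_fun_out (test_fun_partial i tp) nx) subrr.
rewrite -(ipv_J Cd d0) -(ipv_J (v := Defs.rot (chi n)) (fun i _ => Cr i) (fun i x _ => r0 i x)) in hp.
have L2chi i : (i < 3)%N -> L2 O (chi n i) by move=> hi; apply: Cc_L2 => //; exact: Cchi.
have L2d : L2v O (fun i x => chi n i x - partial i p x) by move=> i hi; apply: Cc_L2 => //; exact: Cd.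
have L2uc : L2v O (fun i x => u i x - chi n i x).
  by move=> i hi; apply: L2_sub => //; [exact: hu|exact: L2chi].
have L2rw : L2v O (fun i x => Defs.rot (chi n) i x - w i x).
  by move=> i hi; apply: L2_sub => //; [exact: Cc_L2|exact: hw].
have e1 : ipv O (fun i x => u i x - chi n i x) (fun i x => u i x - chi n i x) <= tau ^+ 2.
  by move: hn1; rewrite !ipv_sum3 /sum3 !(ip_subC (chi n _)).
apply: (passage_arith l0 t01 tl A0 (ipv_ge0 _) (ipv_ge0 _) e1 hn2 hp).
- by apply: ipv_sqr_add => // i x; rewrite addrC subrK.
- by apply: ipv_sqr_add => // i x; rewrite [RHS]addrC addrA subrK.
Qed.

(** The eps-norm of u - grad p is expanded and the cross term turned into (g, p) by the weak
    divergence. The Friedrichs inequalities in the three directions, weighted by [elow], add up to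
    exactly the multiple of |p|^2 that Young's inequality for (g, p) produces. *)
Lemma energy_bound (e u : vfield R) (g p : pt R -> R) (elow : nat -> R) (l : nat -> R) (eup : R) :
  (forall i, (i < 3)%N -> measurable_fun O (e i) /\
     exists M : R, {ae @lam3 R, forall x, O x -> `|e i x| <= M}) ->
  (forall i, (i < 3)%N -> 0 < elow i /\
     forall phi, L2 O phi -> elow i * ip O phi phi <= ip O (fun x => e i x * phi x) phi) ->
  (forall phi : vfield R, L2v O phi -> ipv O (epsmul e phi) phi <= eup * ipv O phi phi) ->
  (forall i, (i < 3)%N -> 0 < l i) -> (forall i x, (i < 3)%N -> O x -> 0 < coord i x < l i) ->
  L2v O u -> L2 O g -> weak_div O (epsmul e u) g -> test_fun O p ->
  ipv O (epsmul e u) u <=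
    eup * ipv O (fun i x => u i x - partial i p x) (fun i x => u i x - partial i p x)
    + ip O g g / (pi ^+ 2 * sum3 (fun i => elow i / l i ^+ 2)).
Proof.
move=> he hlow hup l0 hl hu hg hdiv tp.
have L2e i f : (i < 3)%N -> L2 O f -> L2 O (fun x => e i x * f x).
  by move=> hi hf; have [me [M hM]] := he i hi; exact: L2_bounded_mul hM hf.
have Lp := test_fun_L2 tp.
have Ldp i : L2 O (partial i p) by apply: test_fun_L2; exact: test_fun_partial.
pose q : vfield R := fun i x => u i x - partial i p x.
have Lq : L2v O q by move=> i hi; apply: L2_sub => //; exact: hu.
have exp i : (i < 3)%N -> ip O (epsmul e q i) (q i) = ip O (epsmul e u i) (u i)
    - 2 * ip O (epsmul e u i) (partial i p) + ip O (fun x => e i x * partial i p x) (partial i p).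
  move=> hi; have h1 := hu i hi; have h2 := Ldp i; have h3 := L2e i _ hi h1.
  have h4 := L2e i _ hi h2.
  have E1 h : L2 O h -> ip O (epsmul e q i) h =
      ip O (epsmul e u i) h - ip O (fun x => e i x * partial i p x) h.
    move=> hh; rewrite -[RHS]/(_ + - _) -mulN1r -ip_scale // -ip_add //; last exact: L2_scale.
    by congr (ip O _ h); apply/funext => x; rewrite /epsmul /q; ring.
  have E2 h : L2 O h -> ip O h (q i) = ip O h (u i) - ip O h (partial i p).
    move=> hh; rewrite !(ipC O h) -mulN1r -ip_scale // -ip_add //; last exact: L2_scale.
    by congr (ip O _ h); apply/funext => x; rewrite /q mulN1r.
  have sy : ip O (fun x => e i x * partial i p x) (u i) = ip O (epsmul e u i) (partial i p).
    by rewrite /ip /epsmul; congr Rintegral; apply/funext => x; ring.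
  by rewrite E1 ?E2 //; [rewrite sy; ring|exact: Lq].
have low i : (i < 3)%N -> elow i / l i ^+ 2 * pi ^+ 2 * ip O p p <=
    ip O (fun x => e i x * partial i p x) (partial i p).
  move=> hi; have [el hel] := hlow i hi; apply: le_trans (hel _ (Ldp i)).
  have sp := test_fun_smth tp; have bp := test_fun_bsupp bO tp.
  have slab x : p x = 0 \/ 0 < coord i x < l i.
    by have [Ox|nO] := pselect (O x); [right; exact: hl|left; exact: test_fun_out tp nO].
  have := friedrichs_slab hi (l0 i hi) sp bp slab.
  have J1 : J (fun x => p x ^+ 2) = ip O p p.
    by rewrite ip_J //; move=> x; exact: test_fun_out.
  have J2 : J (fun x => partial i p x ^+ 2) = ip O (partial i p) (partial i p).
    by rewrite ip_J //; move=> x; apply: test_fun_out; exact: test_fun_partial.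
  have ln : l i != 0 by rewrite gt_eqF // l0.
  rewrite J1 J2 -(ler_pM2l el) => h; apply: le_trans h; rewrite le_eqVlt; apply/orP; left; apply/eqP.
  by move: (ip O p p) (elow i) (l i) ln => a b c cn; field.
pose s := sum3 (fun i => elow i / l i ^+ 2).
have s0 : 0 < s.
  have h i : (i < 3)%N -> 0 < elow i / l i ^+ 2.
    by move=> hi; have [el _] := hlow i hi; rewrite divr_gt0 // exprn_gt0 // l0.
  by rewrite /s /sum3 !addr_gt0 // h.
have k0 : 0 < pi ^+ 2 * s by rewrite mulr_gt0 // exprn_gt0 // pi_gt0.
have y := ip_young mO k0 hg Lp; have up := hup q Lq; have dv := hdiv p tp.
rewrite (sum3E (fun i => ip O (epsmul e u i) (partial i p))) in dv.
rewrite -/s -/q; rewrite ipv_sum3 /sum3 !exp // in up.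
rewrite ipv_sum3; move: dv y up (low 0%N isT) (low 1%N isT) (low 2%N isT); rewrite /s /sum3.
move: (ip O g p) (ip O g g / _) (eup * _) (ip O p p) => gp G D1 pp.
move: (ip O (epsmul e u 0%N) (u 0%N)) (ip O (epsmul e u 1%N) (u 1%N)) (ip O (epsmul e u 2%N) (u 2%N)).
move: (ip O (epsmul e u 0%N) _) (ip O (epsmul e u 1%N) _) (ip O (epsmul e u 2%N) _).
move: (ip O _ (partial 0 p)) (ip O _ (partial 1 p)) (ip O _ (partial 2 p)).
by move: (elow 0%N / _) (elow 1%N / _) (elow 2%N / _) => *; lra.
Qed.

End Reduction.

(** * Diameter and the ball of the barrier *)

Section Diameter.
Variables (R : realType) (O : set (pt R)) (D : R).
Hypothesis bO : forall x, O x -> `|x| <= D.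
Implicit Types x y : pt R.

Lemma edist_sqr x y : Defs.edist x y ^+ 2 = dist2 x y.
Proof.
rewrite /Defs.edist (sum3E (fun i => (coord i x - coord i y) ^+ 2)) sqr_sqrtr //.
by rewrite /sum3 !addr_ge0 ?sqr_ge0.
Qed.

Lemma edist_ge0 x y : 0 <= Defs.edist x y. Proof. exact: sqrtr_ge0. Qed.

Lemma edist_le_diam x y : O x -> O y -> Defs.edist x y <= diam O.
Proof.
move=> Ox Oy; apply: ub_le_sup; last by exists x, y.
exists (Num.sqrt (3 * (2 * D) ^+ 2)) => _ [p [q [Op Oq ->]]].
rewrite /Defs.edist (sum3E (fun i => (coord i p - coord i q) ^+ 2)) ler_wsqrtr //.
have h : `|p - q| <= 2 * D.
  by rewrite (le_trans (ler_normB _ _)) // mulrDl mul1r lerD // bO.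
by have := euclid_sup h; rewrite /sum3 !coordB.
Qed.

Lemma diam_gt0 : open O -> O !=set0 -> 0 < diam O.
Proof.
move=> oO [x Ox]; have := oO _ Ox; rewrite /interior => /near_pt [d d0 hd].
have d2 : 0 < d / 2 by rewrite divr_gt0.
have nu : `|upd 0 x (coord 0 x + d / 2) - x| = d / 2.
  by rewrite normpt_upd addrAC subrr add0r gtr0_norm.
have Ou : O (upd 0 x (coord 0 x + d / 2)) by apply: hd; rewrite nu; lra.
apply: lt_le_trans (edist_le_diam Ou Ox).
rewrite lt_neqAle edist_ge0 andbT eq_sym; apply/eqP => e0.
have e1 : coord 0 (upd 0 x (coord 0 x + d / 2)) - coord 0 x = d / 2.
  by rewrite coord_upd addrAC subrr add0r.
have := edist_sqr (upd 0 x (coord 0 x + d / 2)) x; rewrite e0 expr0n /= /dist2 /sum3 e1.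
have := sqr_ge0 (coord 1 (upd 0 x (coord 0 x + d / 2)) - coord 1 x).
have := sqr_ge0 (coord 2 (upd 0 x (coord 0 x + d / 2)) - coord 2 x).
have : 0 < (d / 2) ^+ 2 by rewrite exprn_gt0.
by move: (_ ^+ 2) (_ ^+ 2) (_ ^+ 2) => p q r; lra.
Qed.

(* Jung's constant 3/8 and pi^2 < 32/3 leave room for the barrier of radius 2 / sqrt lam
   with lam = pi^2 / diam^2. *)
Lemma diam_barrier : open O -> O !=set0 ->
  exists m, forall x, O x -> rad m (pi ^+ 2 / diam O ^+ 2) x < 1.
Proof.
move=> oO nO; have d0 := diam_gt0 oO nO; set d := diam O in d0 *.
have dd0 : 0 < d ^+ 2 by rewrite exprn_gt0.
have hdd x y : O x -> O y -> dist2 x y <= d ^+ 2.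
  move=> Ox Oy; rewrite -edist_sqr ler_pXn2r ?nnegrE ?edist_ge0 ?(ltW d0) //.
  exact: edist_le_diam.
have del0 : 0 < d ^+ 2 / 100 by rewrite divr_gt0.
have [m hm] := jung nO bO hdd del0.
exists m => x Ox; have h := hm x Ox.
have p2 : pi ^+ 2 <= 256 / 25 :> R.
  have -> : 256 / 25 = (16 / 5) ^+ 2 :> R by field.
  by rewrite ler_pXn2r ?nnegrE ?pi_ge0 ?pi_upper // divr_ge0.
have -> : rad m (pi ^+ 2 / d ^+ 2) x = pi ^+ 2 / 4 * (dist2 x m / d ^+ 2).
  rewrite /rad /dist2 /sum3 -!expr2; move: (_ + _ + _) => z; field.
  by rewrite gt_eqF.
(* 3 / 8 + 1 / 100 = 77 / 200, and 256 / 25 / 4 times this number is 0.9856. *)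
have h2 : dist2 x m / d ^+ 2 <= 77 / 200 by rewrite ler_pdivrMr //; lra.
have q0 : 0 <= pi ^+ 2 / 4 :> R by rewrite divr_ge0 ?sqr_ge0.
apply: (@le_lt_trans _ _ (256 / 25 / 4 * (77 / 200))); last by lra.
rewrite ler_pM //; last by lra.
by rewrite divr_ge0 ?(ltW dd0) // /dist2 /sum3 !addr_ge0 ?sqr_ge0.
Qed.

End Diameter.

Theorem theorem3p6 (R : realType) (l1 l2 l3 : R) (O : set (pt R))
  (e : vfield R) (elow : nat -> R) (eup : R) :
  0 < l1 -> 0 < l2 -> 0 < l3 ->
  (* O is a bounded convex domain contained in the box *)
  open O -> O !=set0 -> measurable O -> convex_set3 O ->
  (forall x, O x -> [/\ 0 < x.1.1 < l1, 0 < x.1.2 < l2 & 0 < x.2 < l3]) ->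
  (* eps_i in L^oo(O), real valued *)
  (forall i, (i < 3)%N -> measurable_fun O (e i) /\
     exists M : R, {ae @lam3 R, forall x, O x -> `|e i x| <= M}) ->
  (* lower bounds *)
  (forall i, (i < 3)%N -> 0 < elow i /\
     forall phi, L2 O phi -> elow i * ip O phi phi <= ip O (fun x => e i x * phi x) phi) ->
  (* upper bound *)
  0 < eup ->
  (forall phi : vfield R, L2v O phi -> ipv O (epsmul e phi) phi <= eup * ipv O phi phi) ->
  tangential_maxwell_estimate O e
    (pi^-1 * Num.max
       (Num.sqrt (elow 0%N / l1 ^+ 2 + elow 1%N / l2 ^+ 2 + elow 2%N / l3 ^+ 2))^-1
       (Num.sqrt eup * diam O)).
Proof.
move=> l10 l20 l30 oO nO mO cO hbox he hlow eup0 hup u w g hu hw _ hrc hg hdiv.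
pose l i := if i == 0%N then l1 else if i == 1%N then l2 else l3.
have l0 i : (i < 3)%N -> 0 < l i by case: i => [|[|[|i]]].
have hl i x : (i < 3)%N -> O x -> 0 < Defs.coord i x < l i.
  by move=> hi /hbox []; case: i hi => [|[|[|i]]].
have bO x : O x -> `|x| <= l1 + l2 + l3.
  move=> Ox; rewrite normpt_le.
  have b i : (i < 3)%N -> `|Defs.coord i x| <= l1 + l2 + l3.
    move=> hi; have /andP[c0 c1] := hl i x hi Ox; rewrite gtr0_norm //.
    by move: c1; case: i hi {c0} => [|[|[|i]]] // _; rewrite /l /=; lra.
  by rewrite !b.
have d0 := diam_gt0 bO oO nO; have [m hm] := diam_barrier bO oO nO.
have p0 : 0 < pi :> R by exact: pi_gt0.
set d := diam O in d0 hm *; pose lam := pi ^+ 2 / d ^+ 2.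
have lam0 : 0 < lam by rewrite divr_gt0 // exprn_gt0.
pose s := sum3 (fun i => elow i / l i ^+ 2).
have es : elow 0%N / l1 ^+ 2 + elow 1%N / l2 ^+ 2 + elow 2%N / l3 ^+ 2 = s by [].
have s0 : 0 < s.
  have h i : (i < 3)%N -> 0 < elow i / l i ^+ 2.
    by move=> hi; have [el _] := hlow i hi; rewrite divr_gt0 // exprn_gt0 // l0.
  by rewrite /s /sum3 !addr_gt0 // h.
rewrite es; pose A := ipv O w w; pose G := ip O g g.
have A0 : 0 <= A by exact: ipv_ge0.
have G0 : 0 <= G by exact: ip_ge0.
(* The test function p depends on the loss eta but has disappeared from the bound, so eta can be
   sent to 0. *)
have main : ipv O (epsmul e u) u <= eup / lam * A + G / (pi ^+ 2 * s).
  apply/ler_addgt0Pr => eta eta0.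
  have e0 : 0 < eta * lam / eup by rewrite divr_gt0 // mulr_gt0.
  have [p tp hp] := gradient_approx_weak mO bO oO cO nO lam0 hm hu hw hrc e0.
  apply: (le_trans (energy_bound mO bO he hlow hup l0 hl hu hg hdiv tp)).
  rewrite addrAC lerD2r.
  have E (a b c t : R) : a != 0 -> b != 0 -> a / b * c + t = a / b * (c + t * b / a).
    by move=> an bn; field; rewrite an bn.
  rewrite E ?gt_eqF //.
  move: hp; move: (ipv O _ _) => z; rewrite mulrC -ler_pdivlMr // => hz.
  by rewrite mulrAC -mulrA ler_pM2l.
set C := pi^-1 * _.
have pi0 : 0 < pi^-1 :> R by rewrite invr_gt0.
have C1 : pi^-1 * (Num.sqrt s)^-1 <= C by rewrite ler_pM2l // le_max lexx.
have C2 : pi^-1 * (Num.sqrt eup * d) <= C by rewrite ler_pM2l // le_max lexx orbT.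
have q1 : 0 <= pi^-1 * (Num.sqrt s)^-1 by rewrite mulr_ge0 ?(ltW pi0) // invr_ge0 sqrtr_ge0.
have q2 : 0 <= pi^-1 * (Num.sqrt eup * d).
  by rewrite mulr_ge0 ?(ltW pi0) // mulr_ge0 ?sqrtr_ge0 // ltW.
have C0 : 0 <= C by exact: le_trans C1.
(* The two coefficients in [main] are the squares of the two entries of the maximum divided by pi,
   so C^2 dominates each of them. *)
have k1 : (pi ^+ 2 * s)^-1 <= C ^+ 2.
  have -> : (pi ^+ 2 * s)^-1 = (pi^-1 * (Num.sqrt s)^-1) ^+ 2.
    by rewrite exprMn !exprVn sqr_sqrtr ?(ltW s0) // invfM.
  by rewrite ler_pXn2r ?nnegrE.
have k2 : eup / lam <= C ^+ 2.
  have -> : eup / lam = (pi^-1 * (Num.sqrt eup * d)) ^+ 2.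
    have E (a b c : R) : b != 0 -> c != 0 -> a / (b ^+ 2 / c ^+ 2) = b^-1 ^+ 2 * (a * c ^+ 2).
      by move=> bn cn; field; rewrite bn cn.
    by rewrite !exprMn sqr_sqrtr ?(ltW eup0) // /lam E // gt_eqF.
  by rewrite ler_pXn2r ?nnegrE.
have -> : C * Num.sqrt (ip O g g + ipv O w w) = Num.sqrt (C ^+ 2 * (G + A)).
  by rewrite sqrtrM ?sqr_ge0 // sqrtr_sqr ger0_norm.
apply: ler_wsqrtr; apply: (le_trans main).
have h1 := ler_wpM2r A0 k2; have h2 := ler_wpM2r G0 k1.
by rewrite [C ^+ 2 * _]mulrDr [G / _]mulrC [leRHS]addrC; exact: lerD h1 h2.
Qed.
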